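(* Let $M$ be a locally compact separable metrizable topological space and let $X$ be a Hunt process on $(M,\mathscr{B}(M))$. Let $U$ be a non-empty open subset of $M$, let $B\in\mathscr{B}(M)$ satisfy $\overline{B}\subset U$, and define stopping times $\tau_n,\sigma_n$, $n\in\mathbb{N}=\{1,2,\dots\}$, by $\tau_1:=\tau_U$ and inductively $$\sigma_n:=\dot\sigma_{B,\tau_n},\qquad \tau_{n+1}:=\tau_{U,\sigma_n},\qquad n\in\mathbb{N}.$$ Then for any Borel measurable function $u:M\to[-\infty,\infty]$ that is either $[0,\infty]$-valued or bounded and satisfies $u|_{M\setminus B}=0$, and for any $(t,x)\in[0,\infty)\times M$, $$\mathcal{P}_tu(x)=\mathcal{P}^U_tu(x)+\sum_{n\in\mathbb{N}}\mathbb{E}_x\bigl[\mathbf{1}_{\{\sigma_n\le t\}}\,\mathcal{P}^U_{t-\sigma_n}u(X_{\sigma_n})\bigr].$$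
   Context: Conventions: $\inf\emptyset:=\infty$; $[\infty,\infty):=\emptyset$; $\mathscr{B}(E)$ is the Borel $\sigma$-field of $E$; $\overline{B}$ is the closure of $B$ in $M$. $M_\Delta=M\cup\{\Delta\}$ is the one-point compactification of $M$; functions on $M$ are extended by $0$ at $\Delta$. A Hunt process $X=(\Omega,\mathscr{M},\{X_t\}_{t\in[0,\infty]},\{\mathbb{P}_x\}_{x\in M_\Delta})$ on $(M,\mathscr{B}(M))$ consists of a measurable space $(\Omega,\mathscr{M})$, measurable maps $X_t:\Omega\to M_\Delta$, probability measures $\mathbb{P}_x$ (expectation $\mathbb{E}_x$) and shift operators $\theta_t:\Omega\to\Omega$ with $X_s\circ\theta_t=X_{s+t}$, such that, with $\zeta(\omega):=\inf\{t\in[0,\infty)\mid X_t(\omega)=\Delta\}$ (life time), $X_t(\omega)=\Delta$ for all $t\in[\zeta(\omega),\infty]$; for every $\omega$ the path $[0,\infty)\ni t\mapsto X_t(\omega)\in M_\Delta$ is right-continuous with left limits in $M_\Delta$ on $(0,\infty)$; it is a normal Markov process ($\mathbb{P}_x[X_0=x]=1$, $x\mapsto\mathbb{P}_x[X_t\in A]$ Borel for $A\in\mathscr{B}(M)$, $\mathbb{P}_\Delta[X_t=\Delta]=1$); and its minimum completed admissible filtration $\mathscr{F}_*=\{\mathscr{F}_t\}_{t\in[0,\infty]}$ is right-continuous and $X$ is strong Markov and quasi-left-continuous with respect to $\mathscr{F}_*$. For $B\subset M_\Delta$: $\tau_B:=\inf\{t\in[0,\infty)\mid X_t\in M_\Delta\setminus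 B\}$. For $\sigma:\Omega\to[0,\infty]$ and $B\subset M_\Delta$: $\dot\sigma_{B,\sigma}(\omega):=\inf\{t\in[\sigma(\omega),\infty)\mid X_t(\omega)\in B\}$ and $\tau_{B,\sigma}:=\dot\sigma_{M_\Delta\setminus B,\sigma}$; for Borel $B$ and an $\mathscr{F}_*$-stopping time $\sigma$ these are $\mathscr{F}_*$-stopping times. $X_\sigma(\omega):=X_{\sigma(\omega)}(\omega)$. For $u$ Borel on $M$, non-negative or bounded: $\mathcal{P}_tu(x):=\mathbb{E}_x[u(X_t)]$ and $\mathcal{P}^U_tu(x):=\mathbb{E}_x[u(X_t)\mathbf{1}_{\{t<\tau_U\}}]$ for $x\in M$. *)

(* Defs.v *)
From HB Require Import structures.
From mathcomp Require Import all_boot all_order all_algebra.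
From mathcomp Require Import all_classical all_reals all_analysis.
From mathcomp Require Import measurable_realfun.

Set Implicit Arguments.
Unset Strict Implicit.
Unset Printing Implicit Defensive.
Import Order.TTheory GRing.Theory Num.Theory.
Import numFieldNormedType.Exports.

Local Open Scope classical_set_scope.
Local Open Scope ring_scope.
Local Open Scope ereal_scope.

Definition separable_space (T : topologicalType) : Prop :=
  exists2 D : set T, countable D & dense D.

Definition metrizable (R : realType) (T : topologicalType) : Prop :=
  exists rho : T -> T -> R,
    [/\ forall x y, (rho x y = 0 <-> x = y)%R,
        forall x y, rho x y = rho y x,
        forall x y z, (rho x z <= rho x y + rho y z)%R &
        forall (x : T) (A : set T),
          nbhs x A <-> exists2 e : R, (0 < e)%R & [set y | (rho x y < e)%R] `<=` A].

Definition borel (T : topologicalType) : set (set T) := <<s @open T >>.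

Definition measurable_wrt (T : Type) (G : set (set T)) (R : realType)
    (f : T -> \bar R) : Prop :=
  forall V : set (\bar R), measurable V -> G (f @^-1` V).

(* Integral against the completion of mu. The events attached to hitting times
   belong only to the completed filtration, hence need not be measurable sets
   of the original space. *)
Definition completed_expectation (d : measure_display) (T : measurableType d)
    (R : realType) (mu : probability T R) (f : T -> \bar R) : \bar R :=
  \int[@completed_measure_extension _ _ _ mu]_w f w.

(* f is a version of the conditional probability of A given G, where E is the
   expectation. *)
Definition cond_prob_version (T : Type) (R : realType)
    (E : (T -> \bar R) -> \bar R) (G : set (set T)) (A : set T)
    (f : T -> \bar R) : Prop :=
  measurable_wrt G f /\
  forall L, G L ->
    E (fun w => (\1_(L `&` A) w)%:E) = E (fun w => (\1_L w)%:E * f w).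

(* A filtration (F_t), t in [0, +oo], is a function F on \bar R of which only
   the values at t >= 0 are used; likewise for processes. *)
Definition stopping_time (T : Type) (R : realType)
    (F : \bar R -> set (set T)) (sigma : T -> \bar R) : Prop :=
  (forall w, 0 <= sigma w) /\
  (forall t, 0 <= t -> F t [set w | sigma w <= t]).

Definition stopped_sigma_field (T : Type) (R : realType)
    (F : \bar R -> set (set T)) (sigma : T -> \bar R) : set (set T) :=
  [set A | F +oo A /\ forall t, 0 <= t -> F t (A `&` [set w | sigma w <= t])].

Definition right_continuous_filtration (T : Type) (R : realType)
    (F : \bar R -> set (set T)) : Prop :=
  forall t : R, (0 <= t)%R -> F t%:E = \bigcap_(s in [set s | t%:E < s]) F s.

(* M_Delta; the cemetery Delta is None, and it is isolated if M is compact. *)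
Notation cemetery_ext M := (one_point_compactification M).

Notation borel_cemetery_ext M :=
  (g_sigma_algebraType (@open (one_point_compactification M))).

Definition ext0 (M : Type) (R : realType) (u : M -> \bar R)
    (y : cemetery_ext M) : \bar R :=
  if y is Some x then u x else 0.

Section process.
Context (R : realType) (M : topologicalType) (d : measure_display)
  (Omega : measurableType d).
Variables (X : \bar R -> Omega -> cemetery_ext M)
  (P : cemetery_ext M -> probability Omega R).

Definition life_time (w : Omega) : \bar R :=
  ereal_inf [set t%:E | t in [set t : R | (0 <= t)%R /\ X t%:E w = None]].

(* inf {t in [sigma, +oo) | X_t in B}; it is +oo if there is no such t. *)
Definition hitting_after (B : set (cemetery_ext M)) (sigma : Omega -> \bar R)
    (w : Omega) : \bar R :=
  ereal_inf [set t%:E | t in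
    [set t : R | [/\ (0 <= t)%R, sigma w <= t%:E & B (X t%:E w)]]].

Definition exit_after (B : set (cemetery_ext M)) (sigma : Omega -> \bar R) :
    Omega -> \bar R :=
  hitting_after (~` B) sigma.

Definition exit_time (B : set (cemetery_ext M)) : Omega -> \bar R :=
  exit_after B (fun=> 0).

Definition Ex (x : cemetery_ext M) (f : Omega -> \bar R) : \bar R :=
  completed_expectation (P x) f.

(* The expectation for the initial law mu, i.e. for the mixture
   P_mu = \int P_x mu(dx). *)
Definition Emu (mu : probability (borel_cemetery_ext M) R)
    (f : Omega -> \bar R) : \bar R :=
  completed_expectation mu (fun x => Ex x f).

Definition Pmu (mu : probability (borel_cemetery_ext M) R) (A : set Omega) :
    \bar R :=
  Emu mu (fun w => (\1_A w)%:E).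

Definition natural_filtration (t : \bar R) : set (set Omega) :=
  <<s [set A | exists s V, [/\ 0 <= s, s <= t, borel V & A = X s @^-1` V]] >>.

Definition null_sets (mu : probability (borel_cemetery_ext M) R) :
    set (set Omega) :=
  [set N | exists L, [/\ natural_filtration +oo L, N `<=` L & Pmu mu L = 0]].

(* The minimum completed admissible filtration: the intersection over all
   initial laws mu of the P_mu-augmentations of the natural filtration. *)
Definition completed_filtration (t : \bar R) : set (set Omega) :=
  [set A | forall mu : probability (borel_cemetery_ext M) R,
     <<s natural_filtration t `|` null_sets mu >> A].

Definition markov_property : Prop :=
  forall (x : cemetery_ext M) (s t : R) (A : set (cemetery_ext M)),
    (0 <= s)%R -> (0 <= t)%R -> borel A ->
    cond_prob_version (Ex x) (natural_filtration s%:E)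
      (X (s + t)%:E @^-1` A)
      (fun w => P (X s%:E w) (X t%:E @^-1` A)).

Definition strong_markov_property (F : \bar R -> set (set Omega)) : Prop :=
  forall (sigma : Omega -> \bar R), stopping_time F sigma ->
  forall (mu : probability (borel_cemetery_ext M) R) (t : R)
      (A : set (cemetery_ext M)),
    (0 <= t)%R -> borel A ->
    cond_prob_version (Emu mu) (stopped_sigma_field F sigma)
      [set w | A (X (sigma w + t%:E) w)]
      (fun w => P (X (sigma w) w) (X t%:E @^-1` A)).

Definition quasi_left_continuous (F : \bar R -> set (set Omega)) : Prop :=
  forall (s : nat -> Omega -> \bar R) (sigma : Omega -> \bar R),
    (forall n, stopping_time F (s n)) ->
    (forall w, {homo s^~ w : m n / (m <= n)%N >-> m <= n}) ->
    (forall w, s n w @[n --> \oo] --> sigma w) ->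
  forall mu : probability (borel_cemetery_ext M) R,
    Pmu mu [set w | X (s n w) w @[n --> \oo] --> X (sigma w) w /\
                    sigma w < +oo] =
    Pmu mu [set w | sigma w < +oo].

Record hunt_process (theta : \bar R -> Omega -> Omega) : Prop := HuntProcess {
  hunt_measurable : forall t, 0 <= t -> forall A : set (cemetery_ext M),
    borel A -> measurable (X t @^-1` A) ;
  hunt_shift : forall s t w, 0 <= s -> 0 <= t ->
    X s (theta t w) = X (s + t) w ;
  hunt_life_time : forall w t, life_time w <= t -> X t w = None ;
  hunt_right_continuous : forall w (t : R), (0 <= t)%R ->
    X s%:E w @[s --> t^'+] --> X t%:E w ;
  hunt_left_limits : forall w (t : R), (0 < t)%R ->
    exists l : cemetery_ext M, X s%:E w @[s --> t^'-] --> l ;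
  hunt_normal : forall x : M, P (Some x) (X 0 @^-1` [set Some x]) = 1 ;
  hunt_kernel : forall t, 0 <= t -> forall A : set M, borel A ->
    measurable_wrt (@borel M) (fun x => P (Some x) (X t @^-1` (Some @` A))) ;
  hunt_cemetery : forall t, 0 <= t -> P None (X t @^-1` [set None]) = 1 ;
  hunt_markov : markov_property ;
  hunt_filtration : right_continuous_filtration completed_filtration ;
  hunt_strong_markov : strong_markov_property completed_filtration ;
  hunt_quasi_left_continuous : quasi_left_continuous completed_filtration
}.

Definition semigroup (t : R) (u : M -> \bar R) (x : M) : \bar R :=
  Ex (Some x) (fun w => ext0 u (X t%:E w)).

Definition killed_semigroup (U : set M) (t : R) (u : M -> \bar R) (x : M) :
    \bar R :=
  Ex (Some x) (fun w =>
    ext0 u (X t%:E w) * (\1_[set w | (t%:E < exit_time (Some @` U) w)%E] w)%:E).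

End process.

(* Main.v *)
Require Import Defs.
From HB Require Import structures.
From mathcomp Require Import all_boot all_order all_algebra.
From mathcomp Require Import all_classical all_reals all_analysis.
From mathcomp Require Import measurable_realfun.
From mathcomp Require Import ring lra.

Set Implicit Arguments.
Unset Strict Implicit.
Unset Printing Implicit Defensive.
Import Order.TTheory GRing.Theory Num.Theory.
Import numFieldNormedType.Exports.

Local Open Scope classical_set_scope.
Local Open Scope ring_scope.
Local Open Scope ereal_scope.

(* The events {t < tau_1} and {sigma_n <= t < tau_{n+1}} are disjoint. Outside of
   their union X_t is not in B, so that u(X_t) = 0, unless t is at least
   T = sup tau_n = sup sigma_n. When T is finite, quasi-left-continuity applied to
   tau_n and to sigma_n shows that almost surely X_T is neither in U nor outside
   of the closure of B, hence X_T = Delta, and again u(X_t) = 0 for t >= T. It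
   remains to sum the expectations of u(X_t) on these events; the one of
   {sigma_n <= t < tau_{n+1}} is computed by the strong Markov property at sigma_n
   for a functional of sigma_n and of the path after sigma_n.

   The random times are stopping times of the completed filtration: the exit
   time from an open set is almost surely the supremum of the hitting times of
   complements of compact sets, by quasi-left-continuity, and the hitting time of
   a Borel set is handled by the measurability, up to null sets, of projections
   of progressive sets. *)

(** * Projections of measurable sets *)

(** Hitting and exit times are events of the completed filtration, for all initial laws at once,
    whereas [y |-> P y A] is known to be Borel only for [A] in the natural filtration. Much of the
    work is the passage between the two levels: a completed event is replaced by a natural one up to
    a null set, under an arbitrary law when a stopping time is constructed and under a Dirac mass
    when an expectation is computed.

    The strong Markov property is given for one time lag and one Borel set. In the term with P^U_{t
    - sigma_n} the remaining time is random, so the property has to be extended to jointly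
    measurable functions of the pair formed by sigma_n and the shifted path. This forces a version
    of the exit time from U that is measurable without completion.

    For nonnegative [u] the sum over the events is countable additivity. For bounded [u] of either
    sign this is applied to both parts of [u]; the bound makes all quantities finite, so that the
    two series can be subtracted and the signed series converges. *)

Section measurable_projection.
Context (R : realType) (d : measure_display) (T : measurableType d).
Implicit Types (H : set (\bar R * T)) (f g : nat -> nat).

(** Times live in the compact interval [-oo, +oo], so closed time intervals that meet pairwise have
    a common point; the second coordinate carries only measurable sets and no topology. *)
Let slab := (\bar R * \bar R * set T)%type.

Let in_slab (c : slab) (z : \bar R * T) : Prop :=
  [/\ c.1.1 <= z.1, z.1 <= c.1.2 & c.2 z.2].

(* A Souslin scheme of closed slabs: the n-th slab only depends on the first
   [L n] values of the branch [f]. *)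
Let scheme (S : nat -> (nat -> nat) -> slab) (L : nat -> nat) : Prop :=
  (forall n f, measurable (S n f).2) /\
  (forall n f g, (forall i, (i < L n)%N -> f i = g i) -> S n f = S n g).

Let analytic H : Prop := exists S L, scheme S L /\
  forall z, H z <-> exists f, forall n, in_slab (S n f) z.

Let analytic_slab (c : slab) : measurable c.2 -> analytic (in_slab c).
Proof.
move=> mc; exists (fun _ _ => c), (fun=> 0%N); split; first by split.
by move=> z; split => [cz|[f fz]]; [exists id | exact: (fz 0%N)].
Qed.

Let analytic_choice (F : nat -> set (\bar R * T)) : (forall k, analytic (F k)) ->
  exists S L, forall k, scheme (S k) (L k) /\
    forall z, F k z <-> exists f, forall n, in_slab (S k n f) z.
Proof.
move=> /choice[S] /choice[L] SL; exists S, L => k; exact: SL.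
Qed.

(** Numbers that code no pair are sent to (0, 0), which merely repeats a condition imposed
    elsewhere. *)
Let dec (n : nat) : nat * nat := odflt (0, 0)%N (unpickle n).

Let decK p : dec (pickle p) = p.
Proof. by rewrite /dec pickleK. Qed.

(** The first value of the branch selects [k]. The depth [L k n] then depends on the branch, while a
    scheme must fix its depth in advance; so the stage coding (n, b) imposes the [n]-th slab only if
    its depth is at most [b], and every slab is imposed at some stage. *)
Let analytic_bigcup (F : nat -> set (\bar R * T)) :
  (forall k, analytic (F k)) -> analytic (\bigcup_k F k).
Proof.
move=> /analytic_choice[S [L SL]].
exists (fun m f => if (L (f 0%N) (dec m).1 <= (dec m).2)%N
  then S (f 0%N) (dec m).1 (f \o succn) else (-oo, +oo, setT)).
exists (fun m => (dec m).2.+2); split; first split.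
- by move=> m f; case: ifP => _ /=; [exact: (SL _).1.1 | exact: measurableT].
- move=> m f g fg; rewrite (fg 0%N)//; case: ifP => // Lm.
  by apply: (SL _).1.2 => i iL /=; apply: fg; rewrite ltnS ltnW// ltnS (leq_trans iL).
move=> z; split.
- move=> [k _ /(SL k).2[f Hf]].
  exists (fun n => if n is n'.+1 then f n' else k) => m.
  by case: ifP => _ /=; [exact: Hf | split; rewrite //= ?leNye ?leey].
- move=> [f Hf]; exists (f 0%N) => //; apply/(SL _).2; exists (f \o succn) => n.
  by have := Hf (pickle (n, L (f 0%N) n)); rewrite decK leqnn.
Qed.

(** A single branch encodes countably many: the [k]-th one is read off at the codes of the pairs (k,
    j). *)
Let analytic_bigcap (F : nat -> set (\bar R * T)) :
  (forall k, analytic (F k)) -> analytic (\bigcap_k F k).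
Proof.
move=> /analytic_choice[S [L SL]].
pose sub (k : nat) f : nat -> nat := fun j => f (pickle (k, j)).
exists (fun n f => S (dec n).1 (dec n).2 (sub (dec n).1 f)).
exists (fun n => (\max_(j < L (dec n).1 (dec n).2) pickle ((dec n).1, val j)).+1).
split; first split.
- by move=> n f; exact: (SL _).1.1.
- move=> n f g fg; apply: (SL _).1.2 => j jL; rewrite /sub; apply: fg.
  by rewrite ltnS (@leq_bigmax _ (fun j : 'I__ => pickle ((dec n).1, val j)) (Ordinal jL)).
move=> z; split.
- move=> Fz.
  have /choice[f Hf] : forall k, exists f, forall n, in_slab (S k n f) z.
    by move=> k; apply/(SL k).2; exact: Fz.
  pose h n := f (dec n).1 (dec n).2.
  exists h => n; have -> : sub (dec n).1 h = f (dec n).1.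
    by apply/funext => j; rewrite /sub /h decK.
  exact: Hf.
- move=> [f Hf] k _; apply/(SL k).2; exists (sub k f) => n.
  by have := Hf (pickle (k, n)); rewrite decK.
Qed.

Let bianalytic H := analytic H /\ analytic (~` H).

Let bianalytic_sigma_algebra : sigma_algebra setT bianalytic.
Proof.
split.
- split; last first.
    rewrite setC0.
    suff -> : setT = in_slab (-oo, +oo, setT) by apply: analytic_slab; exact: measurableT.
    by apply/seteqP; split => [z _|//]; split => //=; rewrite ?leNye ?leey.
  suff -> : set0 = in_slab (-oo, +oo, set0) by apply: analytic_slab; exact: measurable0.
  by apply/seteqP; split => // z [].
- by move=> A [A1 A2]; rewrite setTD; split; rewrite ?setCK.
- move=> F aF; split; first by apply: analytic_bigcup => k; exact: (aF k).1.
  by rewrite setC_bigcup; apply: analytic_bigcap => k; exact: (aF k).2.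
Qed.

Lemma sigma_algebra_preimage_fst (A B : Type) (P : set (set (A * B))) :
  sigma_algebra setT P -> sigma_algebra setT [set C : set A | P (fst @^-1` C)].
Proof.
move=> [P0 PC PU]; split => /=.
- by rewrite preimage_set0.
- by move=> C /PC; rewrite !setTD preimage_setC.
- by move=> F /PU; rewrite preimage_bigcup.
Qed.

Let measurable_analytic H : measurable H -> analytic H.
Proof.
suff: (measurable : set (set (\bar R * T))) `<=` bianalytic by move=> h /h[].
apply: smallest_sub; first exact: bianalytic_sigma_algebra.
move=> _ [] /= [C mC <-]; rewrite setTI; last first.
  split.
    suff -> : snd @^-1` C = in_slab (-oo, +oo, C) by exact: analytic_slab.
    apply/seteqP; split => [z Cz|z []//].
    by split => //=; rewrite ?leNye ?leey.
  suff -> : ~` (snd @^-1` C) = in_slab (-oo, +oo, ~` C).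
    exact/analytic_slab/measurableC.
  apply/seteqP; split => [z Cz|z []//].
  by split => //=; rewrite ?leNye ?leey.
have sB := sigma_algebra_preimage_fst bianalytic_sigma_algebra.
have : (@ErealGenCInfty.G R).-sigma.-measurable C by rewrite -ErealGenCInfty.measurableE.
move: C {mC}; apply: smallest_sub => // _ [r ->].
split.
  suff -> : fst @^-1` `[r%:E, +oo[%classic = in_slab (r%:E, +oo, setT).
    by apply: analytic_slab; exact: measurableT.
  apply/seteqP; split => z /=; rewrite in_itv/= andbT; first by split; rewrite ?leey.
  by case.
(* The complement is open at its upper end, so it takes countably many closed slabs. *)
suff -> : ~` (fst @^-1` `[r%:E, +oo[%classic) =
    \bigcup_n in_slab (-oo, (r - n.+1%:R^-1)%:E, setT).
  by apply: analytic_bigcup => k; apply: analytic_slab; exact: measurableT.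
apply/seteqP; split => [[s w]|[s w] [n _ []]] /=; rewrite in_itv/= andbT.
- move=> /negP; rewrite -ltNge; case: s => [s|//|] sr; last first.
    by exists 0%N => //; split; rewrite //= leNye.
  rewrite lte_fin in sr.
  have [n _ ns] := near_infty_natSinv_lt (PosNum (ltac:(by rewrite subr_gt0) : (0 < r - s)%R)).
  exists n => //; split; rewrite //= ?leNye// lee_fin lerBrDr -lerBrDl ltW//.
  exact: (ns n (leqnn _)).
- move=> _ sr _; apply/negP; rewrite -ltNge (le_lt_trans sr)// lte_fin.
  by rewrite ltrBlDr ltrDl.
Qed.

(** An ultrafilter contains exactly one cell of a finite partition. This replaces the extraction of
    diagonal subsequences in [scheme_compact]. *)
Lemma ultra_bounded (UF : set_system nat) {FF : UltraFilter UF} (x : nat -> nat) b :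
  (forall n, (x n <= b)%N) -> exists v, UF [set n | x n = v].
Proof.
elim: b x => [|b IH] x xb.
  exists 0%N; rewrite [X in UF X](_ : _ = setT); first exact: filterT.
  by apply/seteqP; split => // n _ /=; apply/eqP; rewrite -leqn0.
have [h|h] := in_ultra_setVsetC [set n | x n = b.+1] FF; first by exists b.+1.
have [n|v hv] := IH (fun n => minn (x n) b); first exact: geq_minr.
exists v; apply: filterS2 h hv => n /= xn.
suff /minn_idPl -> : (x n <= b)%N by [].
by rewrite -ltnS ltn_neqAle xb andbT; exact/eqP.
Qed.

(** Compactness of the branches bounded by [g]: along an ultrafilter finer than the cofinite filter
    each coordinate of the approximate branches becomes constant, and a slab sees only finitely many
    coordinates. *)
Let scheme_compact S L (w : T) (g : nat -> nat) : scheme S L ->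
  (forall N, exists f s, (forall i, (f i <= g i)%N) /\
     forall n, (n < N)%N -> in_slab (S n f) (s, w)) ->
  exists f s, forall n, in_slab (S n f) (s, w).
Proof.
move=> [_ locS] /choice[F] /choice[s Fs].
have [UF [UU sUF]] := ultraFilterLemma (eventually_filter).
have /choice[f Hf] : forall i, exists v, UF [set N | F N i = v].
  by move=> i; apply: (@ultra_bounded _ _ _ (g i)) => N; exact: (Fs N).1.
have agree k : UF [set N | forall i, (i < k)%N -> F N i = f i].
  elim: k => [|k IH]; first by apply: filterS filterT.
  apply: filterS2 IH (Hf k) => N /= h1 h2 i; rewrite ltnS leq_eqVlt.
  by case/orP => [/eqP ->//|/h1].
have slabS n : UF [set N | in_slab (S n f) (s N, w)].
  have large : UF [set N | (n < N)%N] by apply: sUF; exists n.+1.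
  apply: filterS2 large (agree (L n)) => N /= nN FN.
  by rewrite -(locS _ _ _ FN); exact: (Fs N).2.
(* Any two of the time intervals share some [s N], so every left endpoint is below every right
   endpoint and the supremum of the left endpoints lies in all of them. *)
exists f, (ereal_sup [set (S n f).1.1 | n in setT]) => n; split => /=.
- by apply: ereal_sup_ubound; exists n.
- apply: ge_ereal_sup => _ [m _ <-].
  have [N [[h1 _ _] [_ h2 _]]] := filter_ex (filterI (slabS m) (slabS n)).
  exact: le_trans h1 h2.
- by have [N []] := filter_ex (slabS n).
Qed.

Let truncated (g : nat -> nat) S N : set T := [set w | exists f s,
  (forall i, (f i <= g i)%N) /\ forall n, (n < N)%N -> in_slab (S n f) (s, w)].

(** The first [N] slabs see only the first [K] values of the branch, so branches can be replaced by
    finite sequences padded with 0, of which there are countably many. For a fixed sequence the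
    condition [ok] on times does not involve [w]. *)
Let measurable_truncated (g : nat -> nat) S L N :
  scheme S L -> measurable (truncated g S N).
Proof.
move=> [mS locS].
pose ext (l : seq nat) : nat -> nat := nth 0%N l.
pose ok (l : seq nat) := (forall i, (ext l i <= g i)%N) /\
  exists s, forall n, (n < N)%N -> (S n (ext l)).1.1 <= s <= (S n (ext l)).1.2.
pose K := (\max_(n < N) L n)%N.
rewrite [X in measurable X](_ : _ = \bigcup_(l : seq nat)
   \bigcap_n [set w | ok l /\ ((n < N)%N -> (S n (ext l)).2 w)]); last first.
  apply/seteqP; split => [w [f [s [fg fs]]]|w [l _ lw]].
  - exists (mkseq f K) => // n _.
    have extS m : (m < N)%N -> S m (ext (mkseq f K)) = S m f.
      move=> mN; apply: locS => i iL; rewrite /ext nth_mkseq//.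
      exact: leq_trans iL (@leq_bigmax _ (fun j : 'I_N => L j) (Ordinal mN)).
    split; last by move=> nN; rewrite extS//; case: (fs _ nN).
    split; last by exists s => m mN; rewrite extS//; case: (fs _ mN) => /= -> ->.
    move=> i; rewrite /ext; have [iK|Ki] := ltnP i K; first by rewrite nth_mkseq.
    by rewrite nth_default// size_mkseq.
  - have [[lg [s ls]] _] := lw 0%N I.
    exists (ext l), s; split => // n nN; have /andP[? ?] := ls _ nN.
    by split => //=; case: (lw n I) => _; exact.
apply: countable_bigcupT_measurable => // l; apply: bigcapT_measurable => n.
have [okl|nokl] := pselect (ok l); last first.
  by rewrite [X in measurable X](_ : _ = set0)//; apply/seteqP; split => // w [].
have [nN|nN] := boolP (n < N)%N; last first.
  by rewrite [X in measurable X](_ : _ = setT)//; apply/seteqP; split => // w _.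
rewrite [X in measurable X](_ : _ = (S n (ext l)).2); first exact: mS.
by apply/seteqP; split => [w [_]|w ?] //; exact.
Qed.

Let mu_ext_ge0 (mu : {measure set T -> \bar R}) (E : set T) : 0 <= mu_ext mu E.
Proof. exact: mu_ext_ge0. Qed.

Lemma measurable_hull (mu : {finite_measure set T -> \bar R}) (E : set T) :
  exists A, [/\ measurable A, E `<=` A & mu A = mu_ext mu E].
Proof.
have Efin : mu_ext mu E \is a fin_num.
  rewrite ge0_fin_numE//; apply: (@le_lt_trans _ _ (mu setT)).
    by rewrite -(measurable_mu_extE mu)//; exact: le_mu_ext.
  by rewrite -ge0_fin_numE// fin_num_measure.
have /choice[A HA] : forall n : nat, exists A, [/\ measurable A, E `<=` A &
    mu A <= mu_ext mu E + (n.+1%:R^-1)%:E].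
  move=> n; have n0 : (0 < n.+1%:R^-1 :> R)%R by [].
  have [_ [F [mF EF] <-] lF] := lb_ereal_inf_adherent n0 Efin.
  exists (\bigcup_k F k); split => //; first exact: bigcupT_measurable.
  apply: le_trans (ltW lF); apply: measure_sigma_subadditive => //.
  exact: bigcupT_measurable.
exists (\bigcap_n A n); split.
- by apply: bigcapT_measurable => n; case: (HA n).
- by move=> x Ex n _; have [_ + _] := HA n; exact.
- have mA : measurable (\bigcap_n A n) by apply: bigcapT_measurable => n; case: (HA n).
  apply/eqP; rewrite eq_le; apply/andP; split; last first.
    rewrite -(measurable_mu_extE mu)//; apply: le_mu_ext => x Ex n _.
    by have [_ + _] := HA n; exact.
  apply/lee_addgt0Pr => e e0; have [n _ ne] := near_infty_natSinv_lt (PosNum e0).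
  have [mAn _ An] := HA n.
  apply: (@le_trans _ _ (mu (A n))).
    by apply: le_measure; rewrite ?inE//; exact: bigcap_inf.
  by rewrite (le_trans An)// leeD2l// lee_fin ltW//; exact: (ne n (leqnn n)).
Qed.

(** Continuity from below of the outer measure along arbitrary increasing sets. Hulls of the [E n]
    need not increase, but the intersections [B n] of their tails do, and they still contain
    [E n]. *)
Lemma lt_mu_ext_bigcup (mu : {finite_measure set T -> \bar R})
    (E : nat -> set T) c : (forall n, E n `<=` E n.+1) ->
  c < mu_ext mu (\bigcup_n E n) -> exists n, c < mu_ext mu (E n).
Proof.
move=> ndE; apply: contraPP => /forallNP Ec; apply/negP; rewrite -leNgt.
have homoE m n : (m <= n)%N -> E m `<=` E n.
  move=> /subnKC <-; elim: (n - m)%N => [|k IH]; first by rewrite addn0.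
  by rewrite addnS; apply: subset_trans IH _.
have /choice[A HA] := fun n => measurable_hull mu (E n).
pose B n := \bigcap_(k in [set k | (n <= k)%N]) A k.
have mB n : measurable (B n).
  by apply: bigcap_measurable; [exists n => /= | move=> k _; case: (HA k)].
have EB n : E n `<=` B n.
  by move=> x Ex k /= nk; have [_ + _] := HA k; apply; exact: homoE Ex.
have ndB : nondecreasing_seq B.
  move=> m n mn; apply/subsetPset => x Bx k /= nk; apply: Bx; exact: leq_trans nk.
have mUB : measurable (\bigcup_n B n) by exact: bigcupT_measurable.
apply: (@le_trans _ _ (mu (\bigcup_n B n))).
  rewrite -(measurable_mu_extE mu)//; apply: le_mu_ext.
  by apply: subset_bigcup => n _; exact: EB.
have /cvg_lim <- // := @nondecreasing_cvg_mu _ _ _ mu _ mB mUB ndB.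
apply: lime_le.
  by apply: ereal_nondecreasing_is_cvgn => m n mn; apply: le_measure;
    rewrite ?inE//; apply/subsetPset/ndB.
apply: nearW => n /=; have [mAn _ An] := HA n.
apply: (@le_trans _ _ (mu (A n))).
  by apply: le_measure; rewrite ?inE//; apply: bigcap_inf => /=.
by rewrite An leNgt; apply/negP.
Qed.

(* Sion's capacitability argument: bound the successive values of the branch
   while keeping the outer measure of the projection above [c]; compactness of
   the bounded branches and of the slabs turns the intersection of the
   truncations into a subset of the projection. *)
Let analytic_capacitable (mu : {finite_measure set T -> \bar R}) H c :
  analytic H -> c < mu_ext mu (snd @` H) ->
  exists A, [/\ measurable A, A `<=` snd @` H & c <= mu A].
Proof.
move=> [S [L [SL HS]]] cH.
(* Unlike [truncated], [E l] keeps all slabs and bounds only the first values of the branch. It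
   increases with the last bound, and the union over that bound removes it. *)
pose E (l : seq nat) : set T := [set w | exists f s,
  (forall i, (i < size l)%N -> (f i <= nth 0%N l i)%N) /\
  forall n, in_slab (S n f) (s, w)].
have E0 : E [::] = snd @` H.
  apply/seteqP; split => [w [f [s [_ fs]]]|w [[s w'] /HS[f fs] /= <-]].
    by exists (s, w) => //; apply/HS; exists f.
  by exists f, s.
have Estep l : exists v, c < mu_ext mu (E l) -> c < mu_ext mu (E (rcons l v)).
  have [cl|?] := pselect (c < mu_ext mu (E l)); last by exists 0%N.
  suff [v cv] : exists v, c < mu_ext mu (E (rcons l v)) by exists v.
  apply: lt_mu_ext_bigcup.
    move=> v w [f [s [fl fs]]]; exists f, s; split => // i; rewrite size_rcons => il.
    apply: leq_trans (fl i _) _; rewrite ?size_rcons// !nth_rcons.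
    by case: ifP => // _; case: ifP.
  apply: lt_le_trans cl _; apply: le_mu_ext => w [f [s [fl fs]]].
  exists (f (size l)) => //; exists f, s; split => // i.
  rewrite size_rcons ltnS leq_eqVlt nth_rcons => /orP[/eqP ->|il].
    by rewrite ltnn eqxx.
  by rewrite il; exact: fl.
have [next Hnext] := choice Estep.
pose pre := fix pre n := if n is n'.+1 then rcons (pre n') (next (pre n')) else [::].
pose g n := next (pre n).
have size_pre n : size (pre n) = n by elim: n => //= n IH; rewrite size_rcons IH.
have nth_pre n i : (i < n)%N -> nth 0%N (pre n) i = g i.
  elim: n => // n IH; rewrite ltnS leq_eqVlt /= nth_rcons size_pre.
  by case/orP => [/eqP ->|il]; [rewrite ltnn eqxx | rewrite il IH].
have cpre n : c < mu_ext mu (E (pre n)).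
  by elim: n => [|n IH]; [rewrite E0 | exact: Hnext].
have mtr N : measurable (truncated g S N) by exact: measurable_truncated SL.
have ctr N : c <= mu (truncated g S N).
  pose K := (\max_(n < N) L n)%N.
  rewrite -(measurable_mu_extE mu)//; apply: le_trans (ltW (cpre K)) _.
  apply: le_mu_ext => w [f [s [fg fs]]].
  (* The bound by [g] is known only below [K]; resetting the later values to 0 makes it hold
     everywhere and leaves the first [N] slabs unchanged. *)
  pose f' i := if (i < K)%N then f i else 0%N.
  exists f', s; split => [i|n nN].
    by rewrite /f'; case: ifP => // iK; rewrite -(nth_pre K)//; apply: fg; rewrite size_pre.
  rewrite (SL.2 _ _ f) => [|i iL]; first exact: fs.
  rewrite /f' ifT//.
  exact: leq_trans iL (@leq_bigmax _ (fun j : 'I_N => L j) (Ordinal nN)).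
exists (\bigcap_N truncated g S N); split.
- exact: bigcapT_measurable.
- move=> w tw; have [f [s fs]] := scheme_compact SL (fun N => tw N I).
  by exists (s, w) => //; apply/HS; exists f.
- have nitr : nonincreasing_seq (truncated g S).
    move=> m n mn; apply/subsetPset => w [f [s [fg fs]]].
    by exists f, s; split => // k km; apply: fs; exact: leq_trans mn.
  have mI : measurable (\bigcap_N truncated g S N) by exact: bigcapT_measurable.
  have tr0 : mu (truncated g S 0) < +oo by rewrite -ge0_fin_numE ?fin_num_measure.
  have /cvg_lim <- // := @nonincreasing_cvg_mu _ _ _ mu _ tr0 mtr mI nitr.
  apply: lime_ge; last exact: nearW.
  apply: ereal_nonincreasing_is_cvgn => m n mn; apply: le_measure;
    rewrite ?inE//; exact/subsetPset/nitr.
Qed.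

(** Capacitability, applied just below the outer measure of the projection, gives inner sets whose
    union has the measure of the hull. *)
Theorem measurable_projection (mu : {finite_measure set T -> \bar R}) H :
  measurable H -> exists A A', [/\ measurable A, measurable A',
    A `<=` snd @` H, snd @` H `<=` A' & mu (A' `\` A) = 0].
Proof.
move=> /measurable_analytic aH; have [A' [mA' HA' A'E]] := measurable_hull mu (snd @` H).
have A'fin : mu A' \is a fin_num by exact: fin_num_measure.
have /choice[A HA] : forall n, exists A, [/\ measurable A, A `<=` snd @` H &
    mu A' - (n.+1%:R^-1)%:E <= mu A].
  move=> n; apply: analytic_capacitable => //.
  by rewrite -A'E lteBlDr// lteDl// lte_fin.
have mUA : measurable (\bigcup_n A n) by apply: bigcupT_measurable => n; case: (HA n).
have UAH : \bigcup_n A n `<=` snd @` H by apply: bigcup_sub => n _; case: (HA n).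
exists (\bigcup_n A n), A'; split => //.
rewrite measureD//=; last by rewrite -ge0_fin_numE.
rewrite setIidr; last exact: subset_trans HA'.
apply/eqP; rewrite eq_le; apply/andP; split; last first.
  by rewrite sube_ge0 ?fin_num_measure//; apply: le_measure;
    rewrite ?inE//; exact: subset_trans HA'.
apply/lee_addgt0Pr => e e0; have [n _ ne] := near_infty_natSinv_lt (PosNum e0).
have [mAn _ An] := HA n; rewrite add0e leeBlDr ?fin_num_measure//.
rewrite leeBlDr// in An; apply: le_trans An _; rewrite addeC leeD//.
  by rewrite lee_fin ltW//; exact: (ne n (leqnn n)).
by apply: le_measure; rewrite ?inE//; exact: bigcup_sup.
Qed.

End measurable_projection.

(** * The state space and the paths *)

Section metrizable_space.
Context (R : realType) (M : topologicalType).
Variable rho : M -> M -> R.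
Hypothesis rho0 : forall x y, (rho x y = 0 <-> x = y)%R.
Hypothesis rhoC : forall x y, rho x y = rho y x.
Hypothesis rhoD : forall x y z, (rho x z <= rho x y + rho y z)%R.
Hypothesis nbhs_rho : forall (x : M) (A : set M),
  nbhs x A <-> exists2 e : R, (0 < e)%R & [set y | (rho x y < e)%R] `<=` A.

Let rho_ge0 x y : (0 <= rho x y)%R.
Proof.
have := rhoD x y x; rewrite (rhoC y x) (rho0 x x).2//; lra.
Qed.

Let closed_rho_ball p r : closed [set y | (rho p y <= r)%R].
Proof.
rewrite -[X in closed X]setCK; apply: open_closedC; rewrite openE => y /negP.
rewrite -ltNge => py; apply/nbhs_rho; exists (rho p y - r)%R.
  by rewrite subr_gt0.
move=> z /=; rewrite ltrBrDr => h; apply/negP; rewrite -ltNge.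
by have := rhoD p z y; rewrite (rhoC z y); lra.
Qed.

Lemma metrizable_hausdorff : hausdorff_space M.
Proof.
move=> x y /= h; apply/rho0; apply: contrapT => xy.
have r0 : (0 < rho x y / 2)%R by rewrite divr_gt0// lt_def rho_ge0 andbT; exact/eqP.
have [z [/= xz yz]] := h [set z | (rho x z < rho x y / 2)%R] [set z | (rho y z < rho x y / 2)%R]
  (ltac:(by apply/nbhs_rho; exists (rho x y / 2)%R)) (ltac:(by apply/nbhs_rho; exists (rho x y / 2)%R)).
by have := rhoD x z y; rewrite (rhoC z y); lra.
Qed.

(** The candidates are the closed balls of radius 1/(n+1) about the points of a countable dense set,
    numbered through the injection [f]; those that fail to be compact are replaced by the empty
    set. *)
Lemma metrizable_compact_base : locally_compact [set: M] -> separable_space M ->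
  exists K : nat -> set M, (forall i, compact (K i)) /\
    forall (G : set M) x, open G -> G x -> exists2 i, (K i)^° x & K i `<=` G.
Proof.
move=> lcM [D cD dD]; have /countable_injP[f injf] := cD.
pose K0 (k : nat * nat) : set M := [set x | exists p,
  [/\ D p, f p = k.1 & (rho p x <= k.2.+1%:R^-1)%R]].
pose K i : set M := let k := odflt (0, 0)%N (unpickle i) in
  if `[< compact (K0 k) >] then K0 k else set0.
exists K; split.
  by move=> i; rewrite /K; case: asboolP => // _; exact: compact0.
move=> G x oG Gx.
have [C Cx [cC clC]] := lcM x I.
have xC : nbhs x C by move: Cx; rewrite withinET.
have [e e0 eGC] : exists2 e : R, (0 < e)%R & [set y | (rho x y < e)%R] `<=` C `&` G.
  by apply: (nbhs_rho _ _).1; apply: filterI => //; exact: open_nbhs_nbhs.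
(* With r < e/2 and [p] within [r] of [x], the closed ball of radius [r] about [p] stays within [e]
   of [x]. *)
have [n _ ne] := near_infty_natSinv_lt (PosNum (ltac:(by rewrite divr_gt0) : (0 < e / 2)%R)).
have {}ne : (n.+1%:R^-1 < e / 2 :> R)%R := ne n (leqnn n).
set r := (n.+1%:R^-1 : R)%R in ne.
have r0 : (0 < r)%R by rewrite /r.
have [p [xp Dp]] : ([set y | (rho x y < r)%R]^° `&` D) !=set0.
  apply: dD; last exact: open_interior.
  by exists x; apply/nbhs_rho; exists r.
have {}xp : (rho x p < r)%R := interior_subset xp.
have K0E : K0 (f p, n) = [set y | (rho p y <= r)%R].
  apply/seteqP; split => [y [p' [Dp' /injf fp' +]]|y py]; last by exists p.
  by rewrite fp' ?inE.
have K0CG : K0 (f p, n) `<=` C `&` G.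
  by rewrite K0E => y /= py; apply: eGC => /=; have := rhoD x p y; lra.
have cK0 : compact (K0 (f p, n)).
  apply: (subclosed_compact _ cC); last by move=> y /K0CG[].
  by rewrite K0E; exact: closed_rho_ball.
exists (pickle (f p, n)); rewrite /K pickleK /= asboolT//.
  rewrite K0E; apply/nbhs_rho; exists (r - rho x p)%R; first by rewrite subr_gt0.
  by move=> y /=; have := rhoD p x y; rewrite (rhoC p x); lra.
by move=> y /K0CG[].
Qed.

End metrizable_space.

(** * Borel sets of the one-point compactification *)

Section cemetery_borel.
Context (M : topologicalType).
Implicit Types (A G : set M) (V : set (cemetery_ext M)).

Lemma closed_cemetery_compact A : hausdorff_space M -> compact A ->
  closed (Some @` A : set (cemetery_ext M)).
Proof.
move=> hM cA; have clA : closed A by exact: compact_closed.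
rewrite -[X in closed X]setCK; apply: open_closedC; rewrite openE => -[x|] h.
  have nAx : ~ A x by move=> Ax; apply: h; exists x.
  have : nbhs x (~` A) by apply: open_nbhs_nbhs; split => //; exact: closed_openC.
  move/one_point_compactification_some_nbhs; apply: filterS => _ [y nAy <-] [z Az [zy]].
  by apply: nAy; rewrite -zy.
exists A => // _ [[y nAy <-]|->] [z Az]; last by [].
by case=> zy; apply: nAy; rewrite -zy.
Qed.

Lemma Some_preimageK V : ~ V None -> Some @` (Some @^-1` V) = V.
Proof.
move=> nV; apply/seteqP; split => [_ [x Vx <-]//|[x Vx|//]]; by exists x.
Qed.

Lemma open_Some_preimage V : open V -> open (Some @^-1` V : set M).
Proof.
move: V; apply/continuousP; exact: one_point_compactification_some_continuous.
Qed.

(** An open set containing Delta is its trace on M together with the complement of M, so the open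
    subsets of M already generate the Borel sets of the compactification. *)
Lemma borel_cemetery_sub (Q : set (set (cemetery_ext M))) :
  sigma_algebra setT Q -> (forall G, open G -> Q (Some @` G)) ->
  @borel (cemetery_ext M) `<=` Q.
Proof.
move=> sQ QG; apply: smallest_sub => // V oV.
have QV := QG _ (open_Some_preimage oV).
have [VN|nVN] := pselect (V None); last by rewrite -(Some_preimageK nVN).
have -> : V = Some @` (Some @^-1` V) `|` ~` (Some @` [set: M]).
  apply/seteqP; split => [[x Vx|_]|[x|]].
  - by left; exists x.
  - by right => -[].
  - by case=> [[y Vy <-]//|[]]; exists x.
  - by [].
case: sQ => Q0 QC QU.
have QU2 (A B : set (cemetery_ext M)) : Q A -> Q B -> Q (A `|` B).
  by move=> QA QB; rewrite -bigcup2E; apply: (QU) => -[|[|k]].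
by apply: QU2 => //; rewrite -setTD; apply: (QC); exact: QG openT.
Qed.

Lemma borel_sigma (T : topologicalType) : sigma_algebra setT (@borel T).
Proof. exact: smallest_sigma_algebra. Qed.

Lemma borel_open (T : topologicalType) (V : set T) : open V -> borel V.
Proof. exact: sub_sigma_algebra. Qed.

Lemma borel_Some A : borel A -> borel (Some @` A : set (cemetery_ext M)).
Proof.
suff : @borel M `<=` [set A | borel (Some @` A : set (cemetery_ext M))] by exact.
have [b0 bC bU] := borel_sigma (cemetery_ext M).
apply: smallest_sub; last first.
  by move=> G oG; apply: borel_open; exact: one_point_compactification_open_some.
split => /=.
- by rewrite image_set0.
- move=> C bSC; rewrite (_ : Some @` (setT `\` C) =
      setT `\` (Some @` C `|` ~` (Some @` [set: M]))).
    apply: (bC); rewrite -bigcup2E; apply: (bU) => -[|[|k]] //=.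
    rewrite -setTD; apply: (bC); apply: borel_open.
    exact/one_point_compactification_open_some/openT.
  apply/seteqP; split => [_ [x [_ nCx] <-]|[x|]].
  + split => // -[[y Cy [yx]]|]; first by apply: nCx; rewrite -yx.
    by apply; exists x.
  + by move=> [_ h]; exists x => //; split => // Cx; apply: h; left; exists x.
  + by move=> [_ h]; exfalso; apply: h; right => -[].
- move=> F bF; rewrite image_bigcup; exact: bU.
Qed.

Lemma borel_None : borel [set None : cemetery_ext M].
Proof.
rewrite (_ : [set _] = setT `\` (Some @` [set: M])).
  have [_ bC _] := borel_sigma (cemetery_ext M); apply: (bC).
  by apply: borel_Some; apply: borel_open; exact: openT.
by apply/seteqP; split => [_ ->|[x|//] [_ []]]; [split => // -[] | exists x].
Qed.

Lemma borel_Some_preimage V : borel V -> borel (Some @^-1` V : set M).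
Proof.
suff : @borel (cemetery_ext M) `<=` [set V | borel (Some @^-1` V : set M)] by exact.
have [b0 bC bU] := borel_sigma M.
apply: borel_cemetery_sub; last first.
  move=> G oG /=; rewrite (_ : _ @^-1` _ = G); first exact: borel_open.
  by apply/seteqP; split => [x [y Gy [<-]]//|x Gx]; exists x.
split => /=; first by rewrite preimage_set0.
- by move=> A /bC; rewrite !setTD preimage_setC.
- by move=> F bF; rewrite preimage_bigcup; exact: bU.
Qed.

End cemetery_borel.

(** * Path regularity and progressive measurability *)

Section path.
Context (R : realType) (M : topologicalType) (d : measure_display)
  (Omega : measurableType d).
Variables (X : \bar R -> Omega -> cemetery_ext M)
  (P : cemetery_ext M -> probability Omega R)
  (theta : \bar R -> Omega -> Omega).
Hypothesis hX : hunt_process X P theta.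

Lemma right_continuousP (w : Omega) (s : R) (W : set (cemetery_ext M)) :
  (0 <= s)%R -> open W -> W (X s%:E w) ->
  exists2 e : R, (0 < e)%R & forall r, (s <= r < s + e)%R -> W (X r%:E w).
Proof.
move=> s0 oW Ws.
have hw : X r%:E w @[r --> s^'+] --> X s%:E w by exact: (hunt_right_continuous hX).
have /nbhs_ballP[e /= e0 se] := hw W (open_nbhs_nbhs (conj oW Ws)).
exists e => // r /andP[]; rewrite le_eqVlt => /orP[/eqP <-//|sr] re.
by apply: se => //=; rewrite /ball/= distrC ger0_norm ?subr_ge0 ?ltW// ltrBlDl.
Qed.

Lemma X_infty w : X +oo w = None.
Proof. by apply: (hunt_life_time hX); rewrite leey. Qed.

Lemma X_None_after w (s t : \bar R) : 0 <= s -> s <= t -> X s w = None -> X t w = None.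
Proof.
case: s => [s||//] s0; last by rewrite leye_eq => /eqP ->.
move=> st Xs; apply: (hunt_life_time hX); apply: le_trans st.
by apply: ereal_inf_lbound; exists s.
Qed.

(** The generating family inside [natural_filtration], named so that the generated sigma-algebra can
    equip a measurable type. *)
Definition natural_gen (t : \bar R) : set (set Omega) :=
  [set A | exists s V, [/\ 0 <= s, s <= t, borel V & A = X s @^-1` V]].

Local Notation natural_type t := (g_sigma_algebraType (natural_gen t)).

Lemma measurable_natural t (s : \bar R) V : 0 <= s -> s <= t -> borel V ->
  measurable (X s @^-1` V : set (natural_type t)).
Proof. by move=> s0 st bV; apply: sub_sigma_algebra; exists s, V. Qed.

Lemma natural_mono s t : s <= t ->
  natural_filtration X s `<=` natural_filtration X t.
Proof.
move=> st; apply: sub_smallest2r; first exact: smallest_sigma_algebra.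
move=> _ [r [V [r0 rs bV ->]]]; exists r, V.
by split => //; exact: le_trans st.
Qed.

Section progressive.
Variable K : nat -> set M.
Hypothesis cK : forall i, compact (K i).
Hypothesis baseK : forall (G : set M) x, open G -> G x ->
  exists2 i, (K i)^° x & K i `<=` G.
Hypothesis hM : hausdorff_space M.

Local Notation lift A := ([set Some y | y in A] : set (cemetery_ext M)).

(** By right-continuity a path in the interior of [K i] stays there for a while, and conversely
    membership in the closed set [K i] passes to the limit from the right. Since s < t, rational
    times below [t] suffice, so the natural filtration at [t] need not be enlarged to its right
    limit. *)
Lemma path_open_rat w (s t : R) (G : set M) : (0 <= s)%R -> (s < t)%R -> open G ->
  lift G (X s%:E w) <-> exists i, K i `<=` G /\
    exists n : nat, forall q : rat, (ratr q < t :> R)%R ->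
      [\/ (ratr q <= s :> R)%R, (s + n.+1%:R^-1 <= ratr q :> R)%R |
          lift (K i) (X (ratr q : R)%:E w)].
Proof.
move=> s0 st oG; split.
- move=> [x Gx xE]; have [i Kix KiG] := baseK oG Gx.
  exists i; split => //.
  have oKi : open (Some @` (K i)^° : set (cemetery_ext M)).
    exact/one_point_compactification_open_some/open_interior.
  have [|e e0 He] := right_continuousP (w := w) s0 oKi; first by rewrite -xE; exists x.
  have [n _ ne] := near_infty_natSinv_lt (PosNum e0); exists n => q qt.
  have [qs|sq] := leP (ratr q : R) s; first by constructor 1.
  have [sq'|qs'] := leP (s + n.+1%:R^-1)%R (ratr q : R); first by constructor 2.
  constructor 3; have [|y yK yE] := He (ratr q).
    rewrite (ltW sq) (lt_trans qs')// ltrD2l; exact: ne n (leqnn n).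
  by exists y => //; exact: interior_subset.
- move=> [i [KiG [n Hn]]].
  suff [x Kx <-] : lift (K i) (X s%:E w) by exists x => //; exact: KiG.
  have cl : closed (lift (K i)) by exact: closed_cemetery_compact.
  apply: contrapT => nKs.
  have [e e0 He] := right_continuousP (w := w) s0 (closed_openC cl) nKs.
  have n0 : (0 < n.+1%:R^-1 :> R)%R by [].
  pose b := (Num.min (Num.min t (s + e)) (s + n.+1%:R^-1))%R.
  have sb : (s < b)%R by rewrite !lt_min st !ltrDl e0 n0.
  have [q] := rat_in_itvoo sb; rewrite in_itv/= !lt_min => /andP[sq /andP[/andP[qt qe] qn]].
  case: (Hn q qt); [by rewrite leNgt sq | by rewrite leNgt qn |].
  by apply: He; rewrite (ltW sq).
Qed.

Lemma progressive (t : R) (V : set (cemetery_ext M)) : borel V ->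
  measurable [set z : \bar R * natural_type t%:E |
    [/\ 0 <= z.1, z.1 < t%:E & V (X z.1 z.2)]].
Proof.
pose Q := [set V : set (cemetery_ext M) |
   measurable [set z : \bar R * natural_type t%:E |
    [/\ 0 <= z.1, z.1 < t%:E & V (X z.1 z.2)]]].
suff : @borel (cemetery_ext M) `<=` Q by exact.
have mfst (J : set \bar R) : measurable J ->
    measurable [set z : \bar R * natural_type t%:E | J z.1].
  by move=> mJ; rewrite -[X in measurable X]setTI; exact: measurable_fst.
have msnd (J : set (natural_type t%:E)) : measurable J ->
    measurable [set z : \bar R * natural_type t%:E | J z.2].
  by move=> mJ; rewrite -[X in measurable X]setTI; exact: measurable_snd.
have mt : measurable [set z : \bar R * natural_type t%:E | (0 <= z.1 < t%:E)%E].
  apply: (mfst [set r | (0 <= r < t%:E)%E]).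
  rewrite [X in measurable X](_ : _ = `[0, t%:E[%classic); first exact: emeasurable_itv.
  by apply/seteqP; split => r /=; rewrite in_itv.
apply: borel_cemetery_sub.
  split.
  - by rewrite /Q/= [X in measurable X](_ : _ = set0)//; apply/seteqP; split => // z [].
  - move=> A mA; rewrite /Q/= [X in measurable X](_ : _ =
      [set z : \bar R * natural_type t%:E | (0 <= z.1 < t%:E)%E] `\`
      [set z : \bar R * natural_type t%:E | [/\ 0 <= z.1, z.1 < t%:E & A (X z.1 z.2)]]).
      exact: measurableD.
    apply/seteqP; split => [z [z0 zt [_ nA]]|z [/= /andP[z0 zt] nA]].
      by split => [/=|[]//]; rewrite z0.
    by split => //; split => // Az; exact: nA.
  - move=> F mF; rewrite /Q/= [X in measurable X](_ : _ = \bigcup_n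
      [set z : \bar R * natural_type t%:E | [/\ 0 <= z.1, z.1 < t%:E & F n (X z.1 z.2)]]).
      exact: bigcupT_measurable.
    by apply/seteqP; split => [z [z0 zt [n _ Fn]]|z [n _ []]]; [exists n|split => //; exists n].
move=> G oG.
(* The condition of [path_open_rat] at one rational, with the time as a variable. A negative
   rational imposes nothing, being below every admissible time. *)
pose S i n (q : rat) : set (\bar R * natural_type t%:E) :=
  if (0 <= (ratr q : R) < t)%R then
    [set z | z.1 \in `[(ratr q : R)%:E, +oo[ ] `|`
    [set z | z.1 \in `]-oo, (ratr q - n.+1%:R^-1 : R)%:E] ] `|`
    [set z | lift (K i) (X (ratr q : R)%:E z.2)] else setT.
rewrite /Q/= [X in measurable X](_ : _ =
   [set z : \bar R * natural_type t%:E | (0 <= z.1 < t%:E)%E] `&`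
   \bigcup_(i in [set i | K i `<=` G]) \bigcup_n \bigcap_(q : rat) S i n q).
  apply: measurableI => //.
  apply: bigcup_measurable => i _; apply: bigcupT_measurable => n.
  rewrite -[X in measurable X]setCK setC_bigcap; apply: measurableC.
  apply: bigcupT_measurable_rat => q; apply: measurableC; rewrite /S.
  case: ifPn => [/andP[q0 qt]|_]; last exact: measurableT.
  apply: measurableU; first apply: measurableU.
  - by apply: (mfst [set` `[(ratr q : R)%:E, +oo[ ]); exact: emeasurable_itv.
  - by apply: (mfst [set` `]-oo, (ratr q - n.+1%:R^-1 : R)%:E] ]); exact: emeasurable_itv.
  - apply: (msnd (X (ratr q : R)%:E @^-1` lift (K i))).
    apply: measurable_natural; rewrite ?lee_fin// ?ltW//.
    rewrite -[lift _]setCK; have [_ bC _] := borel_sigma (cemetery_ext M).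
    rewrite -setTD; apply: (bC); apply: borel_open; apply: closed_openC.
    exact: closed_cemetery_compact.
have fin s : 0 <= s -> s < t%:E -> exists2 r : R, (0 <= r < t)%R & s = r%:E.
  by case: s => [r||//] r0 rt; [exists r => //; rewrite -!lee_fin -lte_fin r0 | rewrite ltNge leey in rt].
apply/seteqP; split => [[s w] [/= s0 st Gs]|[s w] [/= /andP[s0 st] [i KiG [n _ Hn]]]].
- split => /=; first by rewrite s0.
  have [r /andP[r0 rt] sE] := fin s s0 st; subst s.
  have [i [KiG [n Hn]]] := (path_open_rat w r0 rt oG).1 Gs.
  exists i => //; exists n => // q _; rewrite /S; case: ifPn => // /andP[q0 qt].
  case: (Hn q qt) => h'.
  + by left; left; rewrite /= in_itv/= andbT lee_fin.
  + by left; right; rewrite /= in_itv/= lee_fin lerBrDr.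
  + by right.
- split => //=; have [r /andP[r0 rt] sE] := fin s s0 st; subst s.
  apply/(path_open_rat w r0 rt oG); exists i; split => //; exists n => q qt.
  have [q0|q0] := leP 0%R (ratr q : R); last first.
    by constructor 1; rewrite (le_trans (ltW q0)).
  move: (Hn q I); rewrite /S q0 qt /= => -[[|]|].
  + by rewrite /= in_itv/= andbT lee_fin; constructor 1.
  + by rewrite /= in_itv/= lee_fin lerBrDr; constructor 2.
  + by constructor 3.
Qed.
End progressive.
End path.

(** * Disintegration and completed measures *)

Import HBNNSimple.

Lemma ge0_measurable_fun_ind (d : measure_display) (T : measurableType d)
    (R : realType) (C : (T -> \bar R) -> Prop) :
  (forall A, measurable A -> C (fun x => (\1_A x)%:E)) ->
  (forall f g, measurable_fun setT f -> measurable_fun setT g ->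
    (forall x, 0 <= f x) -> (forall x, 0 <= g x) ->
    C f -> C g -> C (f \+ g)) ->
  (forall k f, (0 <= k)%R -> measurable_fun setT f -> (forall x, 0 <= f x) ->
    C f -> C (fun x => k%:E * f x)) ->
  (forall f : nat -> T -> \bar R, (forall n, measurable_fun setT (f n)) ->
    (forall n x, 0 <= f n x) -> (forall x, nondecreasing_seq (f^~ x)) ->
    (forall n, C (f n)) -> C (fun x => limn (f^~ x))) ->
  forall f, measurable_fun setT f -> (forall x, 0 <= f x) -> C f.
Proof.
move=> C1 CD CZ Clim f mf f0.
pose g := nnsfun_approx measurableT mf.
have -> : f = fun x => limn (fun n => (g n x)%:E).
  apply/funext => x; apply/esym/cvg_lim => //.
  exact: (cvg_nnsfun_approx measurableT mf (fun x _ => f0 x)).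
apply: (Clim (fun n x => (g n x)%:E)).
- by move=> n; exact/measurable_EFinP/measurable_funP.
- by move=> n x; rewrite lee_fin.
- by move=> x m n mn; rewrite lee_fin; exact/lefP/nd_nnsfun_approx.
move=> n.
have C0 : C (fun x => 0).
  have := C1 _ measurable0; congr (C _); apply/funext => x.
  by rewrite indic0.
rewrite (_ : (fun x => _) = (fun x => \sum_(r \in range (g n))
    (r * \1_(g n @^-1` [set r]) x)%:E)); last first.
  by apply/funext => x; rewrite fimfunE -fsumEFin.
under eq_fun do rewrite fsbig_finite//=.
have mi (r : R) : measurable_fun setT (fun x => (r * \1_(g n @^-1` [set r]) x)%:E).
  by apply/measurable_EFinP; apply: measurable_funM => //; exact: measurable_indic.
have i0 (r : R) x : 0 <= (r * \1_(g n @^-1` [set r]) x)%:E.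
  exact: nnfun_muleindic_ge0.
elim: (finmap.enum_fset _) => [|r s IH].
  by under eq_fun do rewrite big_nil.
under eq_fun do rewrite big_cons.
apply: (CD (fun x => (r * \1_(g n @^-1` [set r]) x)%:E)
  (fun x => \sum_(r <- s) (r * \1_(g n @^-1` [set r]) x)%:E)) => //.
- by apply: emeasurable_sum => // ?; exact: mi.
- by move=> x; apply: sume_ge0.
(* The induction on the list forgets that [r] is a value of the simple function; for negative [r]
   the preimage is empty and the term vanishes. *)
- have [r0|r0] := leP 0%R r; last first.
    rewrite (_ : (fun x => _) = (fun=> 0)) //; apply/funext => x.
    by rewrite preimage_nnfun0// indic0 mulr0.
  have mg : measurable (g n @^-1` [set r]) by [].
  under eq_fun do rewrite EFinM; apply: (CZ r) => //.
  + exact/measurable_EFinP/measurable_indic.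
  + exact: C1.
Qed.

Lemma indic_preimage (R : realType) (T T' : Type) (f : T -> T') (A : set T') x :
  \1_(f @^-1` A) x = \1_A (f x) :> R.
Proof. by rewrite !indicE; congr (_%:R); apply/idP/idP; rewrite !inE. Qed.

Lemma integral_indicT (d : measure_display) (T : measurableType d) (R : realType)
    (mu : {measure set T -> \bar R}) (A : set T) : measurable A ->
  \int[mu]_x (\1_A x)%:E = mu A.
Proof. by move=> mA; rewrite integral_indic// setIT. Qed.

Lemma ge0_integral_lim (d : measure_display) (T : measurableType d) (R : realType)
    (mu : {measure set T -> \bar R}) (f : nat -> T -> \bar R) :
  (forall n, measurable_fun setT (f n)) -> (forall n x, 0 <= f n x) ->
  (forall x, nondecreasing_seq (f^~ x)) ->
  \int[mu]_x limn (f^~ x) = limn (fun n => \int[mu]_x f n x).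
Proof. by move=> mf f0 nd; rewrite monotone_convergence. Qed.

Lemma mule_limnr (R : realType) (k : \bar R) (f : nat -> \bar R) : 0 <= k -> k \is a fin_num ->
  (forall n, 0 <= f n) -> nondecreasing_seq f ->
  k * limn f = limn (fun n => k * f n).
Proof.
by move=> k0 kf f0 nd; rewrite limeMl//; exact: ereal_nondecreasing_is_cvgn.
Qed.

(** The pushforward packed as a measure, so that a family of image measures can be used as a
    kernel. *)
Definition image_measure (d d' : measure_display) (T : measurableType d)
    (T' : measurableType d') (R : realType) (m : {measure set T -> \bar R})
    (f : T -> T') (mf : measurable_fun setT f) : {measure set T' -> \bar R} :=
  measure_function_pushforward__canonical__measure_function_Measure m mf.

Lemma ge0_integral_image_measure (d d' : measure_display) (T : measurableType d)
    (T' : measurableType d') (R : realType) (m : {measure set T -> \bar R})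
    (f : T -> T') (mf : measurable_fun setT f) (h : T' -> \bar R) :
  measurable_fun setT h -> (forall y, 0 <= h y) ->
  \int[image_measure m mf]_y h y = \int[m]_x h (f x).
Proof.
by move=> mh h0; rewrite (ge0_integral_pushforward mf m measurableT mh (fun y _ => h0 y)) preimage_setT.
Qed.

Section kernel_disintegration.
Context (d d' : measure_display) (T : measurableType d) (S : measurableType d')
  (R : realType).
Variables (mu : {measure set T -> \bar R}) (k : T -> {measure set S -> \bar R}).
Variables (L : set T) (Z : T -> S).
Hypothesis mL : measurable L.
Hypothesis mZ : measurable_fun setT Z.
Hypothesis mk : forall A, measurable A -> measurable_fun setT (fun w => k w A).
Hypothesis disintegration : forall A, measurable A ->
  mu (L `&` Z @^-1` A) = \int[mu]_w ((\1_L w)%:E * k w A).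

Let m1L : measurable_fun setT (fun w => (\1_L w)%:E : \bar R).
Proof. by apply/measurable_EFinP; exact: measurable_indic. Qed.

Let L0 w : 0 <= ((\1_L w)%:E : \bar R).
Proof. by rewrite lee_fin. Qed.

Let mfZ (f : S -> \bar R) : measurable_fun setT f ->
  measurable_fun setT (fun w => (\1_L w)%:E * f (Z w)).
Proof. by move=> mf; apply: emeasurable_funM m1L _; exact: measurableT_comp mf mZ. Qed.

(** Measurability and the identity go through the same induction, because the additive and limit
    steps of the identity integrate the functions whose measurability is being proved. *)
Lemma kernel_disintegration (h : S -> \bar R) : measurable_fun setT h ->
  (forall y, 0 <= h y) ->
  measurable_fun setT (fun w => \int[k w]_y h y) /\
  \int[mu]_w ((\1_L w)%:E * h (Z w)) = \int[mu]_w ((\1_L w)%:E * \int[k w]_y h y).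
Proof.
move: h; apply: ge0_measurable_fun_ind.
- move=> A mA; have -> : (fun w => \int[k w]_y (\1_A y)%:E) = fun w => k w A.
    by apply/funext => w; rewrite integral_indicT.
  split; first exact: mk.
  transitivity (mu (L `&` Z @^-1` A)); last first.
    by rewrite disintegration//; apply: eq_integral => w _; rewrite integral_indicT.
  rewrite -integral_indicT.
    by apply: eq_integral => w _; rewrite indicI EFinM /= indic_preimage.
  by apply: measurableI => //; rewrite -[X in measurable X]setTI; exact: mZ.
- move=> f g mf mg f0 g0 [mIf If] [mIg Ig].
  have D w : \int[k w]_y (f \+ g) y = \int[k w]_y f y + \int[k w]_y g y.
    exact: (ge0_integralD (k w) measurableT (fun y _ => f0 y) mf (fun y _ => g0 y) mg).
  split; first by rewrite (funext D); exact: emeasurable_funD.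
  have If0 w : 0 <= \int[k w]_y f y by apply: integral_ge0.
  have Ig0 w : 0 <= \int[k w]_y g y by apply: integral_ge0.
  transitivity (\int[mu]_w ((\1_L w)%:E * f (Z w) + (\1_L w)%:E * g (Z w))).
    by apply: eq_integral => w _; rewrite ge0_muleDr.
  rewrite (ge0_integralD mu measurableT (fun w _ => mule_ge0 (L0 w) (f0 _)) (mfZ mf)
    (fun w _ => mule_ge0 (L0 w) (g0 _)) (mfZ mg)) If Ig.
  rewrite -(ge0_integralD mu measurableT (fun w _ => mule_ge0 (L0 w) (If0 w))
    (emeasurable_funM m1L mIf) (fun w _ => mule_ge0 (L0 w) (Ig0 w)) (emeasurable_funM m1L mIg)).
  by apply: eq_integral => w _; rewrite /= D (ge0_muleDr _ (If0 w) (Ig0 w)).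
- move=> c f c0 mf f0 [mIf If].
  have D w : \int[k w]_y (c%:E * f y) = c%:E * \int[k w]_y f y.
    exact: (ge0_integralZl_EFin (k w) measurableT (fun y _ => f0 y) mf).
  split; first by rewrite (funext D); exact: measurable_funeM.
  have If0 w : 0 <= \int[k w]_y f y by apply: integral_ge0.
  transitivity (\int[mu]_w (c%:E * ((\1_L w)%:E * f (Z w)))).
    by apply: eq_integral => w _; rewrite muleCA.
  rewrite (ge0_integralZl_EFin mu measurableT (fun w _ => mule_ge0 (L0 w) (f0 _)) (mfZ mf) c0) If.
  rewrite -(ge0_integralZl_EFin mu measurableT (fun w _ => mule_ge0 (L0 w) (If0 w))
    (emeasurable_funM m1L mIf) c0).
  by apply: eq_integral => w _; rewrite D muleCA.
- move=> f mf f0 nd /all_and2[mIf If].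
  have D w : \int[k w]_y limn (f^~ y) = limn (fun n => \int[k w]_y f n y).
    exact: ge0_integral_lim.
  have If0 n w : 0 <= \int[k w]_y f n y by apply: integral_ge0.
  have ndI w : nondecreasing_seq (fun n => \int[k w]_y f n y).
    by move=> m n mn; apply: ge0_le_integral => // y _; exact: nd.
  split.
    rewrite (funext D).
    by apply: (emeasurable_fun_cvg _ _ mIf) => w _; exact: ereal_nondecreasing_is_cvgn.
  transitivity (\int[mu]_w limn (fun n => (\1_L w)%:E * f n (Z w))).
    by apply: eq_integral => w _; rewrite mule_limnr.
  rewrite (@ge0_integral_lim _ _ _ mu (fun n w => (\1_L w)%:E * f n (Z w))); last 3 first.
    by move=> n; exact: mfZ.
    by move=> n w; rewrite mule_ge0.
    by move=> w m n mn; rewrite lee_wpmul2l//; exact: nd.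
  transitivity (limn (fun n => \int[mu]_w ((\1_L w)%:E * \int[k w]_y f n y))).
    by congr (limn _); apply/funext => n; exact: If.
  rewrite -(@ge0_integral_lim _ _ _ mu (fun n w => (\1_L w)%:E * \int[k w]_y f n y)); last 3 first.
    by move=> n; exact: emeasurable_funM.
    by move=> n w; rewrite mule_ge0.
    by move=> w m n mn; rewrite lee_wpmul2l//; exact: ndI.
  by apply: eq_integral => w _; rewrite D mule_limnr.
Qed.

End kernel_disintegration.

Section disintegration_pi_system.
Context (d d' : measure_display) (T : measurableType d) (S : measurableType d')
  (R : realType).
Variables (mu : {finite_measure set T -> \bar R}) (k : T -> {measure set S -> \bar R}).
Hypothesis kT : forall w, k w setT = 1.
Variables (L : set T) (Z : T -> S).
Hypothesis mL : measurable L.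
Hypothesis mZ : measurable_fun setT Z.
Variable G : set (set S).
Hypothesis GE : measurable = <<s G >>.
Hypothesis GI : setI_closed G.
Hypothesis mG : forall A, G A -> measurable_fun setT (fun w => k w A).
Hypothesis disintegrationG : forall A, G A ->
  mu (L `&` Z @^-1` A) = \int[mu]_w ((\1_L w)%:E * k w A).

Let m1L : measurable_fun setT (fun w => (\1_L w)%:E : \bar R).
Proof. by apply/measurable_EFinP; exact: measurable_indic. Qed.

Let L0 w : 0 <= ((\1_L w)%:E : \bar R).
Proof. by rewrite lee_fin. Qed.

Let mZ1 A : measurable A -> measurable (Z @^-1` A).
Proof. by move=> mA; rewrite -[X in measurable X]setTI; exact: mZ. Qed.

(** Dynkin induction. For complements the finite mass of the event for [A] is added to both sides,
    which then equal [mu L] because the kernel has total mass 1. *)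
Lemma disintegration_pi_system (A : set S) : measurable A ->
  measurable_fun setT (fun w => k w A) /\
  mu (L `&` Z @^-1` A) = \int[mu]_w ((\1_L w)%:E * k w A).
Proof.
rewrite GE; move: A; apply: (dynkin_induction GE GI).
- split.
    by under eq_fun do rewrite kT; exact: measurable_cst.
  rewrite preimage_setT setIT -integral_indicT//.
  by apply: eq_integral => w _; rewrite kT mule1.
- by move=> A GA; split; [exact: mG | exact: disintegrationG].
- move=> A mA [mkA eA].
  have kA w : k w A \is a fin_num.
    rewrite ge0_fin_numE//; apply: (@le_lt_trans _ _ (k w setT)); last by rewrite kT ltry.
    by apply: le_measure; rewrite ?inE.
  have mC : measurable (~` A) by exact: measurableC.
  have kC w : k w (~` A) = 1 - k w A.
    suff <- : k w (~` A) + k w A = 1 by rewrite addeK.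
    by have := kT w; rewrite -(setvU A) measureU// setICl.
  split; first by under eq_fun do rewrite kC; exact: emeasurable_funB.
  have mLA : measurable (L `&` Z @^-1` A) by apply: measurableI => //; exact: mZ1.
  have fA : mu (L `&` Z @^-1` A) \is a fin_num by exact: fin_num_measure.
  have mkC : measurable_fun setT (fun w => k w (~` A)).
    by under eq_fun do rewrite kC; exact: emeasurable_funB.
  have e1 : mu (L `&` Z @^-1` (~` A)) + mu (L `&` Z @^-1` A) = mu L.
    rewrite -measureU//; last 2 first.
      by apply: measurableI => //; exact: mZ1.
      by apply/seteqP; split => // w [[_ nA] [_ Aw]].
    by rewrite -setIUr preimage_setC setvU setIT.
  have e2 : \int[mu]_w ((\1_L w)%:E * k w (~` A)) + mu (L `&` Z @^-1` A) = mu L.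
    rewrite eA -(ge0_integralD mu measurableT
      (fun w _ => mule_ge0 (L0 w) (measure_ge0 (k w) (~` A))) (emeasurable_funM m1L mkC)
      (fun w _ => mule_ge0 (L0 w) (measure_ge0 (k w) A)) (emeasurable_funM m1L mkA)).
    rewrite -[RHS]integral_indicT//; apply: eq_integral => w _ /=.
    by rewrite -ge0_muleDr// kC subeK// mule1.
  by rewrite -[LHS](addeK _ fA) e1 -e2 addeK.
- move=> A mA tA /all_and2[mkA eA].
  have kU w : k w (\bigcup_n A n) = \sum_(n <oo) k w (A n).
    by rewrite measure_semi_bigcup//; exact: bigcupT_measurable.
  split; first by under eq_fun do rewrite kU; exact: ge0_emeasurable_sum.
  rewrite preimage_bigcup setI_bigcupr measure_semi_bigcup//; last 3 first.
    by move=> n; apply: measurableI => //; exact: mZ1.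
    apply: trivIset_setIl; apply/trivIsetP => i j _ _ ij.
    by move/trivIsetP : tA => /(_ i j I I ij) AA; rewrite -[LHS]/(Z @^-1` (A i `&` A j)) AA.
    by apply: bigcupT_measurable => n; apply: measurableI => //; exact: mZ1.
  transitivity (\sum_(n <oo) \int[mu]_w ((\1_L w)%:E * k w (A n))).
    by apply: eq_eseriesr => n _; exact: eA.
  rewrite -(integral_nneseries mu measurableT (fun n => emeasurable_funM m1L (mkA n))
    (fun n w _ => mule_ge0 (L0 w) (measure_ge0 (k w) (A n)))).
  by apply: eq_integral => w _ /=; rewrite kU nneseriesZl.
Qed.

End disintegration_pi_system.

(** * Integrals against a completed probability *)

Section completed_probability.
Context (d : measure_display) (T : measurableType d) (R : realType).
Variable mu : probability T R.

Local Notation cmu := (@completed_measure_extension _ _ _ mu).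
Local Notation cT := (caratheodory_type (mu_ext mu)).

Lemma completed_measurable (A : set T) : measurable A -> measurable (A : set cT).
Proof. exact: caratheodory_measurable_mu_ext. Qed.

Lemma completed_measureE (A : set T) : measurable A -> cmu A = mu A.
Proof. exact: measurable_mu_extE. Qed.

Let cmuT : cmu setT = 1.
Proof. by rewrite completed_measureE// probability_setT. Qed.

HB.instance Definition _ := Measure_isProbability.Build _ _ _ cmu cmuT.

Lemma completed_null (A N : set T) : measurable A -> mu A = 0 -> N `<=` A ->
  measurable (N : set cT) /\ cmu N = 0.
Proof.
move=> mA A0 NA; split.
  by apply: measure_is_complete_caratheodory; exists A; split => //;
    [exact: completed_measurable | rewrite -A0 -(completed_measureE mA)].
apply/eqP; rewrite eq_le; apply/andP; split; last exact: mu_ext_ge0.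
by rewrite -A0 -(completed_measureE mA); exact: le_mu_ext.
Qed.

Lemma completed_measurable_symdiff (A B N : set T) : measurable A -> measurable N ->
  mu N = 0 -> A `\` B `<=` N -> B `\` A `<=` N -> measurable (B : set cT).
Proof.
move=> mA mN N0 AB BA.
have -> : B = (A `\` (A `\` B)) `|` (B `\` A).
  apply/seteqP; split => x.
    by have [Ax|nAx] := pselect (A x) => Bx; [left; split => // -[]|right].
  by move=> [[Ax /not_andP[//|]]|[]//]; exact: contrapT.
apply: (@measurableU _ cT); last exact: (completed_null mN N0 BA).1.
apply: (@measurableD _ cT); [exact: completed_measurable | exact: (completed_null mN N0 AB).1].
Qed.

Lemma completed_measurable_fun d' (T' : measurableType d') (f : T -> T') :
  measurable_fun setT f -> measurable_fun setT (f : cT -> T').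
Proof.
by move=> mf _ B mB; rewrite setTI; apply: completed_measurable; rewrite -[X in measurable X]setTI; exact: mf.
Qed.

(** The identity map from the completed space to the original one is measurable and pushes the
    completion forward to [mu]. *)
Lemma ge0_completed_expectationE (f : T -> \bar R) : measurable_fun setT f ->
  (forall w, 0 <= f w) -> completed_expectation mu f = \int[mu]_w f w.
Proof.
move=> mf f0; rewrite /completed_expectation.
have mid : measurable_fun setT (id : cT -> T) by exact: completed_measurable_fun.
rewrite -[LHS]/(\int[cmu]_(w in id @^-1` setT) (f \o (id : cT -> T)) w).
rewrite -(ge0_integral_pushforward mid cmu measurableT mf (fun y _ => f0 y)).
by apply: eq_measure_integral => A mA _; exact: completed_measureE.
Qed.

(** The integral of a nonnegative function is a supremum over the simple functions below it, which
    is monotone for arbitrary functions. The comparison is later applied to an event whose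
    measurability is unknown. *)
Lemma ge0_le_completed_expectation (f g : T -> \bar R) :
  (forall w, 0 <= f w) -> (forall w, f w <= g w) ->
  completed_expectation mu f <= completed_expectation mu g.
Proof.
move=> f0 fg; rewrite /completed_expectation.
rewrite ge0_integralTE// ge0_integralTE//; last first.
  by move=> w; exact: le_trans (f0 w) (fg w).
apply: ge_ereal_sup => _ [h hf <-]; apply: ereal_sup_ubound; exists h => // w.
exact: le_trans (hf w) (fg w).
Qed.

End completed_probability.

Section completed_ae.
Context (d : measure_display) (T : measurableType d) (R : realType).
Variable mu : probability T R.

Lemma completed_expectation_ae (f g : T -> \bar R) (N : set T) :
  measurable_fun setT f -> (forall x, 0 <= f x) -> measurable N -> mu N = 0 ->
  (forall x, ~ N x -> f x = g x) ->
  completed_expectation mu g = \int[mu]_x f x.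
Proof.
move=> mf f0 mN N0 fg; rewrite -ge0_completed_expectationE//.
have aeE : ae_eq (@completed_measure_extension _ _ _ mu) setT f g.
  exists N; split; [exact: completed_measurable | | ].
    by rewrite -N0; exact: completed_measureE.
  by move=> x /= h; apply: contrapT => Nx; apply: h => _; exact: fg.
rewrite /completed_expectation; apply/esym; apply: ae_eq_integral (aeE).
- exact: measurableT.
- exact: completed_measurable_fun.
- apply: (ae_measurable_fun _ aeE); last exact: completed_measurable_fun.
  exact: measure_is_complete_caratheodory.
Qed.

End completed_ae.

Section mixture.
Context (d d' : measure_display) (T : measurableType d) (S : measurableType d')
  (R : realType).
Variables (mu : probability T R) (k : T -> {measure set S -> \bar R}).
Hypothesis kT : forall w, k w setT = 1.
Hypothesis mk : forall A, measurable A -> measurable_fun setT (fun w => k w A).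

Let mix (A : set S) : \bar R := \int[mu]_w k w A.

Let mix0 : mix set0 = 0.
Proof. by rewrite /mix integral0_eq. Qed.

Let mix_ge0 A : 0 <= mix A.
Proof. by apply: integral_ge0. Qed.

Let mix_sigma_additive : semi_sigma_additive mix.
Proof.
move=> A mA tA mUA.
have -> : mix (\bigcup_n A n) = \sum_(n <oo) mix (A n).
  rewrite /mix -(integral_nneseries mu measurableT (fun n => mk (mA n))) => [|//].
  by apply: eq_integral => w _; rewrite measure_semi_bigcup.
by apply: is_cvg_nneseries => n _ _; exact: mix_ge0.
Qed.

Let mixT : mix setT = 1.
Proof.
have -> : mix setT = \int[mu]_w cst 1 w by apply: eq_integral => w _; exact: kT.
by rewrite integral_cst// mul1e; exact: probability_setT.
Qed.

Let mix_measure := isMeasure.Build _ _ _ mix mix0 mix_ge0 mix_sigma_additive.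
Let mix_pack : {measure set S -> \bar R} := HB.pack mix mix_measure.
Let mix_probability := Measure_isProbability.Build _ _ _ mix_pack mixT.

Definition mixture : probability S R := HB.pack mix mix_measure mix_probability.

End mixture.

Section completed_dirac.
Context (d : measure_display) (T : measurableType d) (R : realType).
Variables (y : T) (my : measurable [set y]).

Local Notation mu := (@dirac _ T y R : probability T R).
Local Notation cT := (caratheodory_type (mu_ext mu)).

(** Every set is measurable for the completion of a Dirac mass at a measurable point. This reduces
    statements about all initial laws to statements about each [P y]. *)
Lemma completed_expectation_dirac (g : T -> \bar R) : (forall x, 0 <= g x) ->
  completed_expectation mu g = g y.
Proof.
move=> g0; rewrite /completed_expectation.
have dy0 : mu (~` [set y]) = 0.
  by rewrite /= diracE memNset//= => /(_ erefl).
have meas (A : set T) : measurable (A : set cT).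
  have [yA|yA] := pselect (A y).
    rewrite -[A]setCK; apply: (@measurableC _ cT).
    apply: (completed_null (mu := mu) (measurableC my) dy0 _).1.
    by move=> x nAx xy; apply: nAx; rewrite xy.
  apply: (completed_null (mu := mu) (measurableC my) dy0 _).1.
  by move=> x Ax xy; apply: yA; rewrite -xy.
rewrite (@ge0_ae_eq_integral _ cT _ _ setT g (cst (g y)))//.
- rewrite integral_cst//= /completed_measure_extension.
  have -> : mu_ext mu setT = 1.
    by rewrite measurable_mu_extE//; exact: (probability_setT mu).
  by rewrite mule1.
- by move=> x _ /=; exact: g0.
- exists (~` [set y]); split; first exact: meas.
    exact: (completed_null (mu := mu) (measurableC my) dy0 (@subset_refl _ _)).2.
  by move=> x /= h xy; apply: h => _; rewrite xy.
Qed.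

End completed_dirac.

(** * The strong Markov property for functionals of the path *)

Section hunt.
Context (R : realType) (M : topologicalType) (d : measure_display)
  (Omega : measurableType d).
Variables (X : \bar R -> Omega -> cemetery_ext M)
  (P : cemetery_ext M -> probability Omega R)
  (theta : \bar R -> Omega -> Omega).
Hypothesis hX : hunt_process X P theta.
Hypothesis hM : hausdorff_space M.

Local Notation E := (borel_cemetery_ext M).
Local Notation F := (completed_filtration X P).
Local Notation cP y := (@completed_measure_extension _ _ _ (P y)).
Local Notation cOmega y := (caratheodory_type (mu_ext (P y))).

Lemma measurable_cemetery_fun (g : E -> \bar R) :
  measurable_wrt (@borel M) (fun x => g (Some x)) -> measurable_fun setT g.
Proof.
move=> mg _ V mV; rewrite setTI.
have := mg V mV => /borel_Some bS.
have [gN|gN] := pselect (V (g None)).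
  rewrite (_ : g @^-1` V = [set Some x | x in (fun x => g (Some x)) @^-1` V] `|` [set None]).
    by apply: (@measurableU _ E); [exact: bS | exact: borel_None].
  apply/seteqP; split => [[x Vx|_]|[x|_]]; [by left; exists x|by right| |by []].
  by move=> [[y Vy [<-]]|].
rewrite (_ : g @^-1` V = [set Some x | x in (fun x => g (Some x)) @^-1` V]); first exact: bS.
by apply/seteqP; split => [[x Vx|//]|_ [x Vx <-]//]; exists x.
Qed.

Lemma borel_set1 (y : cemetery_ext M) : borel [set y].
Proof.
case: y => [x|]; last exact: borel_None.
have cx : closed [set Some x : cemetery_ext M].
  rewrite (_ : [set _] = Some @` [set x]); last by rewrite image_set1.
  by apply: closed_cemetery_compact => //; exact: compact_set1.
rewrite -[X in borel X]setCK; apply: (@measurableC _ E); apply: borel_open.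
exact: closed_openC.
Qed.

Lemma measurable_X t (A : set (cemetery_ext M)) : 0 <= t -> borel A ->
  measurable (X t @^-1` A).
Proof. by move=> t0 bA; exact: (hunt_measurable hX). Qed.

Lemma measurable_X_fun t : 0 <= t -> measurable_fun setT (X t : Omega -> E).
Proof. by move=> t0 _ A mA; rewrite setTI; exact: measurable_X. Qed.

(** The kernel axiom concerns Borel subsets of M; a set containing Delta is treated through its
    complement. *)
Lemma measurable_transition t (A : set (cemetery_ext M)) : 0 <= t -> borel A ->
  measurable_fun setT (fun y : E => P y (X t @^-1` A)).
Proof.
move=> t0 bA.
have noN (V : set (cemetery_ext M)) : borel V -> ~ V None ->
    measurable_fun setT (fun y : E => P y (X t @^-1` V)).
  move=> bV nV; apply: measurable_cemetery_fun.
  rewrite -(Some_preimageK nV); apply: (hunt_kernel hX) => //.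
  exact: borel_Some_preimage.
have [AN|nAN] := pselect (A None); last exact: noN.
have bC : borel (~` A) by exact: (@measurableC _ E).
rewrite (_ : (fun y => _) = (fun y : E => 1 - P y (X t @^-1` (~` A)))).
  by apply: emeasurable_funB => //; apply: noN => // h; exact: h.
apply/funext => y; rewrite -[in LHS](setCK A) preimage_setC probability_setC//.
exact: (measurable_X t0 bC).
Qed.

Lemma natural_sub_measurable t : natural_filtration X t `<=` @measurable _ Omega.
Proof.
apply: smallest_sub; first exact: sigma_algebra_measurable.
by move=> _ [s [V [s0 _ bV ->]]]; exact: measurable_X.
Qed.

Lemma Emu_dirac (y : E) (f : Omega -> \bar R) : (forall w, 0 <= f w) ->
  Emu P (@dirac _ E y R) f = Ex P y f.
Proof.
move=> f0; rewrite /Emu completed_expectation_dirac//; first exact: borel_set1.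
by move=> x; apply: integral_ge0 => w _; exact: f0.
Qed.

Lemma Ex_indic (y : E) (A : set Omega) : measurable (A : set (cOmega y)) ->
  Ex P y (fun w => (\1_A w)%:E) = cP y A.
Proof. by move=> mA; rewrite /Ex /completed_expectation integral_indic// setIT. Qed.

(** For the Dirac law at [y] the mixture is [P y] itself, so the null sets adjoined to the natural
    filtration are measurable for the completion of [P y]. *)
Lemma completed_filtration_measurable t (y : E) (A : set Omega) :
  F t A -> measurable (A : set (cOmega y)).
Proof.
move=> /(_ (@dirac _ E y R)) /= FA.
suff : <<s natural_filtration X t `|` null_sets X P (@dirac _ E y R : probability E R) >> `<=`
   (@measurable _ (cOmega y)) by exact.
apply: smallest_sub; first exact: (@sigma_algebra_measurable _ (cOmega y)).
move=> B [/natural_sub_measurable mB|]; first exact: completed_measurable.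
move=> [L [nL BL PL]]; have mL := natural_sub_measurable nL.
apply: (completed_null mL _ BL).1.
rewrite -PL /Pmu Emu_dirac; last by move=> w; rewrite lee_fin.
by rewrite Ex_indic ?completed_measureE//; exact: completed_measurable.
Qed.

Lemma completed_filtration_sigma t : sigma_algebra setT (F t).
Proof.
split.
- by move=> mu; exact: sigma_algebra0.
- by move=> A FA mu; rewrite setTD; apply: sigma_algebraC; exact: FA.
- by move=> A FA mu; apply: sigma_algebra_bigcup => i; exact: FA.
Qed.

Let fT t := g_sigma_algebraType (F t).

Lemma completed_filtrationE t : (@measurable _ (fT t)) = F t.
Proof. exact: measurable_g_measurableTypeE (completed_filtration_sigma t). Qed.

Lemma completed_filtrationI t A B : F t A -> F t B -> F t (A `&` B).
Proof. by rewrite -completed_filtrationE; exact: measurableI. Qed.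

Lemma completed_filtrationT t : F t setT.
Proof. by rewrite -completed_filtrationE; exact: measurableT. Qed.

Lemma completed_filtration0 t : F t set0.
Proof. by rewrite -completed_filtrationE; exact: measurable0. Qed.

Lemma completed_filtrationC t A : F t A -> F t (~` A).
Proof. by rewrite -completed_filtrationE; exact: measurableC. Qed.

Lemma completed_filtration_bigcup t (A : nat -> set Omega) :
  (forall n, F t (A n)) -> F t (\bigcup_n A n).
Proof. by rewrite -completed_filtrationE; exact: bigcupT_measurable. Qed.

Lemma completed_filtration_bigcap t (A : nat -> set Omega) :
  (forall n, F t (A n)) -> F t (\bigcap_n A n).
Proof. by rewrite -completed_filtrationE; exact: bigcapT_measurable. Qed.

Lemma completed_filtration_mono s t : s <= t -> F s `<=` F t.
Proof.
move=> st A FA mu; apply: (sub_smallest2r _ _ (FA mu)).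
  exact: smallest_sigma_algebra.
by move=> B [nB|]; [left; exact: natural_mono nB | right].
Qed.

Lemma natural_sub_completed t : natural_filtration X t `<=` F t.
Proof. by move=> A nA mu; apply: sub_sigma_algebra; left. Qed.

Lemma stopping_time_cst r : 0 <= r -> stopping_time F (fun=> r).
Proof.
move=> r0; split => // t t0.
have [rt|rt] := boolP (r <= t).
  rewrite (_ : [set _ | _] = setT); first exact: completed_filtrationT.
  by apply/seteqP; split.
rewrite (_ : [set _ | _] = set0); first exact: completed_filtration0.
by apply/seteqP; split => // w; apply/negP.
Qed.

Lemma stopping_time_shift sigma r : (0 <= r)%R -> stopping_time F sigma ->
  stopping_time F (fun w => sigma w + r%:E).
Proof.
move=> r0 [s0 Fs]; split => [w|t t0]; first by rewrite adde_ge0.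
have [rt|rt] := leP r%:E t.
  under eq_set do rewrite -leeBrDr//.
  apply: (@completed_filtration_mono (t - r%:E)); last by apply: Fs; rewrite sube_ge0.
  by rewrite leeBlDr// leeDl// lee_fin.
rewrite (_ : [set _ | _] = set0); first exact: completed_filtration0.
apply/seteqP; split => // w /= h; have := le_lt_trans h rt.
by rewrite ltNge leeDr.
Qed.

Lemma stopped_sub_shift sigma r A : (0 <= r)%R -> stopping_time F sigma ->
  stopped_sigma_field F sigma A ->
  stopped_sigma_field F (fun w => sigma w + r%:E) A.
Proof.
move=> r0 [s0 Fs] [FA FAs]; split => // t t0.
have [rt|rt] := leP r%:E t.
  rewrite (_ : [set w | _] = [set w | sigma w <= t - r%:E]); last first.
    by apply: eq_set => w; rewrite leeBrDr.
  apply: (@completed_filtration_mono (t - r%:E)); last by apply: FAs; rewrite sube_ge0.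
  by rewrite leeBlDr// leeDl// lee_fin.
rewrite (_ : _ `&` _ = set0); first exact: completed_filtration0.
apply/seteqP; split => // w [_ /= h]; have := le_lt_trans h rt.
by rewrite ltNge leeDr.
Qed.

Lemma stopped_setI sigma A B : stopped_sigma_field F sigma A ->
  stopped_sigma_field F sigma B -> stopped_sigma_field F sigma (A `&` B).
Proof.
move=> [FA FAs] [FB FBs]; split; first exact: completed_filtrationI.
by move=> t t0; rewrite setIIl; apply: completed_filtrationI; [exact: FAs|exact: FBs].
Qed.

Lemma stopped_le sigma (r : R) : stopping_time F sigma ->
  stopped_sigma_field F sigma [set w | sigma w <= r%:E].
Proof.
move=> [s0 Fs].
have Fr (r' : \bar R) : F r' [set w | sigma w <= r'].
  have [r0|r0] := leP 0 r'; first exact: Fs.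
  rewrite (_ : [set _ | _] = set0); first exact: completed_filtration0.
  by apply/seteqP; split => // w /= h; have := le_lt_trans h r0; rewrite ltNge s0.
split; first by apply: completed_filtration_mono (Fr r%:E); rewrite leey.
move=> t t0; rewrite (_ : _ `&` _ = [set w | sigma w <= Order.min r%:E t]).
  by apply: completed_filtration_mono (Fr _); rewrite ge_min lexx orbT.
by apply/seteqP; split => w /=; rewrite le_min => /andP.
Qed.

Lemma transition0 (y : cemetery_ext M) A : borel A -> P y (X 0 @^-1` A) = (\1_A y)%:E.
Proof.
move=> bA.
have mA := measurable_X (lexx 0) bA.
have P1 : P y (X 0 @^-1` [set y]) = 1.
  by case: y => [x|]; [exact: (hunt_normal hX) | exact: (hunt_cemetery hX)].
have my : measurable (X 0 @^-1` [set y]) by apply: measurable_X => //; exact: borel_set1.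
rewrite indicE; have [yA|yA] := boolP (y \in A).
  apply/eqP; rewrite eq_le probability_le1//= -P1 le_measure ?inE// => w /= ->.
  exact: set_mem.
have : P y (X 0 @^-1` A) <= P y (~` (X 0 @^-1` [set y])).
  rewrite le_measure ?inE//; first exact: measurableC.
  by move=> w Aw /= yw; move: yA; rewrite -yw notin_setE.
by rewrite probability_setC// P1 subee// => h; apply/eqP; rewrite eq_le h measure_ge0.
Qed.

(** Read off from the strong Markov property with lag 0: the version of the conditional probability
    given there is, by normality, the indicator of the event, and it is measurable for the stopped
    sigma-field. *)
Lemma stopped_X sigma A : stopping_time F sigma -> borel A ->
  stopped_sigma_field F sigma [set w | A (X (sigma w) w)].
Proof.
move=> st bA.
have [+ _] := hunt_strong_markov hX st (@dirac _ E None R) (lexx 0) bA.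
move=> /(_ [set 1] (emeasurable_set1 _)).
congr (stopped_sigma_field _ _ _); apply/seteqP; split => w /=; rewrite transition0// indicE.
  by case: (boolP (_ \in _)) => [/set_mem//|_ /eqP]; rewrite eqe eq_sym oner_eq0.
by move=> /mem_set ->.
Qed.

Lemma measurable_stopped_X sigma (y : E) : stopping_time F sigma ->
  measurable_fun setT (fun w : cOmega y => X (sigma w) w : E).
Proof.
move=> st _ A mA; rewrite setTI.
exact: completed_filtration_measurable (stopped_X st mA).1.
Qed.

Lemma stopped_measurable sigma (y : E) A : stopped_sigma_field F sigma A ->
  measurable (A : set (cOmega y)).
Proof. by move=> [FA _]; exact: completed_filtration_measurable FA. Qed.

Lemma strong_markov_event sigma (y : E) L (t : R) A : stopping_time F sigma ->
  stopped_sigma_field F sigma L -> (0 <= t)%R -> borel A ->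
  cP y (L `&` [set w | A (X (sigma w + t%:E) w)]) =
  \int[cP y]_w ((\1_L w)%:E * P (X (sigma w) w) (X t%:E @^-1` A)).
Proof.
move=> st sL t0 bA.
have [_ /(_ _ sL)] := hunt_strong_markov hX st (@dirac _ E y R) t0 bA.
have mI : measurable ((L `&` [set w | A (X (sigma w + t%:E) w)]) : set (cOmega y)).
  apply: (@measurableI _ (cOmega y)); first exact: stopped_measurable sL.
  exact: stopped_measurable (stopped_X (stopping_time_shift t0 st) bA).
rewrite Emu_dirac; last by move=> w; rewrite lee_fin.
by rewrite Emu_dirac ?Ex_indic// => w; rewrite mule_ge0// lee_fin.
Qed.

Lemma measurable_transition_fun (t : \bar R) (h : E -> \bar R) : 0 <= t ->
  measurable_fun setT h -> (forall y, 0 <= h y) ->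
  measurable_fun setT (fun y : E => \int[P y]_w h (X t w)).
Proof.
move=> t0 mh h0.
(* The zero measure and the empty event make the disintegration hypothesis trivial; only the
   measurability half of the conclusion is kept. *)
have [|+ _] := @kernel_disintegration _ _ E E R mzero
  (fun y => image_measure (P y) (measurable_X_fun t0)) set0 id measurable0
  (@measurable_id _ _ _) (fun A mA => measurable_transition t0 mA) _ h mh h0.
  by move=> A mA; rewrite set0I measure0 integral0_eq// => y _; rewrite indic0 mul0e.
by congr (measurable_fun _ _); apply/funext => y; rewrite ge0_integral_image_measure.
Qed.

Lemma strong_markov_transition sigma (y : E) L (t : R) (h : E -> \bar R) :
  stopping_time F sigma -> stopped_sigma_field F sigma L -> (0 <= t)%R ->
  measurable_fun setT h -> (forall y, 0 <= h y) ->
  \int[cP y]_w ((\1_L w)%:E * h (X (sigma w + t%:E) w)) =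
  \int[cP y]_w ((\1_L w)%:E * \int[P (X (sigma w) w)]_w' h (X t%:E w')).
Proof.
move=> st sL t0 mh h0.
have t0' : 0 <= t%:E by rewrite lee_fin.
have [_ ->] := @kernel_disintegration _ _ (cOmega y) E R (cP y)
  (fun w => image_measure (P (X (sigma w) w)) (measurable_X_fun t0')) L
  (fun w => X (sigma w + t%:E) w) (stopped_measurable y sL)
  (measurable_stopped_X (stopping_time_shift t0 st))
  (fun A mA => measurableT_comp (measurable_transition t0' mA) (measurable_stopped_X st))
  (fun A mA => strong_markov_event y st sL t0 mA) h mh h0.
by apply: eq_integral => w _; rewrite ge0_integral_image_measure.
Qed.

(** The shifts are known only through their action on the path: theta r (theta s w) and theta (s +
    r) w may be different points of [Omega]. Natural events cannot tell them apart. *)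
Lemma natural_path L w w' : natural_filtration X +oo L ->
  (forall s, 0 <= s -> X s w = X s w') -> L w -> L w'.
Proof.
move=> nL; suff : [set L | forall w w', (forall s, 0 <= s -> X s w = X s w') -> L w -> L w'] L.
  by apply.
(* An equivalence, since a one-sided implication does not pass to complements. *)
suff : natural_filtration X +oo `<=` [set L | forall w w',
    (forall s, 0 <= s -> X s w = X s w') -> (L w <-> L w')].
  by move=> /(_ _ nL) h {}w {}w' ww' Lw; apply/(h w w').
apply: smallest_sub; first split => /=.
- by [].
- by move=> A AH {}w {}w' /AH[h1 h2]; split => -[_ nA]; split => // ?; apply: nA; auto.
- move=> A AH {}w {}w' ww'; split => -[n _ An]; exists n => //; by apply/(AH n w w').
- by move=> _ [s [V [s0 _ _ ->]]] {}w {}w' h /=; rewrite h.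
Qed.

Lemma shift_X s t w : 0 <= s -> 0 <= t -> X s (theta t w) = X (s + t) w.
Proof. by move=> s0 t0; exact: (hunt_shift hX). Qed.

Lemma natural_shift L r s w : natural_filtration X +oo L -> 0 <= r -> 0 <= s ->
  L (theta r (theta s w)) <-> L (theta (s + r) w).
Proof.
move=> nL r0 s0; have h t : 0 <= t -> X t (theta r (theta s w)) = X t (theta (s + r) w).
  by move=> t0; rewrite shift_X// shift_X ?adde_ge0// shift_X ?adde_ge0// (addeC s r) addeA.
split; apply: (natural_path nL) => t t0; [exact: h | exact/esym/h].
Qed.

Lemma natural_shift_preimage L r : natural_filtration X +oo L -> 0 <= r ->
  natural_filtration X +oo (theta r @^-1` L).
Proof.
move=> nL r0; suff : natural_filtration X +oo `<=`
    [set L | natural_filtration X +oo (theta r @^-1` L)] by exact.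
apply: smallest_sub; first split => /=.
- by rewrite preimage_set0; exact: sigma_algebra0.
- by move=> A nA; rewrite setTD preimage_setC; exact: sigma_algebraC.
- by move=> A nA; rewrite preimage_bigcup; exact: sigma_algebra_bigcup.
- move=> _ [s [V [s0 _ bV ->]]] /=; apply: sub_sigma_algebra.
  exists (s + r), V; split; rewrite ?adde_ge0 ?leey//.
  by apply/seteqP; split => w /=; rewrite shift_X.
Qed.

(* Finite-dimensional cylinders, in terms of the increments of the times. *)
Fixpoint cylinder (l : seq (R * set (cemetery_ext M))) : set Omega :=
  if l is (r, A) :: l' then X r%:E @^-1` A `&` theta r%:E @^-1` cylinder l' else setT.

Fixpoint valid_cylinder (l : seq (R * set (cemetery_ext M))) : Prop :=
  if l is (r, A) :: l' then [/\ (0 <= r)%R, borel A & valid_cylinder l'] else True.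

Lemma natural_cylinder l : valid_cylinder l -> natural_filtration X +oo (cylinder l).
Proof.
elim: l => [_|[r A] l IH [r0 bA /IH nl]] /=; first exact: (@measurableT _ (g_sigma_algebraType (natural_gen X +oo))).
apply: (@measurableI _ (g_sigma_algebraType (natural_gen X +oo))).
  by apply: measurable_natural => //; rewrite leey.
exact: natural_shift_preimage.
Qed.

(** Times are stored as increments, so a new time either splits the first increment or is passed on,
    reduced by it. *)
Lemma cylinder_insert r A l : (0 <= r)%R -> borel A -> valid_cylinder l ->
  exists2 l', valid_cylinder l' & cylinder l' = X r%:E @^-1` A `&` cylinder l.
Proof.
move=> + bA; elim: l r => [|[r' A'] l IH] r r0.
  by move=> _; exists [:: (r, A)].
move=> /= [r'0 bA' vl]; have [rr'|r'r] := leP r r'.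
  exists ((r, A) :: (r' - r, A')%R :: l) => //=; first by rewrite subr_ge0.
  apply/seteqP; split => w /=.
  - rewrite !shift_X ?lee_fin ?subr_ge0// -EFinD subrK => -[Aw [A'w lw]].
    split => //; split => //; rewrite -(subrK r r') addrC EFinD.
    by apply/(natural_shift _ (natural_cylinder vl)) => //; rewrite lee_fin// subr_ge0.
  - rewrite !shift_X ?lee_fin ?subr_ge0// -EFinD subrK => -[Aw [A'w lw]].
    split => //; split => //.
    apply/(natural_shift _ (natural_cylinder vl)); rewrite ?lee_fin ?subr_ge0//.
    by rewrite -EFinD addrC subrK.
have r'r0 : (0 <= r - r')%R by rewrite subr_ge0 ltW.
have [l' vl' cl'] := IH _ r'r0 vl.
exists ((r', A') :: l') => //=; rewrite cl'.
apply/seteqP; split => w /=; rewrite !shift_X ?lee_fin// -EFinD subrK; tauto.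
Qed.

Lemma cylinder_setI l1 l2 : valid_cylinder l1 -> valid_cylinder l2 ->
  exists2 l, valid_cylinder l & cylinder l = cylinder l1 `&` cylinder l2.
Proof.
move=> vl1 vl2.
(* The induction on [l1] needs a free starting time, the sum of the increments already consumed;
   shifting by 0 leaves the path unchanged. *)
suff [l vl cl] : exists2 l, valid_cylinder l &
    cylinder l = theta (0%R : R)%:E @^-1` cylinder l1 `&` cylinder l2.
  exists l => //; rewrite cl; congr (_ `&` _); apply/seteqP.
  have h w t : 0 <= t -> X t (theta (0%R : R)%:E w) = X t w.
    by move=> t0; rewrite shift_X// adde0.
  by split => w /=; apply: natural_path (natural_cylinder vl1) _ => t t0; rewrite h.
move: (lexx (0%R : R)); move: {2 3}(0%R : R) => s s0.
elim: l1 vl1 s s0 => [_ s s0|[r A] l1 IH [r0 bA vl1] s s0].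
  by exists l2 => //; rewrite preimage_setT setTI.
have [l vl cl] := IH vl1 _ (addr_ge0 s0 r0).
have [l' vl' cl'] := cylinder_insert (addr_ge0 s0 r0) bA vl.
exists l' => //; rewrite cl' cl /= setIA; congr (_ `&` _).
apply/seteqP; split => w /=; rewrite shift_X// addeC -EFinD => -[Aw lw]; split => //.
- by apply/(natural_shift _ (natural_cylinder vl1)).
- by move: lw => /(natural_shift _ (natural_cylinder vl1)); apply.
Qed.

Definition cylinders : set (set Omega) :=
  [set A | exists2 l, valid_cylinder l & A = cylinder l].

Lemma cylinders_setI : setI_closed cylinders.
Proof.
move=> _ _ [l1 vl1 ->] [l2 vl2 ->]; have [l vl cl] := cylinder_setI vl1 vl2.
by exists l.
Qed.

Lemma cylinders_natural : <<s cylinders >> = natural_filtration X +oo.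
Proof.
apply/seteqP; split; apply: smallest_sub; try exact: smallest_sigma_algebra.
  by move=> _ [l vl ->]; exact: natural_cylinder.
move=> _ [[s||] [V [s0 _ bV ->]]] //; apply: sub_sigma_algebra.
- exists [:: (s, V)]; first by split; rewrite // -lee_fin.
  by rewrite /= preimage_setT setIT.
(* At time +oo the process is at Delta, so the event is everything or empty; the empty event is
   coded by an impossible constraint at time 0. *)
- have [VN|VN] := pselect (V None).
    by exists [::] => //=; apply/seteqP; split => w //= _; rewrite (X_infty hX).
  exists [:: (0%R, set0)]; first by split => //; exact: (@measurable0 _ E).
  by apply/seteqP; split => w /=; [rewrite (X_infty hX) | move=> []].
Qed.

(* The strong Markov property for events, by induction on the number of times:
   both the Borel dependence on the starting point and the property itself at
   the next stopping time are needed in the inductive step. *)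
Lemma strong_markov_cylinder l : valid_cylinder l ->
  measurable_fun setT (fun y : E => P y (cylinder l)) /\
  forall sigma (y : E) L, stopping_time F sigma -> stopped_sigma_field F sigma L ->
    cP y (L `&` [set w | cylinder l (theta (sigma w) w)]) =
    \int[cP y]_w ((\1_L w)%:E * P (X (sigma w) w) (cylinder l)).
Proof.
elim: l => [_|[r A] l IH [r0 bA vl]].
  split => [|sigma y L st sL].
    by rewrite (_ : (fun=> _) = cst 1)//; apply/funext => y; rewrite probability_setT.
  rewrite setIT -integral_indicT; last exact: stopped_measurable sL.
  by apply: eq_integral => w _; rewrite probability_setT mule1.
have [mIH smIH] := IH vl.
have r0' : 0 <= r%:E by rewrite lee_fin.
pose h (y : E) : \bar R := (\1_A y)%:E * P y (cylinder l).
have mh : measurable_fun setT h.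
  by apply: emeasurable_funM => //; apply/measurable_EFinP; exact: measurable_indic.
have h0 y : 0 <= h y by rewrite mule_ge0// lee_fin.
(* The induction hypothesis at the constant stopping time [r]; it reduces Borel dependence on [y] to
   the transition kernel at time [r]. *)
have hE y : P y (cylinder ((r, A) :: l)) = \int[P y]_w h (X r%:E w).
  have sA : stopped_sigma_field F (fun=> r%:E) (X r%:E @^-1` A).
    exact: (stopped_X (stopping_time_cst r0')).
  have mhX : measurable_fun setT (fun w => h (X r%:E w)).
    exact: (measurableT_comp mh (measurable_X_fun r0')).
  rewrite -completed_measureE; last first.
    exact: natural_sub_measurable (natural_cylinder (l := (r, A) :: l) _).
  rewrite -ge0_completed_expectationE//.
  have := smIH (fun=> r%:E) y _ (stopping_time_cst r0') sA.
  rewrite [X in cP y X = _](_ : _ = cylinder ((r, A) :: l))// => ->.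
split.
  rewrite (_ : (fun y => _) = fun y => \int[P y]_w h (X r%:E w)).
    exact: measurable_transition_fun.
  by apply/funext => y; exact: hE.
move=> sigma y L st sL.
have st' := stopping_time_shift r0 st.
(* The first constraint is absorbed into the conditioning event at the later stopping time sigma +
   r, where the induction hypothesis applies. *)
pose L' := L `&` [set w | A (X (sigma w + r%:E) w)].
have sL' : stopped_sigma_field F (fun w => sigma w + r%:E) L'.
  by apply: stopped_setI; [exact: stopped_sub_shift | exact: stopped_X].
have := smIH _ y L' st' sL'.
rewrite [X in cP y X = _](_ : _ = L `&` [set w | cylinder ((r, A) :: l) (theta (sigma w) w)]).
  move=> ->.
  transitivity (\int[cP y]_w ((\1_L w)%:E * h (X (sigma w + r%:E) w))).
    apply: eq_integral => w _; rewrite indicI EFinM -muleA; congr (_ * (_ * _)).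
  rewrite (strong_markov_transition _ st sL r0 mh h0).
  by apply: eq_integral => w _; rewrite hE.
have s0 w : 0 <= sigma w by case: st.
apply/seteqP; split => w /=.
- move=> [[Lw Aw] lw]; split => //; rewrite shift_X// addeC; split => //.
  by apply/(natural_shift _ (natural_cylinder vl)).
- rewrite shift_X// addeC => -[Lw [Aw lw]]; split => //.
  by move: lw => /(natural_shift _ (natural_cylinder vl)); apply.
Qed.

Local Notation nOmega := (g_sigma_algebraType (natural_gen X +oo)).

Lemma measurable_to_natural : measurable_fun setT (id : Omega -> nOmega).
Proof. by move=> _ A /natural_sub_measurable mA; rewrite setTI. Qed.

Lemma natural_typeE : (@measurable _ nOmega) = <<s cylinders >>.
Proof. by rewrite cylinders_natural. Qed.

Lemma measurable_shift sigma (y : E) : stopping_time F sigma ->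
  measurable_fun setT (fun w : cOmega y => theta (sigma w) w : nOmega).
Proof.
move=> st; apply: (@measurability _ _ (cOmega y) nOmega _ _ (natural_gen X +oo)) => //.
have s0 w : 0 <= sigma w by case: st.
move=> _ [_ [[s||] [V [s0' _ bV ->]]] <-] //; rewrite setTI.
- rewrite [X in measurable X](_ : _ = [set w | V (X (sigma w + s%:E) w)]).
    by apply: stopped_measurable (stopped_X (stopping_time_shift _ st) bV); rewrite -lee_fin.
  by apply/seteqP; split => w /=; rewrite shift_X// addeC.
- have [VN|VN] := pselect (V None).
    rewrite [X in measurable X](_ : _ = setT)//.
    by apply/seteqP; split => w //= _; rewrite (X_infty hX).
  rewrite [X in measurable X](_ : _ = set0)//.
  by apply/seteqP; split => w //=; rewrite (X_infty hX).
Qed.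

Lemma measurable_P_natural (L : set Omega) : natural_filtration X +oo L ->
  measurable_fun setT (fun y : E => P y L).
Proof.
move=> nL.
have [| | |+ _ //] := @disintegration_pi_system _ _ E nOmega R mzero
  (fun y => image_measure (P y) measurable_to_natural) _ set0 (fun=> point) measurable0
  (measurable_cst _) cylinders natural_typeE cylinders_setI _ _ L nL.
- by move=> y; exact: (probability_setT (P y)).
- by move=> _ [l vl ->]; exact: (strong_markov_cylinder vl).1.
- by move=> A _; rewrite set0I measure0 integral0_eq// => y _; rewrite indic0 mul0e.
Qed.

Lemma strong_markov_natural sigma (y : E) L A : stopping_time F sigma ->
  stopped_sigma_field F sigma L -> natural_filtration X +oo A ->
  cP y (L `&` [set w | A (theta (sigma w) w)]) =
  \int[cP y]_w ((\1_L w)%:E * P (X (sigma w) w) A).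
Proof.
move=> st sL nA.
have [| | |_ //] := @disintegration_pi_system _ _ (cOmega y) nOmega R (cP y)
  (fun w => image_measure (P (X (sigma w) w)) measurable_to_natural) _ L
  (fun w => theta (sigma w) w) (stopped_measurable y sL) (measurable_shift st)
  cylinders natural_typeE cylinders_setI _ _ A nA.
- by move=> w; exact: (probability_setT (P _)).
- move=> _ [l vl ->].
  exact: (measurableT_comp (strong_markov_cylinder vl).1 (measurable_stopped_X st)).
- by move=> _ [l vl ->]; exact: (strong_markov_cylinder vl).2.
Qed.

Lemma stopped_sigma_field_sigma_algebra sigma : stopping_time F sigma ->
  sigma_algebra setT (stopped_sigma_field F sigma).
Proof.
move=> [s0 Fs]; split.
- split; first exact: completed_filtration0.
  by move=> t t0; rewrite set0I; exact: completed_filtration0.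
- move=> A [FA FAs]; rewrite setTD; split; first exact: completed_filtrationC.
  move=> t t0; rewrite (_ : _ `&` _ = [set w | sigma w <= t] `&` ~` (A `&` [set w | sigma w <= t])).
    apply: completed_filtrationI; first exact: Fs.
    by apply: completed_filtrationC; exact: FAs.
  by apply/seteqP; split => w /= => [[nA st]|[st]]; [split => // -[] | move=> h; split => // Aw; apply: h].
- move=> A sA; split; first by apply: completed_filtration_bigcup => n; case: (sA n).
  move=> t t0; rewrite setI_bigcupl; apply: completed_filtration_bigcup => n.
  by case: (sA n) => _; exact.
Qed.

(** On [sigma <= t] the value +oo, which [fine] would send to 0, does not occur. *)
Lemma stopped_fine sigma (t : R) (J : set R) : stopping_time F sigma -> measurable J ->
  stopped_sigma_field F sigma ([set w | sigma w <= t%:E] `&` [set w | J (fine (sigma w))]).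
Proof.
move=> st mJ.
pose Q := [set J : set R | stopped_sigma_field F sigma
  ([set w | sigma w <= t%:E] `&` [set w | J (fine (sigma w))])].
have [s0 sC sU] := stopped_sigma_field_sigma_algebra st.
have sG0 w : 0 <= sigma w by case: st.
suff : (@RGenInftyO.G R).-sigma.-measurable `<=` Q.
  by apply; rewrite -RGenInftyO.measurableE.
apply: smallest_sub; first split.
- by rewrite /Q/= (_ : _ `&` _ = set0)//; apply/seteqP; split => // w [].
- move=> A QA; rewrite /Q/= (_ : _ `&` _ = [set w | sigma w <= t%:E] `&`
      (setT `\` ([set w | sigma w <= t%:E] `&` [set w | A (fine (sigma w))]))).
    by apply: stopped_setI; [exact: stopped_le | exact: sC].
  apply/seteqP; split => w /= [h1 h2]; split => //; first by split => // -[_]; case: h2.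
  by split => // Aw; case: h2 => _; apply.
- by move=> A QA; rewrite /Q/= (_ : _ `&` _ = \bigcup_n ([set w | sigma w <= t%:E] `&` [set w | A n (fine (sigma w))])); [exact: sU | rewrite -setI_bigcupr].
move=> _ [r ->]; rewrite /Q/= (_ : _ `&` _ = \bigcup_n
   ([set w | sigma w <= t%:E] `&` [set w | sigma w <= (r - n.+1%:R^-1)%:E])).
  by apply: sU => n; apply: stopped_setI; exact: stopped_le.
apply/seteqP; split => w /=.
- rewrite in_itv/= => -[swt]; have := sG0 w; move: swt; case sw: (sigma w) => [s||//] /=.
    move=> st' s0' sr.
    have [n _ nr] := near_infty_natSinv_lt (PosNum (ltac:(by rewrite subr_gt0) : (0 < r - s)%R)).
    exists n => //; split; rewrite /= sw// lee_fin lerBrDr -lerBrDl ltW//.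
    exact: nr n (leqnn n).
  by rewrite leye_eq.
- move=> [n _ [swt swr]]; split => //; rewrite in_itv/=.
  move: swt swr => /= swt swr; move: swt swr (sG0 w); case: (sigma w) => [s||//] /=.
    by rewrite !lee_fin => _ h _; rewrite (le_lt_trans h)// ltrBlDr ltrDl.
  by rewrite leye_eq.
Qed.

Let time_path (sigma : Omega -> \bar R) w (w' : Omega) : R * nOmega := (fine (sigma w), w').

Let measurable_time_path sigma w : measurable_fun setT (time_path sigma w).
Proof.
by apply: measurable_fun_pair; [exact: measurable_cst | exact: measurable_to_natural].
Qed.

(** Rectangles form a generating system stable under intersection. On a rectangle the constraint on
    [sigma] belongs to the stopped sigma-field, so it joins the conditioning event and the strong
    Markov property is left for the path alone. *)
Lemma strong_markov_functional (sigma : Omega -> \bar R) (y : E) (t : R)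
    (h : R * nOmega -> \bar R) : stopping_time F sigma ->
  measurable_fun setT h -> (forall z, 0 <= h z) ->
  measurable_fun setT (fun w : cOmega y =>
    \int[P (X (sigma w) w)]_w' h (fine (sigma w), w')) /\
  \int[cP y]_w ((\1_[set w : Omega | (sigma w <= t%:E)%E] w)%:E *
    h (fine (sigma w), theta (sigma w) w)) =
  \int[cP y]_w ((\1_[set w : Omega | (sigma w <= t%:E)%E] w)%:E *
     \int[P (X (sigma w) w)]_w' h (fine (sigma w), w')).
Proof.
move=> st mh h0.
pose k w := image_measure (P (X (sigma w) w)) (measurable_time_path sigma w).
pose L := [set w : Omega | (sigma w <= t%:E)%E].
have mL : measurable (L : set (cOmega y)) := stopped_measurable y (stopped_le t st).
have msig : measurable_fun setT (sigma : cOmega y -> \bar R).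
  apply: (@measurability _ _ (cOmega y) _ _ sigma _ (ErealGenInftyO.measurableE R)).
  move=> _ [_ [r ->] <-]; rewrite setTI.
  rewrite (_ : _ @^-1` _ = \bigcup_n [set w | sigma w <= (r - n.+1%:R^-1)%:E]).
    by apply: (@bigcupT_measurable _ (cOmega y)) => n; exact: stopped_measurable (stopped_le _ st).
  have s0 w : 0 <= sigma w by case: st.
  apply/seteqP; split => w /=.
    rewrite in_itv/=; have := s0 w; case sw: (sigma w) => [s||//] /=; last by move=> _; rewrite ltNge leey.
    move=> _ sr; rewrite lte_fin in sr.
    have [n _ nr] := near_infty_natSinv_lt (PosNum (ltac:(by rewrite subr_gt0) : (0 < r - s)%R)).
    exists n => //; rewrite /= sw lee_fin lerBrDr -lerBrDl ltW//.
    exact: nr n (leqnn n).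
  move=> [n _ /= swr]; rewrite in_itv/= (le_lt_trans swr)// lte_fin.
  by rewrite ltrBlDr ltrDl.
have mZ : measurable_fun setT (fun w : cOmega y => (fine (sigma w), theta (sigma w) w) : R * nOmega).
  apply: (@measurable_fun_pair _ _ _ (cOmega y) R nOmega); last exact: measurable_shift.
  exact: measurableT_comp (fine_measurable measurableT) msig.
have prodE : (@measurable _ (R * nOmega)%type) =
    <<s [set A `*` B | A in (@measurable _ R) & B in (@measurable _ nOmega)] >>.
  exact: measurable_prod_measurableType.
have prodI : setI_closed [set A `*` B | A in (@measurable _ R) & B in (@measurable _ nOmega)].
  move=> _ _ [A1 mA1 [B1 mB1 <-]] [A2 mA2 [B2 mB2 <-]].
  exists (A1 `&` A2); first exact: measurableI.
  by exists (B1 `&` B2); [exact: measurableI | rewrite -setXI].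
have kE w (A : set R) (B : set nOmega) :
    k w (A `*` B) = (\1_A (fine (sigma w)))%:E * P (X (sigma w) w) B.
  rewrite /k/= /image_measure/= /pushforward indicE.
  have [Aw|Aw] := boolP (fine (sigma w) \in A).
    rewrite mul1e; congr (P _ _); apply/seteqP; split => w' /=; first by case.
    by move=> Bw'; split => //; exact: set_mem.
  rewrite mul0e (_ : _ @^-1` _ = set0) ?measure0//.
  by apply/seteqP; split => // w' [/= /mem_set]; rewrite (negbTE Aw).
have dis A : measurable A -> measurable_fun setT (fun w : cOmega y => k w A) /\
    cP y (L `&` (fun w : cOmega y => (fine (sigma w), theta (sigma w) w) : R * nOmega) @^-1` A) =
    \int[cP y]_w ((\1_L w)%:E * k w A).
  move=> mA; apply: (@disintegration_pi_system _ _ (cOmega y) (R * nOmega)%type R (cP y)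
    k _ L _ mL mZ _ prodE prodI _ _ A mA).
  - by move=> w; exact: (probability_setT (P _)).
  - move=> _ [A1 mA1 [B1 mB1 <-]]; under eq_fun do rewrite kE.
    apply: emeasurable_funM.
      have mI1 : measurable_fun setT (\1_A1 : R -> R) by exact: measurable_indic.
      apply/measurable_EFinP/(measurableT_comp mI1).
      exact: measurableT_comp (fine_measurable measurableT) msig.
    exact: measurableT_comp (measurable_P_natural mB1) (measurable_stopped_X st).
  - move=> _ [A1 mA1 [B1 mB1 <-]].
    have := strong_markov_natural y st (stopped_fine t st mA1) mB1.
    rewrite -/L (_ : L `&` _ `&` _ = L `&` (fun w : cOmega y =>
       (fine (sigma w), theta (sigma w) w) : R * nOmega) @^-1` (A1 `*` B1)); last first.
      by apply/seteqP; split => w /=; tauto.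
    move=> e; apply: (etrans e); apply: eq_integral => w _; rewrite kE muleA indicI EFinM.
    congr (_ * _%:E * _); exact: (indic_preimage R (fun w => fine (sigma w)) A1 w).
have [mI ->] := @kernel_disintegration _ _ (cOmega y) (R * nOmega)%type R (cP y) k L
  (fun w => (fine (sigma w), theta (sigma w) w)) mL mZ (fun A mA => (dis A mA).1)
  (fun A mA => (dis A mA).2) h mh h0.
have kh w : \int[k w]_z h z = \int[P (X (sigma w) w)]_w' h (fine (sigma w), w').
  exact: ge0_integral_image_measure.
split; first by move: mI; under eq_fun do rewrite kh.
by apply: eq_integral => w _; rewrite kh.
Qed.

End hunt.

(** * Null sets and stopping times *)

Lemma setDD_sub (T : Type) (A A' D D' : set T) :
  (A `\` D) `\` (A' `\` D') `<=` (A `\` A') `|` (D' `\` D).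
Proof.
move=> w [[Aw nDw] h]; have [A'w|] := pselect (A' w); last by left.
by right; split => //; apply: contrapT => nD'w; apply: h.
Qed.

Lemma sub_setIDD (T : Type) (A A' D D' : set T) : D `<=` A ->
  D `<=` (A `\` A') `|` (D `\` D') `|` (A' `&` D').
Proof.
move=> DA w Dw; have [A'w|nA'w] := pselect (A' w); last by left; left; split => //; exact: DA.
by have [D'w|nD'w] := pselect (D' w); [right|left; right].
Qed.

Section null_sets.
Context (R : realType) (M : topologicalType) (d : measure_display)
  (Omega : measurableType d).
Variables (X : \bar R -> Omega -> cemetery_ext M)
  (P : cemetery_ext M -> probability Omega R)
  (theta : \bar R -> Omega -> Omega).
Hypothesis hX : hunt_process X P theta.
Hypothesis hM : hausdorff_space M.

Local Notation E := (borel_cemetery_ext M).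
Local Notation F := (completed_filtration X P).
Local Notation cP y := (@completed_measure_extension _ _ _ (P y)).
Local Notation cOmega y := (caratheodory_type (mu_ext (P y))).
Local Notation nOmega t := (g_sigma_algebraType (natural_gen X t)).
Implicit Types mu : probability E R.

Let mid t : measurable_fun setT (id : Omega -> nOmega t).
Proof. by move=> _ A /(natural_sub_measurable hX) mA; rewrite setTI. Qed.

Let mk t (A : set (nOmega t)) : measurable A ->
  measurable_fun setT (fun y : E => image_measure (P y) (@mid t) A).
Proof.
move=> mA; apply: (measurable_P_natural hX hM).
by apply: natural_mono mA; rewrite leey.
Qed.

(** P_mu as a genuine probability. It lives on the natural sigma-algebra, on whose events [P y] is
    Borel in [y]. *)
Definition initial_law t mu : probability (nOmega t) R :=
  mixture mu (fun y => probability_setT (P y) : image_measure (P y) (@mid t) setT = 1)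
    (@mk t).

Lemma initial_lawE t mu A : initial_law t mu A = \int[mu]_y P y A.
Proof. by []. Qed.

Lemma PmuE mu L : natural_filtration X +oo L ->
  Pmu P mu L = initial_law +oo mu L.
Proof.
move=> nL; have mL := natural_sub_measurable hX nL.
rewrite initial_lawE -ge0_completed_expectationE//; last exact: (measurable_P_natural hX hM).
rewrite /Pmu /Emu; congr (completed_expectation _ _); apply/funext => y.
by rewrite Ex_indic ?completed_measureE//; exact: completed_measurable.
Qed.

Lemma null_setsP mu N : null_sets X P mu N <-> exists L,
  [/\ natural_filtration X +oo L, N `<=` L & initial_law +oo mu L = 0].
Proof.
by split=> -[L [nL NL L0]]; exists L; split => //; move: L0; rewrite PmuE.
Qed.

Lemma null_sets0 mu : null_sets X P mu set0.
Proof. by apply/null_setsP; exists set0; split; rewrite ?measure0//; exact: sigma_algebra0. Qed.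

Lemma null_sets_sub mu N N' : N `<=` N' -> null_sets X P mu N' -> null_sets X P mu N.
Proof. by move=> NN' [L [nL NL L0]]; exists L; split => //; exact: subset_trans NL. Qed.

Lemma null_sets_bigcup mu (N : nat -> set Omega) :
  (forall n, null_sets X P mu (N n)) -> null_sets X P mu (\bigcup_n N n).
Proof.
move=> N0; have /choice[L HL] := fun n => (null_setsP mu (N n)).1 (N0 n).
apply/null_setsP; exists (\bigcup_n L n); split.
- by apply: sigma_algebra_bigcup => n; case: (HL n).
- by apply: subset_bigcup => n _; case: (HL n).
- have mL n : measurable (L n : set (nOmega +oo)) by case: (HL n).
  apply/eqP; rewrite eq_le measure_ge0 andbT.
  have le0 : initial_law +oo mu (\bigcup_n L n) <= \sum_(n <oo) initial_law +oo mu (L n).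
    exact: (@measure_sigma_subadditive _ _ _ (initial_law +oo mu) (\bigcup_n L n) L mL
      (bigcupT_measurable _ mL)).
  by apply: (le_trans le0); rewrite eseries0// => n _ _; case: (HL n).
Qed.

Lemma null_setsU mu N N' : null_sets X P mu N -> null_sets X P mu N' ->
  null_sets X P mu (N `|` N').
Proof.
move=> n0 n0'; rewrite -bigcup2E; apply: null_sets_bigcup => -[|[|n]] //=.
exact: null_sets0.
Qed.

Lemma augmentedP mu t A : <<s natural_filtration X t `|` null_sets X P mu >> A <->
  exists A', [/\ natural_filtration X t A', null_sets X P mu (A `\` A') &
    null_sets X P mu (A' `\` A)].
Proof.
split.
- pose Q := [set A | exists A', [/\ natural_filtration X t A',
    null_sets X P mu (A `\` A') & null_sets X P mu (A' `\` A)]].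
  suff : <<s natural_filtration X t `|` null_sets X P mu >> `<=` Q by exact.
  have nn := null_sets0 mu.
  apply: smallest_sub; first split.
  + by exists set0; rewrite setDv; split => //; exact: sigma_algebra0.
  + move=> B [B' [nB' BB' B'B]]; exists (~` B'); split.
    * exact: sigma_algebraC.
    * by apply: null_sets_sub B'B => w [[_ nBw] /contrapT B'w].
    * by apply: null_sets_sub BB' => w [nB'w h]; split => //; apply: contrapT => nBw; exact: h.
  + move=> B /choice[B' HB']; exists (\bigcup_n B' n); split.
    * by apply: sigma_algebra_bigcup => n; case: (HB' n).
    * have : null_sets X P mu (\bigcup_n (B n `\` B' n)).
        by apply: null_sets_bigcup => n; case: (HB' n).
      by apply: null_sets_sub => w [[n _ Bw] h]; exists n => //; split => // ?; apply: h; exists n.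
    * have : null_sets X P mu (\bigcup_n (B' n `\` B n)).
        by apply: null_sets_bigcup => n; case: (HB' n).
      by apply: null_sets_sub => w [[n _ Bw] h]; exists n => //; split => // ?; apply: h; exists n.
  + move=> B [nB|nB]; first by exists B; rewrite setDv.
    exists set0; rewrite setD0 set0D; split => //; exact: sigma_algebra0.
- move=> [A' [nA' AA' A'A]].
  pose aug := g_sigma_algebraType (natural_filtration X t `|` null_sets X P mu).
  have -> : A = (A' `\` (A' `\` A)) `|` (A `\` A').
    apply/seteqP; split => w.
      by have [Aw|nAw] := pselect (A' w) => Bw; [left; split => // -[]|right].
    by move=> [[Aw /not_andP[//|]]|[]//]; exact: contrapT.
  apply: (@measurableU _ aug); last by apply: sub_sigma_algebra; right.
  by apply: (@measurableD _ aug); apply: sub_sigma_algebra; [left|right].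
Qed.

Lemma completed_filtration_ae t A B : F t A ->
  (forall mu, null_sets X P mu (A `\` B) /\ null_sets X P mu (B `\` A)) -> F t B.
Proof.
move=> FA AB mu; have /augmentedP[A' [nA' AA' A'A]] := FA mu.
have [ABn BAn] := AB mu; apply/augmentedP; exists A'; split => //.
- apply: null_sets_sub (null_setsU BAn AA') => w [Bw nA'w].
  by have [Aw|nAw] := pselect (A w); [right|left].
- apply: null_sets_sub (null_setsU ABn A'A) => w [A'w nBw].
  by have [Aw|nAw] := pselect (A w); [left|right].
Qed.

(** [A] may fail to be measurable, and the natural set [N] covering the difference is null only for
    the mixture. But then P y N = 0 for [y] outside a [mu]-null set, and for such [y] the sets [A]
    and [A'] have the same completed measure. *)
Lemma Pmu_version mu A A' : natural_filtration X +oo A' ->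
  null_sets X P mu (A `\` A') -> null_sets X P mu (A' `\` A) ->
  Pmu P mu A = initial_law +oo mu A'.
Proof.
move=> nA' AA' A'A; have /null_setsP[N [nN NL N0]] := null_setsU AA' A'A.
have mN := natural_sub_measurable hX nN; have mA' := natural_sub_measurable hX nA'.
have mPN := measurable_P_natural hX hM nN.
pose S : set E := [set y | P y N != 0].
have mS : measurable S.
  rewrite (_ : S = ~` ((fun y : E => P y N) @^-1` [set 0])).
    by apply: measurableC; rewrite -[X in measurable X]setTI; exact: mPN.
  by apply/seteqP; split => y /= /eqP.
have S0 : mu S = 0.
  have : \int[mu]_y `|P y N| = 0.
    by rewrite -[RHS]N0 initial_lawE; apply: eq_integral => y _; rewrite gee0_abs.
  move=> /(ae_eq_integral_abs mu measurableT mPN)[Z [mZ Z0 SZ]].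
  apply/eqP; rewrite eq_le measure_ge0 andbT -Z0; apply: le_measure; rewrite ?inE//.
  by move=> y /eqP Sy; apply: SZ => /= h; apply: Sy; exact: h.
rewrite initial_lawE /Pmu /Emu.
apply: (completed_expectation_ae (measurable_P_natural hX hM nA') _ mS S0) => //.
move=> y /negP/negPn/eqP PN0.
have mA : measurable (A : set (cOmega y)).
  by apply: (completed_measurable_symdiff mA' mN PN0); apply: subset_trans NL => w ?; [right|left].
rewrite Ex_indic// -completed_measureE//.
have [mN' cN0] := completed_null mN PN0 (@subset_refl _ N).
have cU (B : set (cOmega y)) : measurable B -> cP y B = cP y (B `\` N).
  move=> mB; rewrite (measureDI (cP y) mB mN') [X in _ + X](_ : _ = 0) ?adde0//.
  apply/eqP; rewrite eq_le measure_ge0 andbT -cN0; apply: le_measure; rewrite ?inE//.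
  exact: measurableI.
rewrite cU; last exact: completed_measurable.
rewrite [RHS]cU//; congr (cP y _); apply/seteqP; split => w [Aw nNw]; split => //.
- by apply: contrapT => nAw; apply/nNw/NL; right.
- by apply: contrapT => nAw; apply/nNw/NL; left.
Qed.

(* [V] is not assumed measurable: in quasi-left-continuity it is the event that
   the positions converge. *)
Lemma null_sets_avoid mu A D V : F +oo A -> F +oo D -> D `<=` A -> V `<=` A `\` D ->
  Pmu P mu V = Pmu P mu A -> null_sets X P mu D.
Proof.
move=> FA FD DA VAD PVA.
have /augmentedP[A' [nA' AA' A'A]] := FA mu.
have /augmentedP[D' [nD' DD' D'D]] := FD mu.
have VADE w : (\1_V w <= \1_(A `\` D) w :> R)%R.
  rewrite !indicE; have [/set_mem/VAD VDw|_] := boolP (w \in V).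
    by rewrite (mem_set VDw).
  by rewrite ler0n.
have PVA' : Pmu P mu V <= Pmu P mu (A `\` D).
  rewrite /Pmu /Emu; apply: ge0_le_completed_expectation.
    by move=> y; apply: integral_ge0 => w _; rewrite lee_fin.
  move=> y; apply: ge0_le_completed_expectation => w; rewrite lee_fin; last exact: VADE.
  exact: ler0n.
have mA' : measurable (A' : set (nOmega +oo)) by [].
have mD' : measurable (D' : set (nOmega +oo)) by [].
have mAD' : measurable (A' `\` D' : set (nOmega +oo)) by exact: measurableD.
have PA := Pmu_version nA' AA' A'A.
have PAD : Pmu P mu (A `\` D) = initial_law +oo mu (A' `\` D').
  apply: Pmu_version; first exact: mAD'.
  - exact: null_sets_sub (@setDD_sub _ _ _ _ _) (null_setsU AA' D'D).
  - exact: null_sets_sub (@setDD_sub _ _ _ _ _) (null_setsU A'A DD').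
have AD0 : initial_law +oo mu (A' `&` D') = 0.
  have fAD : initial_law +oo mu (A' `\` D') \is a fin_num by exact: fin_num_measure.
  have PVE : Pmu P mu V = initial_law +oo mu (A' `\` D') + initial_law +oo mu (A' `&` D').
    by rewrite PVA PA; exact: measureDI.
  move: PVA'; rewrite PVE PAD.
  rewrite -[X in _ <= X]adde0 (@leeD2lE _ _ _ _ fAD) => le0.
  by apply/eqP; rewrite eq_le le0 measure_ge0.
have AD : null_sets X P mu (A' `&` D'); last first.
  exact: null_sets_sub (@sub_setIDD _ _ _ _ _ DA) (null_setsU (null_setsU AA' DD') AD).
by apply/null_setsP; exists (A' `&` D'); split => //; exact: (@measurableI _ (nOmega +oo)).
Qed.

Lemma measurable_stopping_lt sigma t : stopping_time F sigma -> F t [set w | sigma w < t].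
Proof.
move=> [s0 Fs].
have Fle s : s <= t -> F t [set w | sigma w <= s].
  move=> st; have [s0'|s0'] := leP 0 s; first by apply: completed_filtration_mono (Fs s s0').
  rewrite (_ : [set _ | _] = set0); first exact: completed_filtration0.
  by apply/seteqP; split => // w /= h; have := le_lt_trans h s0'; rewrite ltNge s0.
case: t Fle => [t| |] Fle.
- rewrite (_ : [set _ | _] = \bigcup_n [set w | sigma w <= (t - n.+1%:R^-1)%:E]).
    by apply: completed_filtration_bigcup => n; apply: Fle; rewrite lee_fin lerBlDr lerDl.
  apply/seteqP; split => w /=.
    have := s0 w; case sw: (sigma w) => [s||//] /= _; last by rewrite ltNge leey.
    rewrite lte_fin => st.
    have [n _ nr] := near_infty_natSinv_lt (PosNum (ltac:(by rewrite subr_gt0) : (0 < t - s)%R)).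
    exists n => //; rewrite /= sw lee_fin lerBrDr -lerBrDl ltW//.
    exact: nr n (leqnn n).
  by move=> [n _ /= h]; rewrite (le_lt_trans h)// lte_fin ltrBlDr ltrDl.
- rewrite (_ : [set _ | _] = \bigcup_n [set w | sigma w <= n%:R%:E]).
    by apply: completed_filtration_bigcup => n; apply: Fle; rewrite leey.
  apply/seteqP; split => w /=; last by move=> [n _ /= h]; rewrite (le_lt_trans h)// ltry.
  have := s0 w; case sw: (sigma w) => [s| |]//= s0' _.
  exists (Num.bound s) => //; rewrite /= sw lee_fin ltW//.
  by apply: archi_boundP; rewrite -lee_fin.
- rewrite (_ : [set _ | _] = set0); first exact: completed_filtration0.
  by apply/seteqP; split => // w /=; rewrite ltNge leNye.
Qed.

Lemma stopping_time_lt sigma : (forall w, 0 <= sigma w) ->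
  (forall t : R, (0 <= t)%R -> F t%:E [set w | sigma w < t%:E]) -> stopping_time F sigma.
Proof.
move=> s0 Fs; split => // -[t| |] t0; last by [].
- rewrite lee_fin in t0; rewrite (hunt_filtration hX t0) => s /= ts.
  have [n0 n0s] : exists n0 : nat, (t + n0.+1%:R^-1)%:E <= s.
    case: s ts => [s||//]; last by exists 0%N; rewrite leey.
    rewrite lte_fin => ts.
    have [n _ nr] := near_infty_natSinv_lt (PosNum (ltac:(by rewrite subr_gt0) : (0 < s - t)%R)).
    by exists n; rewrite lee_fin -lerBrDl ltW//; exact: nr n (leqnn n).
  (* Starting the intersection at [n0] keeps all its events in [F s]. *)
  rewrite (_ : [set _ | _] = \bigcap_n [set w | sigma w < (t + (n0 + n).+1%:R^-1)%:E]).
    apply: completed_filtration_bigcap => n.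
    apply: (@completed_filtration_mono _ _ _ _ _ _ (t + (n0 + n).+1%:R^-1)%:E).
      apply: le_trans n0s; rewrite lee_fin lerD2l lef_pV2 ?posrE//.
      by rewrite ler_nat ltnS leq_addr.
    by apply: Fs; rewrite addr_ge0.
  apply/seteqP; split => w /=.
    by move=> h n _ /=; rewrite (le_lt_trans h)// lte_fin ltrDl.
  move=> h; apply/lee_addgt0Pr => e e0.
  have [n _ nr] := near_infty_natSinv_lt (PosNum e0).
  apply: le_trans (ltW (h n I)) _; rewrite -EFinD lee_fin lerD2l.
  by rewrite ltW//; apply: (nr (n0 + n)%N); rewrite /= leq_addl.
- rewrite (_ : [set _ | _] = setT); first exact: completed_filtrationT.
  by apply/seteqP; split => // w _ /=; rewrite leey.
Qed.

Lemma stopping_time_ae sigma tau : stopping_time F sigma -> (forall w, 0 <= tau w) ->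
  (forall mu, null_sets X P mu [set w | sigma w <> tau w]) -> stopping_time F tau.
Proof.
move=> [s0 Fs] t0 st; split => // t t0'.
apply: (completed_filtration_ae (Fs t t0')) => mu; split.
- by apply: null_sets_sub (st mu) => w [/= h1 h2] e; apply: h2; rewrite -e.
- by apply: null_sets_sub (st mu) => w [/= h1 h2] e; apply: h2; rewrite e.
Qed.

Lemma stopping_time_sup (s : nat -> Omega -> \bar R) (sigma : Omega -> \bar R) :
  (forall n, stopping_time F (s n)) ->
  (forall w, sigma w = ereal_sup [set s n w | n in setT]) -> stopping_time F sigma.
Proof.
move=> st sE; split => [w|t t0].
  rewrite sE; apply: le_trans (ereal_sup_ubound _); last by exists 0%N.
  by case: (st 0%N).
rewrite (_ : [set _ | _] = \bigcap_n [set w | s n w <= t]).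
  by apply: completed_filtration_bigcap => n; case: (st n) => _; exact.
apply/seteqP; split => w /=; rewrite sE.
  by move=> h n _ /=; apply: le_trans h; apply: ereal_sup_ubound; exists n.
by move=> h; apply: ge_ereal_sup => _ [n _ <-]; exact: h.
Qed.

(* By quasi-left-continuity, a path that is in the open set [G n] at time
   [sigma] is almost surely in it at all late times [s m], in particular for
   some [m >= n]. *)
Lemma quasi_left_avoid (s : nat -> Omega -> \bar R) (sigma : Omega -> \bar R)
    (G : nat -> set (cemetery_ext M)) :
  (forall n, stopping_time F (s n)) ->
  (forall w, {homo s^~ w : m n / (m <= n)%N >-> m <= n}) ->
  (forall w, sigma w = ereal_sup [set s n w | n in setT]) ->
  (forall n, open (G n)) -> (forall m n, (m <= n)%N -> G m `<=` G n) ->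
  (forall n w, s n w < +oo -> ~ G n (X (s n w) w)) ->
  forall mu, null_sets X P mu
    [set w | sigma w < +oo /\ (\bigcup_n G n) (X (sigma w) w)].
Proof.
move=> st nd sE oG ndG sG mu.
have st' := stopping_time_sup st sE.
have scvg w : s n w @[n --> \oo] --> sigma w.
  by rewrite sE; exact: ereal_nondecreasing_cvgn (nd w).
have bG : borel (\bigcup_n G n) by apply: borel_open; exact: bigcup_open.
have FA : F +oo [set w | sigma w < +oo] by exact: measurable_stopping_lt.
apply: (null_sets_avoid FA _ _ _ (hunt_quasi_left_continuous hX st nd scvg mu)).
- apply: completed_filtrationI => //; exact: (stopped_X hX hM st' bG).1.
- by move=> w [].
- move=> w [cvgX soo]; split => // -[_ [n _ Gn]].
  have := cvgX (G n) (open_nbhs_nbhs (conj (oG n) Gn)).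
  move=> [m _ /(_ (maxn m n))]; rewrite /= leq_maxl => /(_ isT) GX.
  apply: (sG (maxn m n) w); last by apply: ndG GX; rewrite leq_maxr.
  apply: le_lt_trans soo; rewrite sE; apply: ereal_sup_ubound; by exists (maxn m n).
Qed.

End null_sets.

(** * Hitting times *)

Section hitting_time.
Context (R : realType) (M : topologicalType) (d : measure_display)
  (Omega : measurableType d).
Variables (X : \bar R -> Omega -> cemetery_ext M)
  (P : cemetery_ext M -> probability Omega R)
  (theta : \bar R -> Omega -> Omega).
Hypothesis hX : hunt_process X P theta.

Local Notation E := (borel_cemetery_ext M).
Local Notation F := (completed_filtration X P).
Local Notation nOmega t := (g_sigma_algebraType (natural_gen X t)).
Implicit Types (mu : probability E R) (V W : set (cemetery_ext M)).

Lemma hitting_after_ge V sigma w : sigma w <= hitting_after X V sigma w.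
Proof. by apply: le_ereal_inf_tmp => _ [s [_ h _] <-]. Qed.

Lemma hitting_after_ge0 V sigma w : 0 <= hitting_after X V sigma w.
Proof. by apply: le_ereal_inf_tmp => _ [s [h _ _] <-]; rewrite lee_fin. Qed.

Lemma hitting_after_le V (sigma : Omega -> \bar R) w (s : R) : (0 <= s)%R ->
  sigma w <= s%:E -> V (X s%:E w) -> hitting_after X V sigma w <= s%:E.
Proof. by move=> s0 ss Vs; apply: ereal_inf_lbound; exists s. Qed.

Lemma hitting_after_lt V (sigma : Omega -> \bar R) w t : hitting_after X V sigma w < t <->
  exists s : R, [/\ (0 <= s)%R, sigma w <= s%:E, s%:E < t & V (X s%:E w)].
Proof.
split=> [/ereal_inf_lt[_ [s [s0 ss Vs] <-] st]|[s [s0 ss st Vs]]]; first by exists s.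
exact: le_lt_trans (hitting_after_le s0 ss Vs) st.
Qed.

Lemma hitting_after_sub V W sigma w : V `<=` W ->
  hitting_after X W sigma w <= hitting_after X V sigma w.
Proof.
move=> VW; apply: le_ereal_inf_tmp => _ [s [s0 ss Vs] <-].
by apply: hitting_after_le => //; exact: VW.
Qed.

(** Outside the closed set [W] the path would stay outside for some time by right-continuity,
    whereas [V] is visited at or arbitrarily soon after the infimum. *)
Lemma hitting_after_closed V W sigma w : V `<=` W -> closed W ->
  hitting_after X V sigma w < +oo -> W (X (hitting_after X V sigma w) w).
Proof.
move=> VW clW; have := hitting_after_ge0 V sigma w.
case hE: (hitting_after X V sigma w) => [h| |]// h0 _; rewrite lee_fin in h0.
apply: contrapT => nWh.
have [e e0 He] := right_continuousP hX (w := w) h0 (closed_openC clW) nWh.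
have : hitting_after X V sigma w < (h + e)%:E by rewrite hE lte_fin ltrDl.
move=> /hitting_after_lt[s [s0 ss se Vs]]; apply: (He s); last exact: VW.
by rewrite -!lte_fin se andbT -lee_fin -hE; exact: hitting_after_le.
Qed.

Lemma hitting_after_shift V sigma w (s : R) : (0 <= s)%R -> sigma w = s%:E ->
  hitting_after X V sigma w = s%:E + hitting_after X V (fun=> 0) (theta s%:E w).
Proof.
move=> s0 sE; apply/eqP; rewrite eq_le; apply/andP; split.
- rewrite -leeBlDl//; apply: le_ereal_inf_tmp => _ [r [r0 _ Vr] <-].
  rewrite leeBlDl// -EFinD; apply: hitting_after_le; first exact: addr_ge0.
    by rewrite sE lee_fin lerDl.
  by move: Vr; rewrite (shift_X hX) ?lee_fin// -EFinD addrC.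
- apply: le_ereal_inf_tmp => _ [r [r0 sr Vr] <-]; rewrite sE lee_fin in sr.
  rewrite -leeBrDl// -EFinB; apply: hitting_after_le; rewrite ?lee_fin ?subr_ge0//.
  by rewrite (shift_X hX) ?lee_fin ?subr_ge0// -EFinD subrK.
Qed.

(** A visit at time [s] to an open set lasts for a while, so a rational time strictly after [s],
    hence strictly after [sigma], can replace it. *)
Lemma hitting_after_open G sigma w t : open G -> hitting_after X G sigma w < t%:E <->
  exists q : rat, [/\ (0 <= ratr q :> R)%R, (ratr q < t :> R)%R,
    sigma w < (ratr q : R)%:E & G (X (ratr q : R)%:E w)].
Proof.
move=> oG; split=> [/hitting_after_lt[s [s0 ss st Gs]]|[q [q0 qt sq Gq]]]; last first.
  by apply/hitting_after_lt; exists (ratr q); split=> //; rewrite ltW.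
have [e e0 He] := right_continuousP hX (w := w) s0 oG Gs.
have sb : (s < Num.min t (s + e))%R by rewrite lt_min ltrDl e0 -lte_fin st.
have [q] := rat_in_itvoo sb; rewrite in_itv/= lt_min => /andP[sq /andP[qt qe]].
exists q; split=> //; first by rewrite (le_trans s0)// ltW.
  by rewrite (le_lt_trans ss)// lte_fin.
by apply: He; rewrite ltW.
Qed.

Lemma completed_filtration_bigcup_rat t (A : rat -> set Omega) :
  (forall q, F t (A q)) -> F t (\bigcup_q A q).
Proof.
move=> FA; rewrite -completed_filtrationE.
by apply: (@bigcupT_measurable_rat _ (g_sigma_algebraType (F t))) => q; rewrite completed_filtrationE.
Qed.

Lemma stopping_hitting_open G sigma : open G -> stopping_time F sigma ->
  stopping_time F (hitting_after X G sigma).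
Proof.
move=> oG st; apply: (stopping_time_lt hX); first exact: hitting_after_ge0.
move=> t t0; pose A (q : rat) := if (0 <= (ratr q : R) < t)%R then
  [set w | sigma w < (ratr q : R)%:E] `&` X (ratr q : R)%:E @^-1` G else set0.
rewrite (_ : [set _ | _] = \bigcup_q A q).
  apply: completed_filtration_bigcup_rat => q; rewrite /A.
  case: ifPn => [/andP[q0 qt]|_]; last exact: completed_filtration0.
  apply: completed_filtrationI.
    apply: (completed_filtration_mono _ (measurable_stopping_lt st)).
    by rewrite lee_fin ltW.
  have bG := borel_open oG.
  apply: natural_sub_completed; apply: (measurable_natural (t := t%:E) _ _ bG).
    by rewrite lee_fin.
  by rewrite lee_fin ltW.
apply/seteqP; split=> [w /= /(hitting_after_open _ _ _ oG)[q [q0 qt sq Gq]]|w [q _]].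
  by exists q => //; rewrite /A q0 qt.
rewrite /A; case: ifPn => // /andP[q0 qt] [sq Gq].
by apply/(hitting_after_open _ _ _ oG); exists q.
Qed.

Lemma measurable_hitting_open G : open G ->
  measurable_fun setT (hitting_after X G (fun=> 0) : nOmega +oo -> \bar R).
Proof.
move=> oG; apply: (measurability _ (ErealGenInftyO.measurableE R)) => //.
move=> _ [_ [t ->] <-]; rewrite setTI.
pose A (q : rat) : set (nOmega +oo) := if (0 < (ratr q : R) < t)%R then
  X (ratr q : R)%:E @^-1` G else set0.
rewrite (_ : _ @^-1` _ = \bigcup_q A q).
  apply: bigcupT_measurable_rat => q; rewrite /A.
  case: ifPn => [/andP[q0 qt]|_]; last exact: measurable0.
  apply: measurable_natural; rewrite ?lee_fin ?ltW// ?ltry//.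
  exact: borel_open.
apply/seteqP; split=> [w /=|w [q _]].
  rewrite in_itv/= => /(hitting_after_open _ _ _ oG)[q [q0 qt sq Gq]].
  by exists q => //; rewrite /A qt andbT -lte_fin sq.
rewrite /A; case: ifPn => // /andP[q0 qt] Gq; rewrite /= in_itv/=.
by apply/(hitting_after_open _ _ _ oG); exists q; rewrite lte_fin ltW.
Qed.

Section metrizable.
Variable K : nat -> set M.
Hypothesis cK : forall i, compact (K i).
Hypothesis baseK : forall (G : set M) x, open G -> G x ->
  exists2 i, (K i)^° x & K i `<=` G.
Hypothesis hM : hausdorff_space M.

Lemma null_sets_bigcup_rat mu (N : rat -> set Omega) :
  (forall q, null_sets X P mu (N q)) -> null_sets X P mu (\bigcup_q N q).
Proof.
move=> N0; pose N' n := if unpickle n is Some q then N q else set0.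
apply: (@null_sets_sub _ _ _ _ _ _ _ _ (\bigcup_n N' n)).
  by move=> w [q _ Nq]; exists (pickle q); [exact: I|rewrite /N' pickleK].
apply: (null_sets_bigcup hX hM) => n; rewrite /N'.
by case: unpickle => [q|]; [exact: N0|exact: (null_sets0 hX hM)].
Qed.

(** The event that the hitting time is less than [t] is the projection of the set of (s, w) with s <
    t, sigma w <= s and X_s in [V]. As [sigma] is only a stopping time of the completed filtration,
    each event [sigma <= q] is first replaced by a natural event [A q]; the errors form one null set
    [N], outside which the projection theorem applies to the law P_mu. *)
Lemma stopping_hitting_borel V sigma : borel V -> stopping_time F sigma ->
  stopping_time F (hitting_after X V sigma).
Proof.
move=> bV [s0 Fs]; apply: (stopping_time_lt hX); first exact: hitting_after_ge0.
move=> t t0 mu.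
have /choice[A HA] : forall q : rat, exists A : set Omega, natural_filtration X t%:E A /\
    null_sets X P mu [set w | (0 <= (ratr q : R) < t)%R /\
      ~ (sigma w <= (ratr q : R)%:E <-> A w)].
  move=> q; have [/andP[q0 qt]|nq] := boolP (0 <= (ratr q : R) < t)%R; last first.
    exists set0; split; first exact: sigma_algebra0.
    by apply: null_sets_sub (null_sets0 hX hM mu) => w [].
  have FA : F t%:E [set w | sigma w <= (ratr q : R)%:E].
    by apply: completed_filtration_mono (Fs _ _); rewrite lee_fin// ltW.
  have /(augmentedP hX hM)[A [nA A1 A2]] := FA mu; exists A; split => //.
  apply: null_sets_sub (null_setsU hX hM A1 A2) => w [_ h].
  have [Aw|nAw] := pselect (A w); [right|left]; split=> //.
    by move=> sq; apply: h.
  by apply: contrapT => sq; apply: h.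
pose N := \bigcup_q [set w | (0 <= (ratr q : R) < t)%R /\
      ~ (sigma w <= (ratr q : R)%:E <-> A q w)].
have N0 : null_sets X P mu N by apply: null_sets_bigcup_rat => q; case: (HA q).
(* For s < t, sigma <= s means that sigma <= q for all rationals q in (s, t). *)
pose S q : set (\bar R * nOmega t%:E) := if (0 <= (ratr q : R) < t)%R then
  [set z | z.1 \in `[(ratr q : R)%:E, +oo[ ] `|` [set z | A q z.2] else setT.
pose H := [set z : \bar R * nOmega t%:E | [/\ 0 <= z.1, z.1 < t%:E & V (X z.1 z.2)]] `&`
  \bigcap_q S q.
have mH : measurable H.
  apply: measurableI; first exact: (progressive hX cK baseK hM).
  rewrite -[X in measurable X]setCK setC_bigcap; apply: measurableC.
  apply: bigcupT_measurable_rat => q; apply: measurableC; rewrite /S.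
  case: ifPn => _; last exact: measurableT.
  apply: measurableU; rewrite -[X in measurable X]setTI.
    exact: (measurable_fst measurableT [set` `[(ratr q : R)%:E, +oo[ ] (emeasurable_itv _)).
  by apply: (measurable_snd measurableT (A q : set (nOmega t%:E))); exact: (HA q).1.
have HE w : ~ N w -> (snd @` H) w <-> hitting_after X V sigma w < t%:E.
  move=> nN; have Aw q : (0 <= (ratr q : R) < t)%R -> (sigma w <= (ratr q : R)%:E <-> A q w).
    by move=> qt; apply: contrapT => h; apply: nN; exists q.
  split=> [[[s w'] [[/= s0' st Vs] Ss] /= w'E]|/hitting_after_lt[s [s0' ss st Vs]]].
    rewrite {}w'E in Vs Ss; apply/hitting_after_lt.
    case: s => [s||//] in s0' st Vs Ss *; last by rewrite ltNge leey in st.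
    exists s; split; rewrite -?lee_fin//; apply/lee_addgt0Pr => e e0.
    have sb : (s < Num.min t (s + e))%R by rewrite lt_min ltrDl e0 -lte_fin st.
    have [q] := rat_in_itvoo sb; rewrite in_itv/= lt_min => /andP[sq /andP[qt qe]].
    have q0 : (0 <= (ratr q : R) < t)%R by rewrite qt andbT (le_trans _ (ltW sq))// -lee_fin.
    have := Ss q I; rewrite /S q0 => -[|/= Aq].
      by rewrite /= in_itv/= andbT lee_fin leNgt sq.
    by apply: (le_trans ((Aw q q0).2 Aq)); rewrite -EFinD lee_fin ltW.
  exists (s%:E, w) => //; split; first by split; rewrite //= lee_fin.
  move=> q _; rewrite /S; case: ifPn => // q0.
  have [qs|sq] := leP (ratr q : R) s; first by left; rewrite /= in_itv/= andbT lee_fin.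
  by right; apply/(Aw q q0); apply: (le_trans ss); rewrite lee_fin ltW.
have [A1 [A2 [mA1 mA2 A1H HA2 A21]]] := measurable_projection (initial_law hX hM t%:E mu) mH.
apply/(augmentedP hX hM); exists A1; split; first exact: mA1.
- apply: (null_sets_sub _ (null_setsU hX hM N0 (_ : null_sets X P mu (A2 `\` A1)))).
    move=> w [hw nA1]; have [Nw|nNw] := pselect (N w); first by left.
    by right; split => //; apply: HA2; exact/(HE w nNw).
  apply/(null_setsP hX hM); exists (A2 `\` A1); split => //.
  by apply: (@natural_mono _ _ _ _ _ t%:E); rewrite ?leey//; exact: (@measurableD _ (nOmega t%:E)).
- apply: (null_sets_sub _ N0) => w [A1w nh]; apply: contrapT => nNw; apply: nh.
  by apply/(HE w nNw); exact: A1H.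
Qed.

(* The exit times from these compact subsets of [U] are hitting times of open
   sets, and by quasi-left-continuity their supremum is almost surely the exit
   time from [U]. *)
Fixpoint compact_part (U : set M) m : set M :=
  if m is m'.+1 then compact_part U m' `|` (if `[< K m' `<=` U >] then K m' else set0)
  else set0.

Lemma compact_compact_part U m : compact (compact_part U m).
Proof.
elim: m => [|m IH] /=; first exact: compact0.
by apply: compactU => //; case: asboolP => // _; exact: compact0.
Qed.

Lemma compact_part_sub U m : compact_part U m `<=` U.
Proof.
elim: m => [//|m IH] /= x [/IH//|]; by case: asboolP => // KU /KU.
Qed.

Lemma compact_part_mono U m n : (m <= n)%N -> compact_part U m `<=` compact_part U n.
Proof.
by elim: n => [|n IH]; [rewrite leqn0 => /eqP->|rewrite leq_eqVlt => /orP[/eqP->//|/IH h] x /h; left].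
Qed.

Lemma bigcup_compact_part U : open U -> \bigcup_m (compact_part U m)^° = U.
Proof.
move=> oU; apply/seteqP; split=> [x [m _ /interior_subset/compact_part_sub//]|x Ux].
have [i Kx KU] := baseK oU Ux; exists i.+1 => //.
by apply: (@interiorS _ (K i)) => // y Ky /=; right; rewrite asboolT.
Qed.

Definition exit_part U m sigma : Omega -> \bar R :=
  exit_after X (Some @` compact_part U m) sigma.

Definition exit_limit U sigma (w : Omega) : \bar R :=
  ereal_sup [set exit_part U m sigma w | m in setT].

Lemma exit_part_open U m : open (~` (Some @` compact_part U m) : set (cemetery_ext M)).
Proof.
by apply: closed_openC; apply: closed_cemetery_compact => //; exact: compact_compact_part.
Qed.

Lemma stopping_exit_part U m sigma : stopping_time F sigma ->
  stopping_time F (exit_part U m sigma).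
Proof. by move=> st; apply: stopping_hitting_open => //; exact: exit_part_open. Qed.

(** Where the limit falls short of the exit time, the path is still in [U] at the limit. Yet at each
    approximating exit time it is outside the interior of the compact part, and these interiors
    exhaust [U], so [quasi_left_avoid] makes this a null event. *)
Lemma exit_limit_ae U sigma mu : open U -> stopping_time F sigma ->
  null_sets X P mu [set w | exit_limit U sigma w <> exit_after X (Some @` U) sigma w].
Proof.
move=> oU st.
pose G m : set (cemetery_ext M) := Some @` (compact_part U m)^°.
have GU : \bigcup_m G m = Some @` U by rewrite -[in RHS](bigcup_compact_part oU) image_bigcup.
have oG m : open (G m).
  exact/one_point_compactification_open_some/open_interior.
have Gmono m n : (m <= n)%N -> G m `<=` G n.
  by move=> mn; apply: image_subset; apply: interiorS; exact: compact_part_mono.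
have Tmono w : {homo (exit_part U)^~ sigma ^~ w : m n / (m <= n)%N >-> m <= n}.
  move=> m n mn; apply: hitting_after_sub; apply: subsetC; apply: image_subset.
  exact: compact_part_mono.
have nG m w : exit_part U m sigma w < +oo -> ~ G m (X (exit_part U m sigma w) w).
  apply: (@hitting_after_closed _ (~` G m)); last exact: open_closedC.
  by apply: subsetC; apply: image_subset; exact: interior_subset.
apply: null_sets_sub (quasi_left_avoid hX hM (fun m => stopping_exit_part U m st)
  Tmono (fun w => erefl (exit_limit U sigma w)) oG Gmono nG mu).
rewrite GU => w /= Tne.
have Tle : exit_limit U sigma w <= exit_after X (Some @` U) sigma w.
  apply: ge_ereal_sup => _ [m _ <-]; apply: hitting_after_sub; apply: subsetC.
  by apply: image_subset; exact: compact_part_sub.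
have {Tne}Tlt : exit_limit U sigma w < exit_after X (Some @` U) sigma w.
  by rewrite lt_neqAle Tle andbT; exact/eqP.
have sT : sigma w <= exit_limit U sigma w.
  by apply: le_trans (hitting_after_ge _ _ _) (ereal_sup_ubound _); exists 0%N.
have T0 : 0 <= exit_limit U sigma w by apply: le_trans sT; case: st.
split; first by apply: (lt_le_trans Tlt); rewrite leey.
case: (exit_limit U sigma w) sT T0 Tlt {Tle} => [T||]// sT T0 Tlt.
  apply: contrapT => nU; move: Tlt; rewrite ltNge => /negP; apply.
  by apply: hitting_after_le; rewrite -?lee_fin.
by move: Tlt; rewrite ltNge leey.
Qed.

Lemma stopping_exit U sigma : open U -> stopping_time F sigma ->
  stopping_time F (exit_after X (Some @` U) sigma).
Proof.
move=> oU st.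
have sT : stopping_time F (exit_limit U sigma).
  by apply: stopping_time_sup => // m; exact: stopping_exit_part.
apply: (stopping_time_ae hX hM sT); first by move=> w; exact: hitting_after_ge0.
by move=> mu; exact: exit_limit_ae.
Qed.

(** Valid path by path, because it holds for each approximating exit time and a strict inequality
    below a supremum is reached by one of them. *)
Lemma exit_limit_shift U sigma w (s t : R) : (0 <= s)%R -> sigma w = s%:E ->
  t%:E < exit_limit U sigma w <->
  (t - s)%:E < exit_limit U (fun=> 0) (theta s%:E w).
Proof.
move=> s0 sE; have e m : exit_part U m sigma w =
    s%:E + exit_part U m (fun=> 0) (theta s%:E w) by exact: hitting_after_shift.
have e' m : (t%:E < exit_part U m sigma w) =
    ((t - s)%:E < exit_part U m (fun=> 0) (theta s%:E w)).
  by rewrite e addeC -lteBlDr// EFinB.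
split=> /ereal_sup_gt[_ [m _ <-]] h.
- by apply: (lt_le_trans _ (ereal_sup_ubound _)); [rewrite e' in h; exact: h|exists m].
- by apply: (lt_le_trans _ (ereal_sup_ubound _)); [rewrite -e' in h; exact: h|exists m].
Qed.

Lemma measurable_exit_limit U :
  measurable_fun setT (exit_limit U (fun=> 0) : nOmega +oo -> \bar R).
Proof.
apply: (measurability _ (ErealGenOInfty.measurableE R)) => //.
move=> _ [_ [t ->] <-]; rewrite setTI.
rewrite (_ : _ @^-1` _ = \bigcup_m [set w : nOmega +oo |
    t%:E < exit_part U m (fun=> 0) w]).
  apply: bigcupT_measurable => m.
  have := measurable_hitting_open (@exit_part_open U m).
  move=> /(_ measurableT `]t%:E, +oo[%classic (emeasurable_itv _)).
  by rewrite setTI (_ : _ @^-1` _ = [set w | t%:E < exit_part U m (fun=> 0) w])//;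
    apply/seteqP; split => w /=; rewrite in_itv/= andbT.
apply/seteqP; split=> [w /=|w [m _ /= h]].
  by rewrite in_itv/= andbT => /ereal_sup_gt[_ [m _ <-] h]; exists m.
rewrite in_itv/= andbT; apply: (lt_le_trans h); apply: ereal_sup_ubound; by exists m.
Qed.

End metrizable.
End hitting_time.

Lemma indic_bool (T : Type) (R : pzRingType) (b : T -> bool) w :
  \1_[set w | b w] w = (b w)%:R :> R.
Proof. by rewrite indicE; congr (_%:R); congr nat_of_bool; apply/idP/idP => [/set_mem//|/mem_set]. Qed.

(** Counterpart of [completed_expectation_ae] for two functions that are both measurable only after
    completion, as those built from stopping times are. *)
Lemma completed_expectation_null (d : measure_display) (T : measurableType d)
    (R : realType) (mu : probability T R) (f g : T -> \bar R) (N : set T) :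
  measurable_fun setT (f : caratheodory_type (mu_ext mu) -> \bar R) ->
  measurable_fun setT (g : caratheodory_type (mu_ext mu) -> \bar R) ->
  (forall w, 0 <= f w) -> (forall w, 0 <= g w) ->
  measurable N -> mu N = 0 -> (forall w, ~ N w -> f w = g w) ->
  completed_expectation mu f = completed_expectation mu g.
Proof.
move=> mf mg f0 g0 mN N0 fg.
have [mN' cN0] := completed_null mN N0 (@subset_refl _ N).
apply: ge0_ae_eq_integral => //.
exists N; split => // w /= h; apply: contrapT => nN; apply: h => _; exact: fg.
Qed.

(** * The killed semigroup at a stopping time *)

Section strong_markov_exit.
Context (R : realType) (M : topologicalType) (d : measure_display)
  (Omega : measurableType d).
Variables (X : \bar R -> Omega -> cemetery_ext M)
  (P : cemetery_ext M -> probability Omega R)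
  (theta : \bar R -> Omega -> Omega).
Hypothesis hX : hunt_process X P theta.
Variable K : nat -> set M.
Hypothesis cK : forall i, compact (K i).
Hypothesis baseK : forall (G : set M) x, open G -> G x ->
  exists2 i, (K i)^° x & K i `<=` G.
Hypothesis hM : hausdorff_space M.

Local Notation E := (borel_cemetery_ext M).
Local Notation F := (completed_filtration X P).
Local Notation nOmega t := (g_sigma_algebraType (natural_gen X t)).
Local Notation cOmega y := (caratheodory_type (mu_ext (P y))).

Lemma null_sets_dirac (y : E) N : null_sets X P (@dirac _ E y R) N ->
  exists L, [/\ measurable L, N `<=` L & P y L = 0].
Proof.
move=> [L [nL NL PL]]; have mL := natural_sub_measurable hX nL.
exists L; split => //; rewrite -PL /Pmu (Emu_dirac P hM); last by move=> w; rewrite lee_fin.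
by rewrite Ex_indic ?completed_measureE//; exact: completed_measurable.
Qed.

Lemma ext0_ge0 (u : M -> \bar R) : (forall x, 0 <= u x) ->
  forall y : cemetery_ext M, 0 <= ext0 u y.
Proof. by move=> u0 [x|] /=. Qed.

Lemma measurable_ext0 (u : M -> \bar R) : measurable_wrt (@borel M) u ->
  measurable_fun setT (ext0 u : E -> \bar R).
Proof. by move=> mu; exact: measurable_cemetery_fun. Qed.

Lemma measurable_ext0_X (y : E) (u : M -> \bar R) (t : \bar R) : 0 <= t ->
  measurable_wrt (@borel M) u ->
  measurable_fun setT (fun w : cOmega y => ext0 u (X t w)).
Proof.
move=> t0 mu.
have mf : measurable_fun setT (fun w : Omega => ext0 u (X t w)).
  exact: measurableT_comp (measurable_ext0 mu) (measurable_X_fun hX t0).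
exact: (completed_measurable_fun mf).
Qed.

Section killed.
Variables (U : set M) (t : R) (u : M -> \bar R).
Hypotheses (oU : open U) (t0 : (0 <= t)%R) (mu : measurable_wrt (@borel M) u)
  (u0 : forall x, 0 <= u x).

Let alive : set (R * nOmega +oo) := [set z | (0 <= z.1 <= t)%R /\
  (t - z.1)%:E < exit_limit X K U (fun=> 0) z.2].

(* The exit time from [U] is replaced by its version [exit_limit], which is
   measurable for the natural filtration, without completion. *)
Definition killed_functional : R * nOmega +oo -> \bar R :=
  (fun z => ext0 u (X (t - z.1)%:E z.2)) \_ alive.

Let measurable_alive : measurable alive.
Proof.
have msub : measurable_fun setT (fun z : R * nOmega +oo => (t - z.1)%:E).
  by apply/measurable_EFinP; apply: measurable_funB => //; exact: measurable_fst.
have mexit : measurable_fun setT (fun z : R * nOmega +oo => exit_limit X K U (fun=> 0) z.2).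
  exact: measurableT_comp (measurable_exit_limit hX cK hM U) measurable_snd.
have m1 : measurable [set z : R * nOmega +oo | (0 <= z.1 <= t)%R].
  rewrite (_ : [set _ | _] = setT `&` fst @^-1` `[0%R, t]%classic).
    exact: (measurable_fst measurableT _ (measurable_itv _)).
  by rewrite setTI; apply/seteqP; split => z /=; rewrite in_itv.
have m2 : measurable [set z : R * nOmega +oo | (t - z.1)%:E < exit_limit X K U (fun=> 0) z.2].
  by rewrite -[X in measurable X]setTI; exact: emeasurable_fun_lt.
exact: measurableI.
Qed.

Lemma measurable_killed_functional : measurable_fun setT killed_functional.
Proof.
apply: (measurable_restrictT _ measurable_alive).1.
have mfX : measurable_fun alive (fun z : R * nOmega +oo => X (t - z.1)%:E z.2 : E).
  move=> _ V bV.
  (* The horizon is t + 1 because [progressive] asks for times strictly below the horizon, while t -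
     s may equal [t]. *)
  have mphi : measurable_fun setT (fun z : R * nOmega +oo =>
      ((t - z.1)%:E, z.2 : nOmega (t + 1)%:E)).
    apply: measurable_fun_pair.
      by apply/measurable_EFinP; apply: measurable_funB => //; exact: measurable_fst.
    move=> _ A mA.
    apply: (measurable_snd measurableT (A : set (nOmega +oo))).
    by apply: natural_mono mA; rewrite leey.
  rewrite (_ : _ `&` _ = alive `&` (setT `&` (fun z : R * nOmega +oo =>
      ((t - z.1)%:E, z.2 : nOmega (t + 1)%:E)) @^-1`
      [set z | [/\ 0 <= z.1, z.1 < (t + 1)%:E & V (X z.1 z.2)]])).
    have mprog : measurable [set z : \bar R * nOmega (t + 1)%:E |
        [/\ 0 <= z.1, z.1 < (t + 1)%:E & V (X z.1 z.2)]].
      exact: (progressive hX cK baseK hM).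
    by apply: measurableI; [exact: measurable_alive|exact: (mphi measurableT _ mprog)].
  apply/seteqP; split => [z [az Vz]|z [az [_ [_ _ Vz]]]]; split => //; split => //=.
  have [/andP[z0 zt] _] := az.
  by split=> //; rewrite ?lee_fin ?lte_fin; lra.
exact: (measurable_comp (F := setT)) (measurable_ext0 mu) mfX.
Qed.

Lemma killed_functional_ge0 z : 0 <= killed_functional z.
Proof. by rewrite /killed_functional patchE; case: ifPn => // _; exact: ext0_ge0. Qed.

Lemma killed_functionalE (s : R) w : (0 <= s <= t)%R ->
  killed_functional (s, w) = ext0 u (X (t - s)%:E w) *
    (\1_[set w : Omega | ((t - s)%:E < exit_limit X K U (fun=> 0) w)%E] w)%:E.
Proof.
move=> st; rewrite /killed_functional patchE indicE.
have -> : ((s, w) \in alive) =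
    (w \in [set w : Omega | ((t - s)%:E < exit_limit X K U (fun=> 0) w)%E]).
  by apply/idP/idP => /set_mem h; apply/mem_set; [case: h|split].
by case: ifPn; rewrite ?mule1 ?mule0.
Qed.

Lemma killed_semigroupE (s : R) (y : E) : (0 <= s <= t)%R ->
  ext0 (killed_semigroup X P U (t - s) u) y = \int[P y]_w killed_functional (s, w).
Proof.
move=> st; have ts0 : (0 <= t - s)%R by lra.
have mf : measurable_fun setT (fun w : Omega => killed_functional (s, w)).
  have := measurable_fun_pair2 s measurable_killed_functional.
  by move=> mk; exact: measurableT_comp mk (measurable_to_natural hX).
case: y => [x|] /=.
  have [L [mL NL L0]] := null_sets_dirac (y := Some x)
    (exit_limit_ae hX cK baseK hM _ oU (stopping_time_cst X P (lexx 0))).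
  apply: completed_expectation_ae mL L0 _ => //.
    by move=> w; exact: killed_functional_ge0.
  move=> w nLw; rewrite killed_functionalE// /exit_time.
  have e : exit_limit X K U (fun=> 0) w = exit_after X [set Some x | x in U] (fun=> 0) w.
    by apply: contrapT => h; apply: nLw; exact: NL.
  by rewrite !indic_bool e.
rewrite -(ge0_completed_expectationE _ mf); last by move=> w; exact: killed_functional_ge0.
(* From Delta the path is almost surely at Delta at time t - s, so the right-hand side is 0 as
   well. *)
have mN : measurable (~` (X (t - s)%:E @^-1` [set None]) : set Omega).
  by apply: measurableC; apply: (measurable_X hX) => //; exact: borel_None.
have N0 : P None (~` (X (t - s)%:E @^-1` [set None])) = 0.
  rewrite probability_setC; last by apply: (measurable_X hX) => //; exact: borel_None.
  by rewrite (hunt_cemetery hX) ?lee_fin// subee.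
rewrite (completed_expectation_ae (f := cst 0) _ _ mN N0)//; first by rewrite integral0.
move=> w /contrapT /= XN; rewrite killed_functionalE// XN /=; by rewrite mul0e.
Qed.

(** The remaining time on the shifted path becomes the absolute time [t], so the killed functional
    evaluated there records that the path has not left [U] between [sigma] and [t]. The
    measurability half later gives integrability for signed [u]. *)
Lemma strong_markov_exit sigma (y : E) : stopping_time F sigma ->
  measurable_fun setT (fun w : cOmega y => (\1_[set w | (sigma w <= t%:E)%E] w)%:E *
    ext0 (killed_semigroup X P U (t - fine (sigma w))%R u) (X (sigma w) w)) /\
  Ex P y (fun w => (\1_[set w | (sigma w <= t%:E)%E] w)%:E *
    ext0 (killed_semigroup X P U (t - fine (sigma w))%R u) (X (sigma w) w)) =
  Ex P y (fun w => ext0 u (X t%:E w) *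
    (\1_[set w | (sigma w <= t%:E < exit_after X (Some @` U) sigma w)%E] w)%:E).
Proof.
move=> st.
have fin w : sigma w <= t%:E -> (0 <= fine (sigma w) <= t)%R /\ sigma w = (fine (sigma w))%:E.
  have := st.1 w; case: (sigma w) => [s| |]//=; by rewrite !lee_fin => -> ->.
have mle : measurable ([set w | sigma w <= t%:E] : set (cOmega y)).
  by apply: (completed_filtration_measurable hX hM) (st.2 t%:E _); rewrite lee_fin.
have [mh Eh] := strong_markov_functional hX hM y t st measurable_killed_functional
  killed_functional_ge0.
have e1 : (fun w => (\1_[set w | (sigma w <= t%:E)%E] w)%:E *
    ext0 (killed_semigroup X P U (t - fine (sigma w))%R u) (X (sigma w) w)) =
  (fun w => (\1_[set w | (sigma w <= t%:E)%E] w)%:E *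
    \int[P (X (sigma w) w)]_w' killed_functional (fine (sigma w), w')).
  apply/funext => w; rewrite indicE; case: (boolP (w \in _)) => [/set_mem /= sw|_].
    by rewrite killed_semigroupE//; exact: (fin w sw).1.
  by rewrite !mul0e.
have mind (A : set (cOmega y)) : measurable A ->
    measurable_fun setT (fun w : cOmega y => (\1_A w)%:E : \bar R).
  by move=> mA; apply/measurable_EFinP; exact: measurable_indic.
rewrite e1; split.
  by apply: emeasurable_funM mh; exact: mind.
rewrite {1}/Ex /completed_expectation -Eh.
have stT := stopping_time_sup (fun m => stopping_exit_part hX cK hM U m st)
  (fun w => erefl (exit_limit X K U sigma w)).
have ste := stopping_exit hX cK baseK hM oU st.
have mset tau : stopping_time F tau ->
    measurable ([set w | (sigma w <= t%:E < tau w)%E] : set (cOmega y)).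
  move=> sttau; apply: (completed_filtration_measurable hX hM (t := t%:E)).
  rewrite (_ : [set _ | _] = [set w | sigma w <= t%:E] `&` ~` [set w | tau w <= t%:E]).
    apply: completed_filtrationI; first by apply: st.2; rewrite lee_fin.
    by apply: completed_filtrationC; apply: sttau.2; rewrite lee_fin.
  apply/seteqP; split => w /=; first by move=> /andP[-> h]; split => //; apply/negP; rewrite -ltNge.
  by move=> [-> /negP]; rewrite -ltNge.
have mX := measurable_ext0_X (y := y) (ltac:(by rewrite lee_fin) : 0 <= t%:E) mu.
have e2 : (fun w => (\1_[set w | (sigma w <= t%:E)%E] w)%:E *
    killed_functional (fine (sigma w), theta (sigma w) w)) =
  (fun w => ext0 u (X t%:E w) *
    (\1_[set w | (sigma w <= t%:E < exit_limit X K U sigma w)%E] w)%:E).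
  apply/funext => w; rewrite !indic_bool; have [sw|_] := boolP (sigma w <= t%:E); last first.
    by rewrite mul0e mule0.
  have [/andP[f0 ft] fE] := fin w sw.
  rewrite mul1e killed_functionalE ?f0// [in theta _ _]fE (shift_X hX) ?lee_fin ?subr_ge0//.
  rewrite -EFinD subrK indic_bool; congr (_ * (_%:R)%:E); congr nat_of_bool.
  by apply/idP/idP => /(exit_limit_shift hX K U t f0 fE).
rewrite e2.
have [L [mL NL L0]] := null_sets_dirac (exit_limit_ae hX cK baseK hM (@dirac _ E y R) oU st).
apply: (completed_expectation_null _ _ _ _ mL L0).
- by apply: (emeasurable_funM mX); apply: mind; exact: mset.
- by apply: (emeasurable_funM mX); apply: mind; exact: mset.
- by move=> w; apply: mule_ge0; [exact: ext0_ge0|rewrite lee_fin].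
- by move=> w; apply: mule_ge0; [exact: ext0_ge0|rewrite lee_fin].
- move=> w nLw; rewrite !indic_bool (_ : exit_limit X K U sigma w = exit_after X (Some @` U) sigma w)//.
  by apply: contrapT => h; apply: nLw; exact: NL.
Qed.

End killed.
End strong_markov_exit.

(** * Decomposition along the successive entrances into B *)

Lemma cvg_eseriesB (R : realType) (a b c : (\bar R)^nat) :
  (forall k, a k = b k - c k) -> (forall k, c k \is a fin_num) ->
  cvgn (fun n => \sum_(0 <= k < n) b k) -> cvgn (fun n => \sum_(0 <= k < n) c k) ->
  \sum_(k <oo) b k \is a fin_num ->
  \sum_(0 <= k < n) a k @[n --> \oo] --> \sum_(k <oo) b k - \sum_(k <oo) c k.
Proof.
move=> abc cfin cb cc bfin.
have -> : (fun n => \sum_(0 <= k < n) a k) =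
    (fun n => \sum_(0 <= k < n) b k - \sum_(0 <= k < n) c k).
  apply/funext => n; rewrite -fin_num_sumeN; last by move=> k _; exact: cfin.
  by rewrite -big_split; apply: eq_bigr => k _; exact: abc.
by apply: cvgeB cb cc; rewrite fin_num_adde_defr.
Qed.

Section alternation.
Context (R : realType) (M : topologicalType) (d : measure_display)
  (Omega : measurableType d).
Variables (X : \bar R -> Omega -> cemetery_ext M)
  (P : cemetery_ext M -> probability Omega R)
  (theta : \bar R -> Omega -> Omega).
Hypothesis hX : hunt_process X P theta.
Variable K : nat -> set M.
Hypothesis cK : forall i, compact (K i).
Hypothesis baseK : forall (G : set M) x, open G -> G x ->
  exists2 i, (K i)^° x & K i `<=` G.
Hypothesis hM : hausdorff_space M.
(** Indices start at 0 in this section, so [tau 0] is the first exit time, written with index 1 in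
    the final statement. *)
Variables (U B : set M) (tau sigma : nat -> Omega -> \bar R).
Hypotheses (oU : open U) (bB : borel B) (clBU : closure B `<=` U)
  (tau0 : tau 0%N = exit_time X (Some @` U))
  (sigmaE : forall n, sigma n = hitting_after X (Some @` B) (tau n))
  (tauS : forall n, tau n.+1 = exit_after X (Some @` U) (sigma n)).

Local Notation E := (borel_cemetery_ext M).
Local Notation F := (completed_filtration X P).
Local Notation cP y := (@completed_measure_extension _ _ _ (P y)).
Local Notation cOmega y := (caratheodory_type (mu_ext (P y))).

Lemma stopping_tau_sigma n : stopping_time F (tau n) /\ stopping_time F (sigma n).
Proof.
have sts m : stopping_time F (tau m) -> stopping_time F (sigma m).
  move=> st; rewrite sigmaE.
  by apply: (stopping_hitting_borel hX cK baseK hM _ st); exact: borel_Some.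
elim: n => [|n [_ st]].
  suff st : stopping_time F (tau 0%N) by split => //; exact: sts.
  by rewrite tau0; apply: (stopping_exit hX cK baseK hM oU); exact: stopping_time_cst.
suff st' : stopping_time F (tau n.+1) by split => //; exact: sts.
by rewrite tauS; exact: (stopping_exit hX cK baseK hM oU).
Qed.

Lemma tau_le_sigma n w : tau n w <= sigma n w.
Proof. by rewrite sigmaE; exact: hitting_after_ge. Qed.

Lemma sigma_le_tau n w : sigma n w <= tau n.+1 w.
Proof. by rewrite tauS; exact: hitting_after_ge. Qed.

Lemma tau_mono w : {homo tau^~ w : m n / (m <= n)%N >-> m <= n}.
Proof.
apply: homo_leq => [y//|y x z|n]; first exact: le_trans.
exact: le_trans (tau_le_sigma n w) (sigma_le_tau n w).
Qed.

Lemma sigma_mono w : {homo sigma^~ w : m n / (m <= n)%N >-> m <= n}.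
Proof.
apply: homo_leq => [y//|y x z|n]; first exact: le_trans.
exact: le_trans (sigma_le_tau n w) (tau_le_sigma n.+1 w).
Qed.

Lemma X_tau n w : tau n w < +oo -> ~ (Some @` U : set (cemetery_ext M)) (X (tau n w) w).
Proof.
have clU : closed (~` (Some @` U) : set (cemetery_ext M)).
  by apply: open_closedC; exact: one_point_compactification_open_some.
case: n => [|n]; rewrite ?tau0 ?tauS; exact: (hitting_after_closed hX _ clU).
Qed.

Lemma X_sigma n w : sigma n w < +oo ->
  ~ (Some @` (~` closure B) : set (cemetery_ext M)) (X (sigma n w) w).
Proof.
rewrite sigmaE; apply: (@hitting_after_closed _ _ _ _ _ _ _ hX _ (~` (Some @` (~` closure B)))).
  by move=> _ [y By <-] [z nBz [zy]]; apply: nBz; rewrite zy; exact: subset_closure.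
apply: open_closedC; apply: one_point_compactification_open_some.
by apply: closed_openC; exact: closed_closure.
Qed.

Definition alternation_limit (w : Omega) : \bar R := ereal_sup [set tau n w | n in setT].

Lemma alternation_limit_ae mu : null_sets X P mu
  [set w | alternation_limit w < +oo /\ X (alternation_limit w) w <> None].
Proof.
have oG1 : open (Some @` U : set (cemetery_ext M)).
  exact: one_point_compactification_open_some.
have oG2 : open (Some @` (~` closure B) : set (cemetery_ext M)).
  by apply: one_point_compactification_open_some; apply: closed_openC; exact: closed_closure.
have limE w : alternation_limit w = ereal_sup [set sigma n w | n in setT].
  apply/eqP; rewrite eq_le; apply/andP; split; apply: ge_ereal_sup => _ [n _ <-].
    by apply: le_trans (tau_le_sigma n w) (ereal_sup_ubound _); exists n.
  by apply: le_trans (sigma_le_tau n w) (ereal_sup_ubound _); exists n.+1.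
have N1 := quasi_left_avoid hX hM (fun n => (stopping_tau_sigma n).1) tau_mono
  (fun w => erefl (alternation_limit w)) (fun=> oG1) (fun _ _ _ => @subset_refl _ _) X_tau mu.
have N2 := quasi_left_avoid hX hM (fun n => (stopping_tau_sigma n).2) sigma_mono
  limE (fun=> oG2) (fun _ _ _ => @subset_refl _ _) X_sigma mu.
apply: null_sets_sub (null_setsU hX hM N1 N2) => w [loo].
case XE: (X (alternation_limit w) w) => [y|//] _.
have [Uy|nUy] := pselect (U y).
  by left; split => //; exists 0%N => //; rewrite XE; exists y.
by right; split => //; exists 0%N => //; rewrite XE; exists y => // /clBU.
Qed.

Section time.
Variables (t : R) (t0 : (0 <= t)%R).

Definition phase n : set Omega :=
  if n is m.+1 then [set w | (sigma m w <= t%:E < tau m.+1 w)%E]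
  else [set w | (t%:E < tau 0%N w)%E].

Lemma phase_lt_tau n : phase n `<=` [set w | t%:E < tau n w].
Proof. by case: n => [//|n] w /= /andP[]. Qed.

Lemma trivIset_phase : trivIset setT phase.
Proof.
have lt_disj i j w : phase i w -> phase j w -> (i < j)%N -> False.
  move=> /phase_lt_tau /= ti; case: j => [//|j] /= /andP[sj _]; rewrite ltnS => ij.
  have := le_trans (le_trans (tau_mono w ij) (tau_le_sigma j w)) sj.
  by rewrite leNgt ti.
apply/trivIsetP => i j _ _; rewrite neq_ltn => ij.
apply/seteqP; split=> // w [wi wj].
by case/orP: ij => [/(lt_disj _ _ w wi wj)|/(lt_disj _ _ w wj wi)].
Qed.

Lemma completed_filtration_phase n : F t%:E (phase n).
Proof.
have tE : 0 <= t%:E by rewrite lee_fin.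
have Ft m : F t%:E [set w | t%:E < tau m w].
  rewrite (_ : [set _ | _] = ~` [set w | tau m w <= t%:E]).
    by apply: completed_filtrationC; apply: (stopping_tau_sigma m).1.2.
  by apply/seteqP; split=> w /=; rewrite ltNge => /negP.
case: n => [|n] /=; first exact: Ft.
rewrite (_ : [set _ | _] = [set w | sigma n w <= t%:E] `&` [set w | t%:E < tau n.+1 w]).
  by apply: completed_filtrationI => //; apply: (stopping_tau_sigma n).2.2.
by apply/seteqP; split=> w /= => [/andP[]//|[-> ->]].
Qed.

Lemma outside_phases w :
  ~ (alternation_limit w < +oo /\ X (alternation_limit w) w <> None) ->
  ~ (\bigcup_n phase n) w -> ~ (Some @` B : set (cemetery_ext M)) (X t%:E w).
Proof.
move=> lim_None nph BX.
have tE : 0 <= t%:E by rewrite lee_fin.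
have [lt_t|t_lt] := leP (alternation_limit w) t%:E.
  have l0 : 0 <= alternation_limit w.
    by apply: le_trans ((stopping_tau_sigma 0).1.1 w) (ereal_sup_ubound _); exists 0%N.
  have XN : X (alternation_limit w) w = None.
    apply: contrapT => h; apply: lim_None; split => //.
    by apply: le_lt_trans lt_t _; rewrite ltry.
  by move: BX; rewrite (X_None_after hX l0 lt_t XN) => -[].
(* For the least such index n+1 the previous exit time is at most [t]; being in [B] at time [t] then
   forces sigma n <= t, and [t] lies in the corresponding phase. *)
have /ex_minnP[n tn min_n] : exists n, t%:E < tau n w.
  by move/ereal_sup_gt: t_lt => [_ [n _ <-]]; exists n.
case: n tn min_n => [|n] tn min_n; first by apply: nph; exists 0%N.
have tau_t : tau n w <= t%:E by rewrite leNgt; apply/negP => /min_n; rewrite ltnn.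
by apply: nph; exists n.+1 => //=; rewrite tn andbT sigmaE; exact: hitting_after_le.
Qed.

Lemma expectation_phases (u : M -> \bar R) (y : E) : measurable_wrt (@borel M) u ->
  (forall x, 0 <= u x) -> (forall x, ~ B x -> u x = 0) ->
  Ex P y (fun w => ext0 u (X t%:E w)) =
  \sum_(n <oo) Ex P y (fun w => ext0 u (X t%:E w) * (\1_(phase n) w)%:E).
Proof.
move=> mu u0 uB; have tE : 0 <= t%:E by rewrite lee_fin.
have mX := measurable_ext0_X hX (P := P) (y := y) tE mu.
have mph n : measurable (phase n : set (cOmega y)).
  exact: (completed_filtration_measurable hX hM) (completed_filtration_phase n).
have mU : measurable (\bigcup_n phase n : set (cOmega y)) by exact: bigcupT_measurable.
have restrictE (A : set (cOmega y)) :
    Ex P y (fun w => ext0 u (X t%:E w) * (\1_A w)%:E) = \int[cP y]_(w in A) ext0 u (X t%:E w).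
  by rewrite [RHS]integral_mkcond epatch_indic.
have [L [mL NL L0]] := null_sets_dirac hX hM (alternation_limit_ae (@dirac _ E y R)).
transitivity (Ex P y (fun w => ext0 u (X t%:E w) * (\1_(\bigcup_n phase n) w)%:E)).
  apply: (completed_expectation_null mX _ _ _ mL L0).
  - by apply: (emeasurable_funM mX); apply/measurable_EFinP; exact: measurable_indic.
  - by move=> w; exact: ext0_ge0.
  - by move=> w; apply: mule_ge0; [exact: ext0_ge0|rewrite lee_fin].
  - move=> w nLw; rewrite indicE; case: (boolP (w \in _)) => [_|/negP nph]; first by rewrite mule1.
    rewrite mule0; have nB : ~ (Some @` B : set (cemetery_ext M)) (X t%:E w).
      apply: outside_phases; first by move=> h; apply: nLw; exact: NL.
      by move=> h; apply: nph; apply/mem_set.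
    by case: (X t%:E w) nB => [z|//] nB /=; apply: uB => Bz; apply: nB; exists z.
rewrite restrictE (ge0_integral_bigcup _ mph); first last.
- exact: trivIset_phase.
- by move=> w _; exact: ext0_ge0.
- exact: (measurable_funS measurableT).
- by apply: eq_eseriesr => n _; rewrite restrictE.
Qed.

Variable x : M.

(** Where sigma n > t the second factor has no meaning as a killed expectation, but the indicator
    vanishes and 0 times any extended real is 0. *)
Definition excursion_term (u : M -> \bar R) (n : nat) : \bar R :=
  Ex P (Some x) (fun w => (\1_[set w | (sigma n w <= t%:E)%E] w)%:E *
    ext0 (killed_semigroup X P U (t - fine (sigma n w))%R u) (X (sigma n w) w)).

Lemma excursion_term_ge0 u n : (forall x, 0 <= u x) -> 0 <= excursion_term u n.
Proof.
move=> u0; apply: integral_ge0 => w _; apply: mule_ge0; first by rewrite lee_fin.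
apply: ext0_ge0 => z; apply: integral_ge0 => w' _.
by apply: mule_ge0; [exact: ext0_ge0|rewrite lee_fin].
Qed.

Lemma ge0_semigroup_excursions u : measurable_wrt (@borel M) u ->
  (forall x, 0 <= u x) -> (forall x, ~ B x -> u x = 0) ->
  semigroup X P t u x = killed_semigroup X P U t u x + \sum_(n <oo) excursion_term u n.
Proof.
move=> mu u0 uB.
have phase_ge0 n : 0 <= Ex P (Some x) (fun w => ext0 u (X t%:E w) * (\1_(phase n) w)%:E).
  apply: integral_ge0 => w _.
  by apply: mule_ge0; [exact: ext0_ge0|rewrite lee_fin].
rewrite /semigroup (expectation_phases _ mu u0 uB).
rewrite (nneseries_recl (fun n _ => phase_ge0 n) isT) -(nneseries_addn 1%N phase_ge0).
have -> : killed_semigroup X P U t u x =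
    Ex P (Some x) (fun w => ext0 u (X t%:E w) * (\1_(phase 0) w)%:E).
  by rewrite /killed_semigroup /phase tau0.
have e n : Ex P (Some x) (fun w => ext0 u (X t%:E w) * (\1_(phase (n + 1)) w)%:E) =
    excursion_term u n.
  have [_ eE] := strong_markov_exit hX cK baseK hM oU t0 mu u0 (Some x) (stopping_tau_sigma n).2.
  by rewrite addn1 /excursion_term eE -tauS.
by rewrite (eq_eseriesr (fun n _ => e n)).
Qed.

(** * Bounded functions of either sign *)

Lemma funepos_ext0 (u : M -> \bar R) (T : Type) (Y : T -> cemetery_ext M) A w :
  (fun w => ext0 u (Y w) * (\1_A w)%:E)^\+ w = ext0 u^\+ (Y w) * (\1_A w)%:E.
Proof.
rewrite funeposE indicE; case: (_ \in _); last by rewrite !mule0 maxxx.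
by rewrite !mule1; case: (Y w) => [z|]; rewrite /= ?funeposE// maxxx.
Qed.

Lemma funeneg_ext0 (u : M -> \bar R) (T : Type) (Y : T -> cemetery_ext M) A w :
  (fun w => ext0 u (Y w) * (\1_A w)%:E)^\- w = ext0 u^\- (Y w) * (\1_A w)%:E.
Proof.
rewrite funenegE indicE; case: (_ \in _); last by rewrite !mule0 oppe0 maxxx.
by rewrite !mule1; case: (Y w) => [z|]; rewrite /= ?funenegE// oppr0 maxxx.
Qed.

(** The integral is by definition the difference of the integrals of the two parts, and multiplying
    by an indicator commutes with taking parts. *)
Lemma killed_semigroup_posneg V s (u : M -> \bar R) z : killed_semigroup X P V s u z =
  killed_semigroup X P V s u^\+ z - killed_semigroup X P V s u^\- z.
Proof.
rewrite /killed_semigroup {1}/Ex /completed_expectation integralE.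
by congr (_ - _); apply: eq_integral => w _; rewrite ?funepos_ext0 ?funeneg_ext0.
Qed.

Lemma semigroup_posneg (u : M -> \bar R) z :
  semigroup X P t u z = semigroup X P t u^\+ z - semigroup X P t u^\- z.
Proof.
have e v : (fun w => ext0 v (X t%:E w)) = (fun w => ext0 v (X t%:E w) * (\1_setT w)%:E).
  by apply/funext => w; rewrite indicT mule1.
rewrite /semigroup !e {1}/Ex /completed_expectation integralE.
by congr (_ - _); apply: eq_integral => w _; rewrite ?funepos_ext0 ?funeneg_ext0.
Qed.

Lemma Ex_bounded y (f : Omega -> \bar R) (C : R) : (forall w, 0 <= f w <= C%:E) ->
  0 <= Ex P y f <= C%:E.
Proof.
move=> fC; apply/andP; split.
  by apply: integral_ge0 => w _; case/andP: (fC w).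
apply: (@le_trans _ _ (completed_expectation (P y) (cst C%:E))).
  by apply: ge0_le_completed_expectation => w; case/andP: (fC w).
have C0 : 0 <= C%:E by have /andP[] := fC point; exact: le_trans.
rewrite ge0_completed_expectationE// integral_cst//.
by rewrite [X in _ * X](_ : _ = 1) ?mule1//; exact: probability_setT.
Qed.

Lemma killed_semigroup_bounded V s (u : M -> \bar R) (C : R) z :
  (forall x, 0 <= u x <= C%:E) -> 0 <= killed_semigroup X P V s u z <= C%:E.
Proof.
move=> uC; have C0 : 0 <= C%:E by have /andP[] := uC z; exact: le_trans.
apply: Ex_bounded => w; rewrite indicE; case: (_ \in _); rewrite ?mule0 ?mule1 ?lexx//.
by case: (X _ _) => [z'|] //=; rewrite lexx.
Qed.

Lemma measurable_funepos_wrt (u : M -> \bar R) : measurable_wrt (@borel M) u ->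
  measurable_wrt (@borel M) u^\+ /\ measurable_wrt (@borel M) u^\-.
Proof.
move=> mu; split=> V mV.
- rewrite (_ : u^\+ = (id : \bar R -> \bar R)^\+ \o u); last first.
    by apply/funext => z; rewrite /= !funeposE.
  rewrite comp_preimage; apply: (mu); rewrite -[X in measurable X]setTI.
  exact: (measurable_funepos (@measurable_id _ _ setT) measurableT).
- rewrite (_ : u^\- = (id : \bar R -> \bar R)^\- \o u); last first.
    by apply/funext => z; rewrite /= !funenegE.
  rewrite comp_preimage; apply: (mu); rewrite -[X in measurable X]setTI.
  exact: (measurable_funeneg (@measurable_id _ _ setT) measurableT).
Qed.

Lemma funeposneg_bounded (u : M -> \bar R) (C : R) : (forall z, `|u z| <= C%:E) ->
  (forall z, 0 <= u^\+ z <= C%:E) /\ (forall z, 0 <= u^\- z <= C%:E).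
Proof.
move=> uC; split=> z; rewrite ?funepos_ge0 ?funeneg_ge0 /=; apply: le_trans (uC z).
- by rewrite funeposE ge_max lee_abs abse_ge0.
- by rewrite funenegE ge_max abse_ge0 -abseN lee_abs.
Qed.

Lemma excursion_bounded n (u : M -> \bar R) (C : R) w : (forall z, 0 <= u z <= C%:E) ->
  0 <= (\1_[set w | (sigma n w <= t%:E)%E] w)%:E *
    ext0 (killed_semigroup X P U (t - fine (sigma n w))%R u) (X (sigma n w) w) <= C%:E.
Proof.
move=> uC; have C0 : 0 <= C%:E by have /andP[] := uC x; exact: le_trans.
rewrite indicE; case: (_ \in _); rewrite ?mul0e ?mul1e ?lexx//.
by case: (X _ _) => [z|] /=; [exact: killed_semigroup_bounded|rewrite lexx].
Qed.

(** Here the two functions subtracted are not the positive and negative parts of the integrand, so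
    linearity of the integral is used; integrability comes from the bound [C] under a
    probability. *)
Lemma excursion_term_posneg (u : M -> \bar R) (C : R) n : measurable_wrt (@borel M) u ->
  (forall z, `|u z| <= C%:E) ->
  excursion_term u n = excursion_term u^\+ n - excursion_term u^\- n.
Proof.
move=> mu uC; have [mup mun] := measurable_funepos_wrt mu.
have [upC unC] := funeposneg_bounded uC.
pose f v w : \bar R := (\1_[set w | (sigma n w <= t%:E)%E] w)%:E *
    ext0 (killed_semigroup X P U (t - fine (sigma n w))%R v) (X (sigma n w) w).
have fE w : f u w = f u^\+ w - f u^\- w.
  rewrite /f indicE; case: (_ \in _); last by rewrite !mul0e sube0.
  rewrite !mul1e; case: (X (sigma n w) w) => [z|] /=; last by rewrite sube0.
  exact: killed_semigroup_posneg.
have intf v : measurable_wrt (@borel M) v -> (forall z, 0 <= v z <= C%:E) ->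
    (cP (Some x)).-integrable setT (f v).
  move=> mv vC; have v0 z : 0 <= v z by case/andP: (vC z).
  apply/integrableP; split.
    exact: (strong_markov_exit hX cK baseK hM oU t0 mv v0 (Some x) (stopping_tau_sigma n).2).1.
  apply: (@le_lt_trans _ _ C%:E); last exact: ltry.
  have fC w := excursion_bounded n w vC.
  have fabs w : `|f v w| = f v w by rewrite gee0_abs//; case/andP: (fC w).
  have -> : (fun w => `|f v w|) = f v by apply/funext.
  by case/andP: (Ex_bounded (Some x) fC).
suff : \int[cP (Some x)]_w f u w =
    \int[cP (Some x)]_w f u^\+ w - \int[cP (Some x)]_w f u^\- w by exact.
have -> : f u = (fun w => f u^\+ w - f u^\- w) by apply/funext.
by apply: integralB; [exact: measurableT|exact: intf|exact: intf].
Qed.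

(** In the bounded case the identity for each part has a left-hand side of at most [C], so both
    nonnegative summands on the right are finite. The two series can then be subtracted termwise,
    and the signed series converges to the difference of the sums. *)
Lemma semigroup_excursions (u : M -> \bar R) : measurable_wrt (@borel M) u ->
  (forall z, 0 <= u z) \/ (exists C : R, forall z, `|u z| <= C%:E) ->
  (forall z, ~ B z -> u z = 0) ->
  exists2 S, \sum_(0 <= k < n) excursion_term u k @[n --> \oo] --> S &
    semigroup X P t u x = killed_semigroup X P U t u x + S.
Proof.
move=> mu [u0 uB|[C uC] uB].
  exists (\sum_(k <oo) excursion_term u k); last exact: ge0_semigroup_excursions.
  by apply: is_cvg_nneseries => n _ _; exact: excursion_term_ge0.
have [mup mun] := measurable_funepos_wrt mu.
have [upC unC] := funeposneg_bounded uC.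
have upB z : ~ B z -> u^\+ z = 0 by move=> /uB uz; rewrite funeposE uz maxxx.
have unB z : ~ B z -> u^\- z = 0 by move=> /uB uz; rewrite funenegE uz oppe0 maxxx.
have fin (f : \bar R) : 0 <= f <= C%:E -> f \is a fin_num.
  by move=> /andP[f0 fC]; rewrite ge0_fin_numE// (le_lt_trans fC) ?ltry.
have term_fin v k : (forall z, 0 <= v z <= C%:E) -> excursion_term v k \is a fin_num.
  by move=> vC; apply: fin; apply: Ex_bounded => w; exact: excursion_bounded.
have part v : measurable_wrt (@borel M) v -> (forall z, 0 <= v z <= C%:E) ->
    (forall z, ~ B z -> v z = 0) ->
    [/\ \sum_(0 <= k < n) excursion_term v k @[n --> \oo] --> \sum_(k <oo) excursion_term v k,
      \sum_(k <oo) excursion_term v k \is a fin_num, killed_semigroup X P U t v x \is a fin_num &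
      semigroup X P t v x = killed_semigroup X P U t v x + \sum_(k <oo) excursion_term v k].
  move=> mv vC vB; have v0 z : 0 <= v z by case/andP: (vC z).
  have sE := ge0_semigroup_excursions mv v0 vB.
  have sfin : semigroup X P t v x \is a fin_num.
    apply: fin; apply: Ex_bounded => w; have C0 : 0 <= C%:E by case/andP: (vC x); exact: le_trans.
    by case: (X t%:E w) => [z|] //=; rewrite lexx.
  have kfin : killed_semigroup X P U t v x \is a fin_num.
    by apply: fin; exact: killed_semigroup_bounded.
  split=> //; first by apply: is_cvg_nneseries => n _ _; exact: excursion_term_ge0.
  by move: sfin; rewrite sE fin_numD => /andP[].
have [cp fp kp sp] := part _ mup upC upB.
have [cn fn kn sn] := part _ mun unC unB.
exists (\sum_(k <oo) excursion_term u^\+ k - \sum_(k <oo) excursion_term u^\- k).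
  apply: (cvg_eseriesB _ _ cp cn).
  - by move=> k; exact: excursion_term_posneg mu uC.
  - by move=> k; exact: term_fin.
  - exact: fp.
rewrite semigroup_posneg killed_semigroup_posneg sp sn (fin_num_oppeD _ fn).
exact: addeACA.
Qed.

End time.
End alternation.

Theorem theorem3p3 (R : realType) (M : topologicalType)
  (M_loc_compact : locally_compact [set: M])
  (M_separable : separable_space M) (M_metrizable : metrizable R M)
  (d : measure_display) (Omega : measurableType d)
  (X : \bar R -> Omega -> cemetery_ext M)
  (P : cemetery_ext M -> probability Omega R)
  (theta : \bar R -> Omega -> Omega)
  (X_hunt : hunt_process X P theta)
  (U : set M) (U_open : open U) (U_nonempty : U !=set0)
  (B : set M) (B_borel : borel B) (B_closure : closure B `<=` U)
  (tau sigma : nat -> Omega -> \bar R)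
  (tau1 : tau 1%N = exit_time X (Some @` U))
  (sigmaE : forall n, (1 <= n)%N ->
    sigma n = hitting_after X (Some @` B) (tau n))
  (tauS : forall n, (1 <= n)%N ->
    tau n.+1 = exit_after X (Some @` U) (sigma n))
  (u : M -> \bar R) (u_borel : measurable_wrt (@borel M) u)
  (u_bounded : (forall x, 0 <= u x) \/ (exists C : R, forall x, `|u x| <= C%:E))
  (u_support : forall x, ~ B x -> u x = 0)
  (t : R) (t_ge0 : (0 <= t)%R) (x : M) :
  let term (n : nat) := Ex P (Some x) (fun w =>
    (\1_[set w | (sigma n w <= t%:E)%E] w)%:E *
    ext0 (killed_semigroup X P U (t - fine (sigma n w))%R u)
      (X (sigma n w) w)) in
  cvgn (fun n : nat => \sum_(1 <= k < n) term k) /\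
  semigroup X P t u x =
    killed_semigroup X P U t u x + \sum_(1 <= n <oo) term n.
Proof.
move=> term; have [rho [rho0 rhoC rhoD nbhs_rho]] := M_metrizable.
have hM := metrizable_hausdorff rho0 rhoC rhoD nbhs_rho.
have [K [cK baseK]] := metrizable_compact_base rhoC rhoD nbhs_rho M_loc_compact M_separable.
have [S termS ->] := semigroup_excursions X_hunt cK baseK hM
  (tau := fun n => tau n.+1) (sigma := fun n => sigma n.+1) U_open B_borel B_closure
  tau1 (fun n => sigmaE n.+1 isT) (fun n => tauS n.+1 isT) t_ge0 x u_borel u_bounded u_support.
have {}termS : \sum_(1 <= k < n) term k @[n --> \oo] --> S.
  rewrite -cvg_shiftS; under eq_fun do rewrite big_add1; exact: termS.
split; first by apply/cvg_ex; exists S.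
by congr (_ + _); apply/esym/cvg_lim.
Qed.
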